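(* Let $n\ge1$ and $m\ge 1$, let $X$ be a pointed, $(n-1)$-connected type and let $Y$ be a pointed, $(m-1)$-connected type. Then $X\wedge Y$ is $(n+m-1)$-connected, and $\pi_{n+m}(X\wedge Y)$ is the tensor product of $\pi_n(X)^{ab}$ and $\pi_m(Y)^{ab}$ in a natural way; that is, there is a map $$\pi_n(X)^{ab}\to_{\mathsf{Grp}}\bigl(\pi_m(Y)^{ab}\to_{\mathsf{Grp}}\pi_{n+m}(X\wedge Y)\bigr),$$ natural in $X$ and $Y$, which exhibits $\pi_{n+m}(X\wedge Y)$ as the tensor product of $\pi_n(X)^{ab}$ and $\pi_m(Y)^{ab}$.
   Context: Setting: homotopy type theory as in the HoTT Book, with a univalent universe $\mathcal U$ closed under higher inductive types (pushouts and truncations suffice) and function extensionality; no choice, excluded middle or Whitehead principle is assumed. All types lie in $\mathcal U$. A pointed type is a type with a basepoint; $X\to_\bullet Y:=\sum_{f:X\to Y}f(x_0)=y_0$. $\|X\|_k$ is the $k$-truncation and $\pi_k(X)=\|\Omega^kX\|_0$. A type $X$ is $k$-connected if $\|X\|_k$ is contractible. Groups are set-level ($0$-truncated underlying type). Smash product: $X\wedge Y$ is the higher inductive type with constructors $\mathsf{sm}:X\times Y\to X\wedge Y$, points $\mathsf{auxl},\mathsf{auxr}$, and paths $\mathsf{gluel}:\prod_{y:Y}\mathsf{sm}(x_0,y)=\mathsf{auxl}$, $\mathsf{gluer}:\prod_{x:X}\mathsf{sm}(x,y_0)=\mathsf{auxr}$, pointed by $\mathsf{sm}(x_0,y_0)$.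 It is functorial in pointed maps. Abelianization: $\eta:G\to G^{ab}$ is a homomorphism to an abelian group, initial among homomorphisms from $G$ to abelian groups. For a group $G$ and an abelian group $H$, the set $G\to_{\mathsf{Grp}}H$ of homomorphisms is an abelian group pointwise. A map $t:A\to_{\mathsf{Grp}}(B\to_{\mathsf{Grp}}T)$, with $A,B,T$ abelian groups, exhibits $T$ as the tensor product of $A$ and $B$ if for every abelian group $C$ composition with $t$ is an equivalence $t^*:(T\to_{\mathsf{Grp}}C)\to(A\to_{\mathsf{Grp}}B\to_{\mathsf{Grp}}C)$. Naturality is with respect to pointed maps $X\to_\bullet X'$, $Y\to_\bullet Y'$. *)

(* Defs.v *)
(** The ambient theory is a two-level type theory.  Rocq's own type theory is
    the outer (strict) level: its equality [=] plays the role of judgmental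
    equality.  The types of homotopy type theory are the Rocq types satisfying
    [Fib], those in the univalent universe are the ones satisfying [Small].
    The type formers other than identity types and higher inductive types are
    Rocq's own; the identity type [a == b] is abstract, and path induction
    eliminates only into [Fib] families.  Rocq's [=] cannot serve as identity
    type: it lives in the impredicative sort Prop and may satisfy UIP, either of
    which conflicts with univalence.  The abstract [==] is compatible with UIP,
    proof irrelevance and extensionality for [=] (simplicial presheaves, with
    Kan fibrations as the [Fib] families, are the intended semantics).  As in
    homotopy type theory itself, unrestricted classical logic is not available:
    deciding [=] uniformly by excluded middle and choice would contradict
    univalence.

    [Fib] and [Small] take values in SProp, so that no construction depends on
    how a type was shown to be fibrant or small. *)

Set Implicit Arguments.

(** * Type formers *)

Class Formers (F : Type -> SProp) := {
  formers_empty : F Empty_set;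
  formers_unit : F unit;
  formers_nat : F nat;
  formers_sum : forall A B : Type, F A -> F B -> F (A + B)%type;
  formers_prod : forall A B : Type, F A -> F B -> F (A * B)%type;
  formers_sig : forall (A : Type) (B : A -> Type),
    F A -> (forall a, F (B a)) -> F {a : A & B a};
  formers_pi : forall (A : Type) (B : A -> Type),
    F A -> (forall a, F (B a)) -> F (forall a : A, B a) }.

(** [U] is a universe in the style of Tarski whose decoding has as values
    exactly the small types; it is itself a type of the theory, so that it
    has a well-behaved identity type. *)
Class TypeTheory := {
  Fib : Type -> SProp;
  Small : Type -> SProp;
  small_fib : forall A : Type, Small A -> Fib A;
  fib_formers : Formers Fib;
  small_formers : Formers Small;

  Id : forall A : Type, A -> A -> Type;
  idp : forall (A : Type) (a : A), Id a a;
  fib_Id : forall (A : Type) (a b : A), Fib A -> Fib (Id a b);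
  small_Id : forall (A : Type) (a b : A), Small A -> Small (Id a b);
  J : forall (A : Type) (fA : Fib A) (a : A) (P : forall b, Id a b -> Type)
        (fP : forall b p, Fib (P b p)) (d : P a (idp a)),
      forall b (p : Id a b), P b p;
  J_idp : forall (A : Type) (fA : Fib A) (a : A) (P : forall b, Id a b -> Type)
        (fP : forall b p, Fib (P b p)) (d : P a (idp a)),
      J fA P fP d (idp a) = d;

  U : Type;
  fib_U : Fib U;
  El : U -> Type;
  small_El : forall u : U, Small (El u);
  code : forall A : Type, Small A -> U;
  El_code : forall (A : Type) (sA : Small A), El (code sA) = A }.

Existing Class Fib.
Existing Class Small.
#[export] Existing Instances fib_formers small_formers.
#[export] Existing Instances fib_Id small_Id fib_U small_El.
#[export] Existing Instance small_fib | 100.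

Section Instances.
Context {TT : TypeTheory}.

#[export] Instance fib_empty : Fib Empty_set := @formers_empty _ fib_formers.
#[export] Instance fib_unit : Fib unit := @formers_unit _ fib_formers.
#[export] Instance fib_nat : Fib nat := @formers_nat _ fib_formers.
#[export] Instance fib_sum (A B : Type) :
  Fib A -> Fib B -> Fib (A + B)%type := @formers_sum _ fib_formers A B.
#[export] Instance fib_prod (A B : Type) :
  Fib A -> Fib B -> Fib (A * B)%type := @formers_prod _ fib_formers A B.
#[export] Instance fib_sig (A : Type) (B : A -> Type) :
  Fib A -> (forall a, Fib (B a)) -> Fib (sigT B) :=
  @formers_sig _ fib_formers A B.
#[export] Instance fib_pi (A : Type) (B : A -> Type) :
  Fib A -> (forall a, Fib (B a)) -> Fib (forall a : A, B a) :=
  @formers_pi _ fib_formers A B.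

#[export] Instance small_empty : Small Empty_set :=
  @formers_empty _ small_formers.
#[export] Instance small_unit : Small unit := @formers_unit _ small_formers.
#[export] Instance small_nat : Small nat := @formers_nat _ small_formers.
#[export] Instance small_sum (A B : Type) :
  Small A -> Small B -> Small (A + B)%type := @formers_sum _ small_formers A B.
#[export] Instance small_prod (A B : Type) :
  Small A -> Small B -> Small (A * B)%type := @formers_prod _ small_formers A B.
#[export] Instance small_sig (A : Type) (B : A -> Type) :
  Small A -> (forall a, Small (B a)) -> Small (sigT B) :=
  @formers_sig _ small_formers A B.
#[export] Instance small_pi (A : Type) (B : A -> Type) :
  Small A -> (forall a, Small (B a)) -> Small (forall a : A, B a) :=
  @formers_pi _ small_formers A B.

End Instances.

Notation "x == y" := (Id x y) (at level 70, no associativity) : type_scope.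

Arguments idp {_ A} a.
Arguments J {_ A fA} a P {fP} d b p.
Arguments J_idp {_ A fA} a P {fP} d.
Arguments code {_} A {sA}.
Arguments El_code {_} A {sA}.

(** * Paths *)

Section Paths.
Context {TT : TypeTheory}.

Definition transport {A : Type} {fA : Fib A} (P : A -> Type)
  {fP : forall a, Fib (P a)} {a b : A} (p : a == b) (x : P a) : P b :=
  J a (fun b _ => P b) x b p.

Definition transport_idp {A : Type} {fA : Fib A} (P : A -> Type)
  {fP : forall a, Fib (P a)} {a : A} (x : P a) :
  transport P (idp a) x = x := J_idp a (fun b _ => P b) x.

Definition concat {A : Type} {fA : Fib A} {a b c : A}
  (p : a == b) (q : b == c) : a == c := transport (fun z => a == z) q p.

Definition inverse {A : Type} {fA : Fib A} {a b : A} (p : a == b) : b == a :=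
  transport (fun z => z == a) p (idp _).

Definition ap {A B : Type} {fA : Fib A} {fB : Fib B} (f : A -> B) {a b : A}
  (p : a == b) : f a == f b := transport (fun z => f a == f z) p (idp _).

Definition apd {A : Type} {fA : Fib A} {P : A -> Type}
  {fP : forall a, Fib (P a)} (f : forall a, P a) {a b : A} (p : a == b) :
  transport P p (f a) == f b :=
  J a (fun b p => transport P p (f a) == f b)
    (match eq_sym (transport_idp P (f a)) in _ = x return x == f a with
     | eq_refl => idp _ end) b p.

Definition happly {A : Type} {fA : Fib A} {B : A -> Type}
  {fB : forall a, Fib (B a)} {f g : forall a, B a} (p : f == g) :
  forall a, f a == g a := fun a => ap (fun h => h a) p.

Definition eq_to_id {A : Type} {a b : A} (e : a = b) : a == b :=
  match e in _ = z return a == z with eq_refl => idp _ end.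

(** * Equivalences and truncation levels *)

Definition IsEquiv {A B : Type} (f : A -> B) : Type :=
  ({g : B -> A & forall a, g (f a) == a} *
   {h : B -> A & forall b, f (h b) == b})%type.

Definition Equiv (A B : Type) : Type := {f : A -> B & IsEquiv f}.

#[export] Instance fib_IsEquiv {A B : Type} (f : A -> B) :
  Fib A -> Fib B -> Fib (IsEquiv f).
Proof. unfold IsEquiv; intros. exact _. Qed.

#[export] Instance fib_Equiv {A B : Type} : Fib A -> Fib B -> Fib (Equiv A B).
Proof. unfold Equiv; intros; exact _. Qed.

Definition equiv_id (A : Type) : Equiv A A :=
  existT _ (fun a => a)
    (existT _ (fun a => a) (fun a => idp a),
     existT _ (fun a => a) (fun a => idp a)).

Definition idtoequiv {u v : U} (p : u == v) : Equiv (El u) (El v) :=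
  J u (fun v _ => Equiv (El u) (El v)) (equiv_id (El u)) v p.

Definition IsContr (A : Type) : Type := {a : A & forall b : A, a == b}.

Inductive trunc_index := minus_two | trunc_S (k : trunc_index).

Fixpoint nat_to_trunc (n : nat) : trunc_index :=
  match n with
  | O => trunc_S (trunc_S minus_two)
  | S n => trunc_S (nat_to_trunc n)
  end.

Fixpoint IsTrunc (k : trunc_index) (A : Type) : Type :=
  match k with
  | minus_two => IsContr A
  | trunc_S k => forall x y : A, IsTrunc k (x == y)
  end.

#[export] Instance fib_IsContr {A : Type} : Fib A -> Fib (IsContr A).
Proof. unfold IsContr; intros; exact _. Qed.

#[export] Instance fib_IsTrunc {k : trunc_index} {A : Type} :
  Fib A -> Fib (IsTrunc k A).
Proof. revert A; induction k; cbn; intros; exact _. Qed.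

End Paths.

Notation "p @ q" := (concat p q) (at level 61, left associativity).
Notation "p ^-1" := (inverse p)
  (at level 3, left associativity, format "p ^-1").
Coercion nat_to_trunc : nat >-> trunc_index.

Notation IsSet := (IsTrunc (nat_to_trunc 0)).

Record pType {TT : TypeTheory} := PType {
  pt_car :> Type;
  pt_small : Small pt_car;
  pt : pt_car }.
#[export] Existing Instance pt_small.
Arguments pType : clear implicits.
Arguments pType {TT}.
Arguments PType {TT} pt_car {pt_small} pt.
Arguments pt {TT p}.

(** * Univalence, function extensionality and higher inductive types

    As for inductive types, the computation rules of the eliminators are
    strict on points; on paths they hold up to [==].  [eq_to_id] mediates
    between the two. *)

Class HoTT {TT : TypeTheory} := {
  funext : forall (A : Type) (B : A -> Type) (fA : Fib A)
      (fB : forall a, Fib (B a)) (f g : forall a, B a),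
    IsEquiv (fun p : f == g => happly p);

  univalence : forall u v : U, IsEquiv (fun p : u == v => idtoequiv p);

  Tr : trunc_index -> forall (A : Type) {sA : Small A}, Type;
  small_Tr : forall k A (sA : Small A), Small (Tr k A);
  tr : forall k {A : Type} {sA : Small A}, A -> Tr k A;
  istrunc_Tr : forall k A (sA : Small A), IsTrunc k (Tr k A);
  Tr_ind : forall k (A : Type) (sA : Small A) (P : Tr k A -> Type)
      (fP : forall x, Fib (P x)) (tP : forall x, IsTrunc k (P x))
      (d : forall a, P (tr k a)) (x : Tr k A), P x;
  Tr_ind_tr : forall k (A : Type) (sA : Small A) (P : Tr k A -> Type)
      (fP : forall x, Fib (P x)) (tP : forall x, IsTrunc k (P x))
      (d : forall a, P (tr k a)) (a : A),
    Tr_ind P fP tP d (tr k a) = d a;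

  Pushout : forall {A B C : Type} {sA : Small A} {sB : Small B} {sC : Small C}
      (f : C -> A) (g : C -> B), Type;
  small_Pushout : forall (A B C : Type) (sA : Small A) (sB : Small B)
      (sC : Small C) (f : C -> A) (g : C -> B), Small (Pushout f g);
  pushl : forall {A B C : Type} {sA : Small A} {sB : Small B} {sC : Small C}
      (f : C -> A) (g : C -> B), A -> Pushout f g;
  pushr : forall {A B C : Type} {sA : Small A} {sB : Small B} {sC : Small C}
      (f : C -> A) (g : C -> B), B -> Pushout f g;
  glue : forall {A B C : Type} {sA : Small A} {sB : Small B} {sC : Small C}
      (f : C -> A) (g : C -> B) (c : C), pushl f g (f c) == pushr f g (g c);
  Pushout_ind : forall (A B C : Type) (sA : Small A) (sB : Small B)
      (sC : Small C) (f : C -> A) (g : C -> B)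
      (P : Pushout f g -> Type) (fP : forall x, Fib (P x))
      (dl : forall a, P (pushl f g a)) (dr : forall b, P (pushr f g b))
      (dg : forall c, transport P (glue f g c) (dl (f c)) == dr (g c))
      (x : Pushout f g), P x;
  Pushout_ind_pushl : forall (A B C : Type) (sA : Small A) (sB : Small B)
      (sC : Small C) (f : C -> A) (g : C -> B)
      (P : Pushout f g -> Type) (fP : forall x, Fib (P x))
      (dl : forall a, P (pushl f g a)) (dr : forall b, P (pushr f g b))
      (dg : forall c, transport P (glue f g c) (dl (f c)) == dr (g c)) (a : A),
    Pushout_ind P fP dl dr dg (pushl f g a) = dl a;
  Pushout_ind_pushr : forall (A B C : Type) (sA : Small A) (sB : Small B)
      (sC : Small C) (f : C -> A) (g : C -> B)
      (P : Pushout f g -> Type) (fP : forall x, Fib (P x))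
      (dl : forall a, P (pushl f g a)) (dr : forall b, P (pushr f g b))
      (dg : forall c, transport P (glue f g c) (dl (f c)) == dr (g c)) (b : B),
    Pushout_ind P fP dl dr dg (pushr f g b) = dr b;
  Pushout_ind_glue : forall (A B C : Type) (sA : Small A) (sB : Small B)
      (sC : Small C) (f : C -> A) (g : C -> B)
      (P : Pushout f g -> Type) (fP : forall x, Fib (P x))
      (dl : forall a, P (pushl f g a)) (dr : forall b, P (pushr f g b))
      (dg : forall c, transport P (glue f g c) (dl (f c)) == dr (g c)) (c : C),
    apd (Pushout_ind P fP dl dr dg) (glue f g c) ==
    ap (transport P (glue f g c))
       (eq_to_id (Pushout_ind_pushl P fP dl dr dg (f c)))
    @ dg c @ (eq_to_id (Pushout_ind_pushr P fP dl dr dg (g c)))^-1;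

  Smash_car : forall X Y : pType, Type;
  small_Smash_car : forall X Y : pType, Small (Smash_car X Y);
  sm : forall {X Y : pType}, X * Y -> Smash_car X Y;
  auxl : forall {X Y : pType}, Smash_car X Y;
  auxr : forall {X Y : pType}, Smash_car X Y;
  gluel : forall {X Y : pType} (y : Y), @sm X Y (pt, y) == auxl;
  gluer : forall {X Y : pType} (x : X), @sm X Y (x, pt) == auxr;
  Smash_ind : forall (X Y : pType) (P : Smash_car X Y -> Type)
      (fP : forall z, Fib (P z))
      (dsm : forall xy, P (sm xy)) (dl : P auxl) (dr : P auxr)
      (dgl : forall y, transport P (gluel y) (dsm (pt, y)) == dl)
      (dgr : forall x, transport P (gluer x) (dsm (x, pt)) == dr)
      (z : Smash_car X Y), P z;
  Smash_ind_sm : forall (X Y : pType) (P : Smash_car X Y -> Type)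
      (fP : forall z, Fib (P z))
      (dsm : forall xy, P (sm xy)) (dl : P auxl) (dr : P auxr)
      (dgl : forall y, transport P (gluel y) (dsm (pt, y)) == dl)
      (dgr : forall x, transport P (gluer x) (dsm (x, pt)) == dr) (xy : X * Y),
    Smash_ind P fP dsm dl dr dgl dgr (sm xy) = dsm xy;
  Smash_ind_auxl : forall (X Y : pType) (P : Smash_car X Y -> Type)
      (fP : forall z, Fib (P z))
      (dsm : forall xy, P (sm xy)) (dl : P auxl) (dr : P auxr)
      (dgl : forall y, transport P (gluel y) (dsm (pt, y)) == dl)
      (dgr : forall x, transport P (gluer x) (dsm (x, pt)) == dr),
    Smash_ind P fP dsm dl dr dgl dgr auxl = dl;
  Smash_ind_auxr : forall (X Y : pType) (P : Smash_car X Y -> Type)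
      (fP : forall z, Fib (P z))
      (dsm : forall xy, P (sm xy)) (dl : P auxl) (dr : P auxr)
      (dgl : forall y, transport P (gluel y) (dsm (pt, y)) == dl)
      (dgr : forall x, transport P (gluer x) (dsm (x, pt)) == dr),
    Smash_ind P fP dsm dl dr dgl dgr auxr = dr;
  Smash_ind_gluel : forall (X Y : pType) (P : Smash_car X Y -> Type)
      (fP : forall z, Fib (P z))
      (dsm : forall xy, P (sm xy)) (dl : P auxl) (dr : P auxr)
      (dgl : forall y, transport P (gluel y) (dsm (pt, y)) == dl)
      (dgr : forall x, transport P (gluer x) (dsm (x, pt)) == dr) (y : Y),
    apd (Smash_ind P fP dsm dl dr dgl dgr) (gluel y) ==
    ap (transport P (gluel y))
       (eq_to_id (Smash_ind_sm P fP dsm dl dr dgl dgr (pt, y)))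
    @ dgl y @ (eq_to_id (Smash_ind_auxl P fP dsm dl dr dgl dgr))^-1;
  Smash_ind_gluer : forall (X Y : pType) (P : Smash_car X Y -> Type)
      (fP : forall z, Fib (P z))
      (dsm : forall xy, P (sm xy)) (dl : P auxl) (dr : P auxr)
      (dgl : forall y, transport P (gluel y) (dsm (pt, y)) == dl)
      (dgr : forall x, transport P (gluer x) (dsm (x, pt)) == dr) (x : X),
    apd (Smash_ind P fP dsm dl dr dgl dgr) (gluer x) ==
    ap (transport P (gluer x))
       (eq_to_id (Smash_ind_sm P fP dsm dl dr dgl dgr (x, pt)))
    @ dgr x @ (eq_to_id (Smash_ind_auxr P fP dsm dl dr dgl dgr))^-1 }.

#[export] Existing Instances small_Tr small_Pushout small_Smash_car.

Arguments Tr_ind {TT HoTT k A sA} P fP tP d x.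
Arguments Tr_ind_tr {TT HoTT k A sA} P fP tP d a.
Arguments Pushout_ind {TT HoTT A B C sA sB sC f g} P fP dl dr dg x.
Arguments Pushout_ind_pushl {TT HoTT A B C sA sB sC f g} P fP dl dr dg a.
Arguments Pushout_ind_pushr {TT HoTT A B C sA sB sC f g} P fP dl dr dg b.
Arguments Pushout_ind_glue {TT HoTT A B C sA sB sC f g} P fP dl dr dg c.
Arguments Smash_ind {TT HoTT X Y} P fP dsm dl dr dgl dgr z.
Arguments Smash_ind_sm {TT HoTT X Y} P fP dsm dl dr dgl dgr xy.
Arguments Smash_ind_auxl {TT HoTT X Y} P fP dsm dl dr dgl dgr.
Arguments Smash_ind_auxr {TT HoTT X Y} P fP dsm dl dr dgl dgr.
Arguments Smash_ind_gluel {TT HoTT X Y} P fP dsm dl dr dgl dgr y.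
Arguments Smash_ind_gluer {TT HoTT X Y} P fP dsm dl dr dgl dgr x.

(** * Path algebra *)

Section PathAlgebra.
Context {TT : TypeTheory}.

Lemma concat_idp {A : Type} {fA : Fib A} {a b : A} (p : a == b) :
  p @ idp b = p.
Proof. exact (transport_idp (fun z => a == z) p). Qed.

Lemma inverse_idp {A : Type} {fA : Fib A} (a : A) : (idp a)^-1 = idp a.
Proof. exact (transport_idp (fun z => z == a) (idp a)). Qed.

Lemma ap_idp {A B : Type} {fA : Fib A} {fB : Fib B} (f : A -> B) (a : A) :
  ap f (idp a) = idp (f a).
Proof. exact (transport_idp (fun z => f a == f z) (idp (f a))). Qed.

(** At [idp] this is the strict equality [concat_idp], on the nose. *)
Definition idp_concat {A : Type} {fA : Fib A} {a b : A} (p : a == b) :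
  idp a @ p == p :=
  J a (fun b p => idp a @ p == p) (eq_to_id (concat_idp (idp a))) b p.

Lemma concat_assoc {A : Type} {fA : Fib A} {a b c d : A}
  (p : a == b) (q : b == c) (r : c == d) : p @ q @ r == p @ (q @ r).
Proof.
revert d r; refine (J c _ _).
rewrite !concat_idp; exact (idp _).
Qed.

Lemma inverse_l {A : Type} {fA : Fib A} {a b : A} (p : a == b) :
  p^-1 @ p == idp b.
Proof.
revert b p; refine (J a _ _).
rewrite concat_idp, inverse_idp; exact (idp _).
Qed.

Lemma inverse_r {A : Type} {fA : Fib A} {a b : A} (p : a == b) :
  p @ p^-1 == idp a.
Proof.
revert b p; refine (J a _ _).
rewrite inverse_idp, concat_idp; exact (idp _).
Qed.

Lemma ap_concat {A B : Type} {fA : Fib A} {fB : Fib B} (f : A -> B)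
  {a b c : A} (p : a == b) (q : b == c) : ap f (p @ q) == ap f p @ ap f q.
Proof.
revert c q; refine (J b _ _).
rewrite concat_idp, ap_idp, concat_idp; exact (idp _).
Qed.

Lemma concat_cancel_r {A : Type} {fA : Fib A} {a b c : A} {p q : a == b}
  (r : b == c) : p @ r == q @ r -> p == q.
Proof.
revert c r; refine (J b _ _); rewrite !concat_idp; exact (fun h => h).
Qed.

Lemma concat_cancel_l {A : Type} {fA : Fib A} {a b c : A} (r : a == b)
  {p q : b == c} : r @ p == r @ q -> p == q.
Proof.
revert c p q; revert b r.
refine (J a _ _); intros c p q h.
exact ((idp_concat p)^-1 @ h @ idp_concat q).
Qed.

(** The interchange argument behind the commutativity of double loops. *)
Lemma whisker_exchange {A : Type} {fA : Fib A} {a b c : A}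
  {p p' : a == b} {q q' : b == c} (s : p == p') (t : q == q') :
  ap (fun x => x @ q) s @ ap (fun y => p' @ y) t ==
  ap (fun y => p @ y) t @ ap (fun x => x @ q') s.
Proof.
revert p' s; refine (J p _ _).
rewrite !(ap_idp (fun x : a == b => _)), concat_idp.
exact (idp_concat _).
Qed.

Lemma ap_homotopic_id {A : Type} {fA : Fib A} (f : A -> A)
  (h : forall x, f x == x) {a b : A} (p : a == b) :
  ap f p @ h b == h a @ p.
Proof.
revert b p; refine (J a _ _).
rewrite ap_idp, concat_idp; exact (idp_concat _).
Qed.

Lemma eckmann_hilton {A : Type} {fA : Fib A} {a : A}
  (s t : idp a == idp a) : s @ t == t @ s.
Proof.
pose (h := fun x : a == a => eq_to_id (concat_idp x)).
pose (k := fun x : a == a => idp_concat x).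
assert (e : k (idp a) = h (idp a)).
{ exact (J_idp a (fun b p => idp a @ p == p) (eq_to_id (concat_idp (idp a)))). }
pose proof (hs := ap_homotopic_id (fun x => x @ idp a) h s).
pose proof (kt := ap_homotopic_id (fun x => idp a @ x) k t).
pose proof (w := whisker_exchange s t).
rewrite e in kt; cbv beta in hs, kt, w.
apply (concat_cancel_l (h (idp a))).
refine ((concat_assoc _ _ _)^-1 @ _ @ concat_assoc _ _ _).
refine (ap (fun z => z @ t) hs^-1 @ _ @ ap (fun z => z @ s) kt).
refine (concat_assoc _ _ _ @ _ @ (concat_assoc _ _ _)^-1).
refine (ap (fun z => _ @ z) kt^-1 @ _ @ ap (fun z => _ @ z) hs).
refine ((concat_assoc _ _ _)^-1 @ _ @ concat_assoc _ _ _).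
exact (ap (fun z => z @ h (idp a)) w).
Qed.

(** * Truncated types *)

Lemma path_sig {A : Type} {fA : Fib A} (P : A -> Type)
  {fP : forall a, Fib (P a)}
  (hP : forall a (x y : P a), x == y) {u v : {a : A & P a}}
  (p : projT1 u == projT1 v) : u == v.
Proof.
destruct u as [a x], v as [b y]; cbn in p.
revert b p x y; refine (J a _ _); intros x y.
exact (ap (existT P a) (hP a x y)).
Qed.

Definition contr_path {A : Type} {fA : Fib A} (cA : IsContr A) (x y : A) :
  x == y := (projT2 cA x)^-1 @ projT2 cA y.

Lemma istrunc_succ {k : trunc_index} {A : Type} {fA : Fib A} :
  IsTrunc k A -> IsTrunc (trunc_S k) A.
Proof.
revert A fA; induction k as [|k IH]; intros A fA hA.
- intros x y; exists (contr_path hA x y).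
  revert y; refine (J x _ _); exact (inverse_l (projT2 hA x)).
- intros x y; exact (IH _ _ (hA x y)).
Qed.

Lemma set_path {A : Type} (sA : IsSet A) {x y : A} (p q : x == y) : p == q.
Proof. exact (projT1 (sA x y p q)). Qed.

(** A reflexive family of propositions that implies identity characterizes it,
    and forces the type to be a set. *)
Lemma set_intro {A : Type} {fA : Fib A} (R : A -> A -> Type)
  {fR : forall x y, Fib (R x y)} (hR : forall x y (r s : R x y), r == s)
  (rho : forall x, R x x) (f : forall x y, R x y -> x == y) : IsSet A.
Proof.
assert (key : forall (x y : A) (p : x == y) (r : R x x),
  f x x r @ p == f x y (transport (R x) p r)).
{ intros x; refine (J x _ _); intro r.
  rewrite concat_idp, transport_idp; exact (idp _). }
assert (h : forall (x y : A) (p q : x == y), p == q).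
{ intros x y p q; apply (concat_cancel_l (f x x (rho x))).
  exact (key x y p (rho x) @ ap (f x y) (hR _ _ _ _)
         @ (key x y q (rho x))^-1). }
intros x y p q.
exists ((h x y p p)^-1 @ h x y p q).
revert q; refine (J p _ _); exact (inverse_l (h x y p p)).
Qed.

End PathAlgebra.

(** * Groups *)

Record Group {TT : TypeTheory} := {
  gcar :> Type;
  gsmall : Small gcar;
  gset : IsSet gcar;
  gop : gcar -> gcar -> gcar;
  gid : gcar;
  ginv : gcar -> gcar;
  gop_assoc : forall x y z, gop (gop x y) z == gop x (gop y z);
  gop_id_l : forall x, gop gid x == x;
  gop_id_r : forall x, gop x gid == x;
  gop_inv_l : forall x, gop (ginv x) x == gid;
  gop_inv_r : forall x, gop x (ginv x) == gid }.
#[export] Existing Instance gsmall.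
Arguments Group : clear implicits.
Arguments Group {TT}.
Arguments gop {TT g} x y.
Arguments gid {TT} g.
Arguments ginv {TT g} x.

Record AbGroup {TT : TypeTheory} := {
  ab_group :> Group;
  gop_comm : forall x y : ab_group, gop x y == gop y x }.
Arguments AbGroup : clear implicits.
Arguments AbGroup {TT}.

Section Groups.
Context {TT : TypeTheory} {HT : HoTT}.

Definition path_pi {A : Type} {fA : Fib A} {B : A -> Type}
  {fB : forall a, Fib (B a)} {f g : forall a, B a}
  (h : forall a, f a == g a) : f == g :=
  projT1 (snd (funext B fA fB f g)) h.

Definition Hom (G H : Group) : Type :=
  {f : G -> H & forall x y, f (gop x y) == gop (f x) (f y)}.

Definition hom_fun {G H : Group} (f : Hom G H) : G -> H := projT1 f.
Coercion hom_fun : Hom >-> Funclass.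

#[export] Instance small_Hom (G H : Group) : Small (Hom G H).
Proof. unfold Hom; exact _. Qed.

Lemma hom_op {G H : Group} (f : Hom G H) (x y : G) :
  f (gop x y) == gop (f x) (f y).
Proof. exact (projT2 f x y). Qed.

Lemma hom_path {G H : Group} {f g : Hom G H} :
  (forall x, f x == g x) -> f == g.
Proof.
intro h; refine (path_sig _ _ (path_pi h)).
intros k u v; refine (path_pi _); intro x; refine (path_pi _); intro y.
exact (set_path (gset H) _ _).
Qed.

Lemma hom_set {G H : Group} : IsSet (Hom G H).
Proof.
refine (set_intro (fun f g : Hom G H => forall x, f x == g x) _ _ _).
- intros f g r s; refine (path_pi _); intro x; exact (set_path (gset H) _ _).
- exact (fun f x => idp (f x)).
- exact (fun f g h => hom_path h).
Qed.

Definition hom_compose {G H K : Group} (g : Hom H K) (f : Hom G H) : Hom G K :=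
  existT _ (fun x => g (f x))
    (fun x y => ap g (hom_op f x y) @ hom_op g (f x) (f y)).

Lemma gop_swap (A : AbGroup) (x y z w : A) :
  gop (gop x y) (gop z w) == gop (gop x z) (gop y w).
Proof.
refine (gop_assoc _ _ _ _ @ _ @ (gop_assoc _ _ _ _)^-1).
refine (ap (gop x) _).
refine ((gop_assoc _ _ _ _)^-1 @ _ @ gop_assoc _ _ _ _).
exact (ap (fun u => gop u w) (gop_comm A y z)).
Qed.

Lemma ginv_unique {G : Group} {x y : G} : gop x y == gid G -> y == ginv x.
Proof.
intro h.
refine ((gop_id_l _ _)^-1 @ _).
refine (ap (fun u => gop u y) (gop_inv_l _ x)^-1 @ _).
refine (gop_assoc _ _ _ _ @ _).
exact (ap (gop (ginv x)) h @ gop_id_r _ _).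
Qed.

Lemma ginv_op (A : AbGroup) (x y : A) :
  ginv (gop x y) == gop (ginv x) (ginv y).
Proof.
refine (ginv_unique _)^-1.
refine (gop_swap _ _ _ _ _ @ _).
refine (ap (fun u => gop u _) (gop_inv_r _ x) @ gop_id_l _ _ @ _).
exact (gop_inv_r _ y).
Qed.

(** Homomorphisms into an abelian group form an abelian group pointwise. *)
Section HomGroup.
Variables (G : Group) (A : AbGroup).

Definition hom_add (f g : Hom G A) : Hom G A :=
  existT _ (fun x => gop (f x) (g x))
    (fun x y => ap (fun u => gop u _) (hom_op f x y)
                @ ap (gop _) (hom_op g x y) @ gop_swap A _ _ _ _).

Definition hom_zero : Hom G A :=
  existT _ (fun _ => gid A) (fun _ _ => (gop_id_l A (gid A))^-1).

Definition hom_opp (f : Hom G A) : Hom G A :=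
  existT _ (fun x => ginv (f x))
    (fun x y => ap (@ginv _ A) (hom_op f x y) @ ginv_op A _ _).

Definition HomGrp : Group := {|
  gcar := Hom G A;
  gsmall := small_Hom G A;
  gset := hom_set;
  gop := hom_add;
  gid := hom_zero;
  ginv := hom_opp;
  gop_assoc := fun f g h => hom_path (f := hom_add (hom_add f g) h)
    (g := hom_add f (hom_add g h)) (fun x => gop_assoc A (f x) (g x) (h x));
  gop_id_l := fun f => hom_path (f := hom_add hom_zero f)
    (fun x => gop_id_l A (f x));
  gop_id_r := fun f => hom_path (f := hom_add f hom_zero)
    (fun x => gop_id_r A (f x));
  gop_inv_l := fun f => hom_path (f := hom_add (hom_opp f) f) (g := hom_zero)
    (fun x => gop_inv_l A (f x));
  gop_inv_r := fun f => hom_path (f := hom_add f (hom_opp f)) (g := hom_zero)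
    (fun x => gop_inv_r A (f x)) |}.

Definition HomAb : AbGroup := {|
  ab_group := HomGrp;
  gop_comm := fun f g : Hom G A => hom_path (f := hom_add f g)
    (g := hom_add g f) (fun x => gop_comm A (f x) (g x)) |}.

End HomGroup.
Arguments hom_add {G A} f g.
Arguments hom_opp {G A} f.

(** * Abelianization and tensor products *)

Record Abelianization (G : Group) := {
  abz :> AbGroup;
  abz_unit : Hom G abz;
  abz_initial : forall (A : AbGroup) (f : Hom G A),
    IsContr {h : Hom abz A & hom_compose h abz_unit == f} }.

Definition abz_map {G H : Group} (aG : Abelianization G) (aH : Abelianization H)
  (f : Hom G H) : Hom aG aH :=
  projT1 (projT1 (abz_initial aG aH (hom_compose (abz_unit aH) f))).

Definition hom_post {B : Group} {T C : AbGroup} (h : Hom T C) :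
  Hom (HomAb B T) (HomAb B C) :=
  existT _ (fun g : Hom B T => hom_compose h g : HomAb B C)
    (fun g g' : Hom B T => hom_path (f := hom_compose h (hom_add g g'))
      (g := hom_add (hom_compose h g) (hom_compose h g'))
      (fun b => hom_op h (g b) (g' b))).

(** The map [t^*]. *)
Definition tensor_pre {A B T : AbGroup} (t : Hom A (HomAb B T)) (C : AbGroup)
  (h : Hom T C) : Hom A (HomAb B C) := hom_compose (hom_post h) t.

Definition IsTensorProduct {A B T : AbGroup} (t : Hom A (HomAb B T)) : Type :=
  forall C : AbGroup, IsEquiv (tensor_pre t C).

Definition hom_app2 {A B T : AbGroup} (t : Hom A (HomAb B T)) (a : A) (b : B) :
  T := hom_fun (t a : Hom B T) b.

(** * Pointed maps, homotopy groups, connectedness *)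

Definition pMap (X Y : pType) : Type := {f : X -> Y & f pt == pt}.
Definition pmap_fun {X Y : pType} (f : pMap X Y) : X -> Y := projT1 f.
Coercion pmap_fun : pMap >-> Funclass.
Definition pmap_pt {X Y : pType} (f : pMap X Y) : f pt == pt := projT2 f.

Definition IsConnected (k : trunc_index) (X : Type) {sX : Small X} : Type :=
  IsContr (Tr k X).

Definition loops (X : pType) : pType := PType (@pt _ X == pt) (idp pt).

Definition loops_map {X Y : pType} (f : pMap X Y) : pMap (loops X) (loops Y) :=
  existT _ (fun p : loops X => (pmap_pt f)^-1 @ ap f p @ pmap_pt f : loops Y)
    (ap (fun q => (pmap_pt f)^-1 @ q @ pmap_pt f) (eq_to_id (ap_idp f pt))
     @ eq_to_id (f_equal (fun q => q @ pmap_pt f) (concat_idp (pmap_pt f)^-1))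
     @ inverse_l (pmap_pt f)).

Fixpoint iloops (n : nat) (X : pType) : pType :=
  match n with
  | O => X
  | S n => loops (iloops n X)
  end.

Fixpoint iloops_map (n : nat) {X Y : pType} (f : pMap X Y) :
  pMap (iloops n X) (iloops n Y) :=
  match n with
  | O => f
  | S n => loops_map (iloops_map n f)
  end.

Lemma set_istrunc_path {A : Type} {fA : Fib A} (sA : IsSet A) (x y : A) :
  IsTrunc (nat_to_trunc 0) (x == y).
Proof. exact (istrunc_succ (k := trunc_S minus_two) (sA x y)). Qed.

Lemma set_Tr (A : Type) {sA : Small A} : IsSet (Tr (nat_to_trunc 0) A).
Proof. exact (istrunc_Tr (nat_to_trunc 0) A sA). Qed.

Definition Tr0_rec {A : Type} {sA : Small A} {B : Type} {fB : Fib B}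
  (hB : IsSet B) (f : A -> B) : Tr (nat_to_trunc 0) A -> B :=
  Tr_ind (fun _ => B) (fun _ => fB) (fun _ => hB) f.

Definition Tr0_rec_tr {A : Type} {sA : Small A} {B : Type} {fB : Fib B}
  (hB : IsSet B) (f : A -> B) (a : A) :
  Tr0_rec hB f (tr (nat_to_trunc 0) a) = f a :=
  Tr_ind_tr (fun _ => B) (fun _ => fB) (fun _ => hB) f a.

Lemma Tr0_path {A B : Type} {sA : Small A} {fB : Fib B} (hB : IsSet B)
  (f g : Tr (nat_to_trunc 0) A -> B) :
  (forall a, f (tr _ a) == g (tr _ a)) -> forall x, f x == g x.
Proof.
exact (Tr_ind (fun x => f x == g x) _ (fun x => set_istrunc_path hB _ _)).
Qed.

Section LoopGroup.
Variable X : pType.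
Let P := Tr (nat_to_trunc 0) (loops X).

Definition tr_concat (x y : P) : P :=
  Tr0_rec (set_Tr _) (fun p : loops X =>
    Tr0_rec (set_Tr _) (fun q : loops X =>
      tr (nat_to_trunc 0) (p @ q : loops X)) y) x.

Definition tr_inverse : P -> P :=
  Tr0_rec (set_Tr _) (fun p : loops X => tr (nat_to_trunc 0) (p^-1 : loops X)).

Lemma tr_concat_tr (p q : loops X) :
  tr_concat (tr _ p) (tr _ q) = tr _ (p @ q : loops X).
Proof. unfold tr_concat; rewrite !Tr0_rec_tr; reflexivity. Qed.

Lemma tr_inverse_tr (p : loops X) :
  tr_inverse (tr _ p) = tr _ (p^-1 : loops X).
Proof. exact (Tr0_rec_tr _ _ p). Qed.

Definition loop_group : Group.
Proof.
refine {| gcar := P; gset := set_Tr (loops X); gop := tr_concat;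
  gid := tr _ (idp pt : loops X); ginv := tr_inverse |}.
- intros x y z; revert x; refine (Tr0_path (set_Tr _) _ _ _); intro p.
  revert y; refine (Tr0_path (set_Tr _) _ _ _); intro q.
  revert z; refine (Tr0_path (set_Tr _) _ _ _); intro r.
  rewrite !tr_concat_tr.
  exact (ap (@tr _ _ _ (loops X) _) (concat_assoc p q r)).
- refine (Tr0_path (set_Tr _) _ _ _); intro p.
  rewrite tr_concat_tr; exact (ap (@tr _ _ _ (loops X) _) (idp_concat p)).
- refine (Tr0_path (set_Tr _) _ _ _); intro p.
  rewrite tr_concat_tr, concat_idp; exact (idp _).
- refine (Tr0_path (set_Tr _) _ _ _); intro p.
  rewrite tr_inverse_tr, tr_concat_tr.
  exact (ap (@tr _ _ _ (loops X) _) (inverse_l p)).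
- refine (Tr0_path (set_Tr _) _ _ _); intro p.
  rewrite tr_inverse_tr, tr_concat_tr.
  exact (ap (@tr _ _ _ (loops X) _) (inverse_r p)).
Defined.

End LoopGroup.

Definition loop2_group (X : pType) : AbGroup.
Proof.
exists (loop_group (loops X)).
intros x y; revert x; refine (Tr0_path (set_Tr _) _ _ _); intro p.
revert y; refine (Tr0_path (set_Tr _) _ _ _); intro q.
cbn; rewrite !tr_concat_tr.
exact (ap (@tr _ _ _ (loops (loops X)) _) (eckmann_hilton p q)).
Defined.

Lemma conj_concat {A : Type} {fA : Fib A} {a b : A}
  (p q : a == a) (r : a == b) :
  r^-1 @ (p @ q) @ r == (r^-1 @ p @ r) @ (r^-1 @ q @ r).
Proof.
revert b r; refine (J a _ _).
rewrite inverse_idp, !concat_idp.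
refine ((concat_assoc _ _ _)^-1 @ _).
exact (ap (fun u => idp a @ p @ u) (idp_concat q)^-1).
Qed.

Definition loop_group_map {X Y : pType} (f : pMap X Y) :
  Hom (loop_group X) (loop_group Y).
Proof.
exists (Tr0_rec (set_Tr _) (fun p : loops X => tr _ (loops_map f p))).
intros x y; revert x; refine (Tr0_path (set_Tr _) _ _ _); intro p.
revert y; refine (Tr0_path (set_Tr _) _ _ _); intro q.
cbn; rewrite tr_concat_tr, !Tr0_rec_tr, tr_concat_tr.
refine (ap (@tr _ _ _ (loops Y) _) _).
exact (ap (fun u => (pmap_pt f)^-1 @ u @ pmap_pt f) (ap_concat f p q)
       @ conj_concat _ _ _).
Defined.

(** [pi n X] is the [n]-th homotopy group for [1 <= n], and [abpi n X] is the
    same group, made abelian by the Eckmann-Hilton argument, for [2 <= n]. *)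
Definition pi (n : nat) (X : pType) : Group := loop_group (iloops (pred n) X).

Definition pi_map (n : nat) {X Y : pType} (f : pMap X Y) :
  Hom (pi n X) (pi n Y) := loop_group_map (iloops_map (pred n) f).

Definition abpi (n : nat) (X : pType) : AbGroup :=
  loop2_group (iloops (pred (pred n)) X).

Definition abpi_map (n : nat) {X Y : pType} (f : pMap X Y) :
  Hom (abpi n X) (abpi n Y) :=
  loop_group_map (loops_map (iloops_map (pred (pred n)) f)).

(** * Functoriality of the smash product *)

Definition Smash (X Y : pType) : pType := PType (Smash_car X Y) (sm (pt, pt)).

Definition transport_const {A B : Type} {fA : Fib A} {fB : Fib B} {a b : A}
  (p : a == b) (x : B) : transport (fun _ => B) p x == x :=
  J a (fun b p => transport (fun _ => B) p x == x)
    (eq_to_id (transport_idp (fun _ => B) x)) b p.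

Section SmashMap.
Context {X X' Y Y' : pType} (f : pMap X X') (g : pMap Y Y').

Definition smash_map_sm (xy : X * Y) : Smash_car X' Y' :=
  sm (f (fst xy), g (snd xy)).

Definition smash_map_gluel (y : Y) : smash_map_sm (pt, y) == auxl :=
  ap (fun x' => sm (x', g y)) (pmap_pt f) @ gluel (g y).

Definition smash_map_gluer (x : X) : smash_map_sm (x, pt) == auxr :=
  ap (fun y' => sm (f x, y')) (pmap_pt g) @ gluer (f x).

Definition smash_map_fun : Smash X Y -> Smash X' Y' :=
  Smash_ind (fun _ => Smash_car X' Y') (fun _ => _) smash_map_sm auxl auxr
    (fun y => transport_const _ _ @ smash_map_gluel y)
    (fun x => transport_const _ _ @ smash_map_gluer x).

Definition smash_map : pMap (Smash X Y) (Smash X' Y') :=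
  existT _ smash_map_fun
    (eq_to_id (Smash_ind_sm _ _ _ _ _ _ _ (pt, pt))
     @ ap (fun x' => sm (x', g pt)) (pmap_pt f)
     @ ap (fun y' => sm (pt, y')) (pmap_pt g)).

End SmashMap.
End Groups.

(** * Existence of abelianizations

    Carried by the set-quotient of [G] identifying [x (y z)] with [x (z y)]. *)

Section AbelianizationExists.
Context {TT : TypeTheory} {HT : HoTT}.
Variable G : Group.

Let R : Type := (G * (G * G))%type.
Let lhs (r : R) : G := gop (fst r) (gop (fst (snd r)) (snd (snd r))).
Let rhs (r : R) : G := gop (fst r) (gop (snd (snd r)) (fst (snd r))).
Let sides (s : R + R) : G := match s with inl r => lhs r | inr r => rhs r end.
Let fold (s : R + R) : R := match s with inl r => r | inr r => r end.
Let Q : Type := Pushout sides fold.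
Let Z : Type := Tr (nat_to_trunc 0) Q.
Let eta (x : G) : Z := tr (nat_to_trunc 0) (pushl sides fold x : Q).

Let eta_swap (x y z : G) : eta (gop x (gop y z)) == eta (gop x (gop z y)).
Proof.
pose (r := (x, (y, z)) : R).
exact (ap (@tr _ _ (nat_to_trunc 0) Q _)
  (glue sides fold (inl r) @ (glue sides fold (inr r))^-1)).
Qed.

Let eta_comm (x y : G) : eta (gop x y) == eta (gop y x).
Proof.
exact (ap eta (gop_id_l G _)^-1 @ eta_swap _ _ _ @ ap eta (gop_id_l G _)).
Qed.

Let Z_set : IsSet Z := set_Tr Q.

Let Z_ind (P : Z -> Type) (fP : forall z, Fib (P z))
  (hP : forall z (u v : P z), u == v) (d : forall x, P (eta x)) : forall z, P z.
Proof.
refine (Tr_ind P fP _ _).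
- intro z; refine (set_intro (fun _ _ => unit) _ _ _).
  + intros _ _ [] []; exact (idp _).
  + exact (fun _ => tt).
  + exact (fun u v _ => hP z u v).
- refine (Pushout_ind (fun q => P (tr _ q)) _ d
    (fun r => transport (fun q => P (tr _ q)) (glue sides fold (inl r))
       (d (lhs r))) _).
  intro c; exact (hP _ _ _).
Qed.

Section Rec.
Context {B : Type} {fB : Fib B} (sB : IsSet B) (h : G -> B)
  (hh : forall r, h (lhs r) == h (rhs r)).

Let Q_rec : Q -> B.
Proof.
refine (Pushout_ind (fun _ => B) (fun _ => fB) h (fun r => h (lhs r)) _).
intros [r|r].
- exact (transport_const _ _).
- exact (transport_const _ _ @ (hh r)^-1).
Defined.

Definition ab_rec : Z -> B := Tr0_rec sB Q_rec.

Lemma ab_rec_eta (x : G) : ab_rec (eta x) = h x.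
Proof.
refine (eq_trans (Tr0_rec_tr sB Q_rec _) _).
exact (Pushout_ind_pushl _ _ _ _ _ _).
Qed.
End Rec.

Let Z_path {B : Type} {fB : Fib B} (sB : IsSet B) (f g : Z -> B) :
  (forall x, f (eta x) == g (eta x)) -> forall z, f z == g z.
Proof.
exact (Z_ind (fun z => f z == g z) _ (fun z => set_path sB (x := _) (y := _))).
Qed.

Let op_r (x : G) : Z -> Z.
Proof.
refine (ab_rec Z_set (fun y => eta (gop x y)) _).
intros [a [b c]]; unfold lhs, rhs; cbn [fst snd].
refine (ap eta (gop_assoc G _ _ _)^-1 @ eta_swap _ _ _
        @ ap eta (gop_assoc G _ _ _)).
Defined.

Let op_r_eta (x y : G) : op_r x (eta y) = eta (gop x y).
Proof. exact (ab_rec_eta Z_set _ _ y). Qed.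

Let Z_fun_set : IsSet (Z -> Z).
Proof.
refine (set_intro (fun f g : Z -> Z => forall z, f z == g z) _ _ _).
- intros f g r s; refine (path_pi _); intro z; exact (set_path Z_set _ _).
- exact (fun f z => idp (f z)).
- exact (fun f g h => path_pi h).
Qed.

Let op : Z -> Z -> Z.
Proof.
refine (ab_rec Z_fun_set op_r _).
intros [a [b c]]; unfold lhs, rhs; cbn [fst snd].
refine (path_pi _); refine (Z_path Z_set _ _ _); intro y.
rewrite !op_r_eta.
refine (eta_comm _ _ @ _ @ eta_comm _ _).
exact (ap eta (gop_assoc G _ _ _)^-1 @ eta_swap _ _ _
       @ ap eta (gop_assoc G _ _ _)).
Defined.

Let op_eta (x y : G) : op (eta x) (eta y) = eta (gop x y).
Proof.
unfold op; rewrite ab_rec_eta; exact (op_r_eta x y).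
Qed.

Let inv_op (x y : G) : ginv (gop x y) == gop (ginv y) (ginv x).
Proof.
refine (ginv_unique _)^-1.
refine (gop_assoc G _ _ _ @ _).
refine (ap (gop x) ((gop_assoc G _ _ _)^-1 @ _) @ gop_inv_r G x).
exact (ap (fun u => gop u _) (gop_inv_r G y) @ gop_id_l G _).
Qed.

Let inv : Z -> Z.
Proof.
refine (ab_rec Z_set (fun x => eta (ginv x)) _).
intros [a [b c]]; unfold lhs, rhs; cbn [fst snd].
assert (k : forall u v, eta (ginv (gop a (gop u v))) ==
  eta (gop (ginv a) (gop (ginv v) (ginv u)))).
{ intros u v; refine (ap eta (inv_op _ _) @ eta_comm _ _ @ _).
  exact (ap (fun w => eta (gop (ginv a) w)) (inv_op u v)). }
exact (k b c @ eta_swap _ _ _ @ (k c b)^-1).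
Defined.

Let inv_eta (x : G) : inv (eta x) = eta (ginv x).
Proof. exact (ab_rec_eta Z_set _ _ x). Qed.

Let Z_group : Group.
Proof.
refine {| gcar := Z; gset := Z_set; gop := op; gid := eta (gid G);
  ginv := inv |}.
- intros x y z; revert x; refine (Z_path Z_set _ _ _); intro x.
  revert y; refine (Z_path Z_set _ _ _); intro y.
  revert z; refine (Z_path Z_set _ _ _); intro z.
  rewrite !op_eta; exact (ap eta (gop_assoc G x y z)).
- refine (Z_path Z_set _ _ _); intro x.
  rewrite op_eta; exact (ap eta (gop_id_l G x)).
- refine (Z_path Z_set _ _ _); intro x.
  rewrite op_eta; exact (ap eta (gop_id_r G x)).
- refine (Z_path Z_set _ _ _); intro x.
  rewrite inv_eta, op_eta; exact (ap eta (gop_inv_l G x)).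
- refine (Z_path Z_set _ _ _); intro x.
  rewrite inv_eta, op_eta; exact (ap eta (gop_inv_r G x)).
Defined.

Let Z_ab : AbGroup.
Proof.
exists Z_group.
intros x y; revert x; refine (Z_path Z_set _ _ _); intro x.
revert y; refine (Z_path Z_set _ _ _); intro y.
change (op (eta x) (eta y) == op (eta y) (eta x)).
rewrite !op_eta; exact (eta_comm x y).
Defined.

Let eta_hom : Hom G Z_ab :=
  existT _ eta (fun x y => eq_to_id (eq_sym (op_eta x y))).

Definition abelianization_exists : Abelianization G.
Proof.
exists Z_ab eta_hom.
intros A f.
assert (hf : forall r, f (lhs r) == f (rhs r)).
{ intros [a [b c]]; unfold lhs, rhs; cbn [fst snd].
  refine (hom_op f _ _ @ ap (gop _) _ @ (hom_op f _ _)^-1).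
  exact (hom_op f _ _ @ gop_comm A _ _ @ (hom_op f _ _)^-1). }
pose (h := ab_rec (gset A) f hf).
assert (he : forall x, h (eta x) = f x) by exact (ab_rec_eta (gset A) f hf).
assert (hm : forall x y, h (op x y) == gop (h x) (h y)).
{ intros x y; revert x; refine (Z_path (gset A) _ _ _); intro x.
  revert y; refine (Z_path (gset A) _ _ _); intro y.
  rewrite op_eta, !he; exact (hom_op f x y). }
pose (hh := existT _ h hm : Hom Z_ab A).
exists (existT (fun k : Hom Z_ab A => hom_compose k eta_hom == f) hh
  (hom_path (f := hom_compose hh eta_hom) (fun x => eq_to_id (he x)))).
intros [k e]; refine (path_sig _ _ _).
- intros k' u v; exact (set_path hom_set u v).
- cbn [projT1]; refine (hom_path (f := hh) _).
  refine (Z_path (gset A) _ _ _); intro x.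
  exact (eq_to_id (he x) @ (ap (fun u : Hom G A => u x) e)^-1).
Qed.

End AbelianizationExists.

(* Main.v *)
From Stdlib Require Import Lia.
Require Import Defs.

(** Both claims are read off from mapping spaces, and the universal property is
    obtained by representing homomorphisms by pointed maps into
    Eilenberg-MacLane spaces.

    Connectedness.  Over a pointed [(k+1)]-connected type a family of [k]-types
    has a unique section through any given value at the basepoint, because the
    family [Tr k (pt == x)] is contractible ([connected_path], a consequence of
    univalence).  Each further dimension of the fibres adds one to the
    truncation level of the type of such sections ([istrunc_Ext]).  This yields
    the extension of maps from a wedge to a product ([wedge_extension]), hence
    the connectedness of the smash product ([smash_connected]), and bounds the
    truncation level of pointed mapping spaces.

    Maps and homotopy groups.  If [X] is [(n-1)]-connected and [T] is
    [n]-truncated, taking [n]-th homotopy groups is a bijection from pointed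
    maps [X -> T] to homomorphisms ([pi_surj], [pi_inj]).  One loop space is
    removed at a time: the fibres of [Susp (loops X) -> X] are connected enough
    for a map [loops X -> loops T], multiplicative in the last step, to extend in
    exactly one way ([contr_ExtData]).

    The pairing.  The smash product comes with maps [X -> Smash X Y], one for
    each [y], that depend on [y] in a pointed way.  Applying them to [n]-fold
    loops [a] in [X] gives a pointed map from [Y] to the [n]-fold loops of
    [Smash X Y], which is applied to [m]-fold loops [b] in [Y].  Additivity in
    [b] is that of loops of a map, additivity in [a] is the Eckmann-Hilton
    argument ([iloops_map_mul]).  Since loop spaces are homogeneous, equality
    of pointed maps into them may be checked without regard to basepoints
    ([path_pmap_loops]); this reduces naturality to that of the inclusions.

    Universality.  An abelian group [C] is the group [pi (n + m) A] of an
    [(n+m-1)]-connected, [(n+m)]-truncated type [A] ([EM_exists]): the first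
    delooping of [C] is the truncated cofibre of the Hopf construction on its
    multiplication, and an H-space is delooped by truncating its suspension.
    Homomorphisms [pi (n + m) (Smash X Y) -> C] are then pointed maps
    [Smash X Y -> A], that is, pointed maps [X -> PMap Y A].  As [PMap Y A] is
    [n]-truncated with [n]-fold loops [PMap Y (iloops n A)], and [iloops n A] is
    [m]-truncated, these are homomorphisms from [pi n X] to the homomorphisms
    from [pi m Y] to [C].  Under these bijections, precomposition with the
    pairing corresponds to currying ([realize], [vanish]). *)

(** * Path algebra *)

(** Path induction on [p], whose right endpoint is a variable on which only [p]
    and the goal depend. *)
Ltac path_ind p :=
  match type of p with
  | Id ?a ?b => revert p; try (revert b); refine (J a _ _)
  end.

(** At [idp] the operations on paths compute up to strict equality, so after
    path induction a goal is cleared by rewriting. *)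
Ltac strict :=
  repeat first [ rewrite transport_idp | rewrite ap_idp | rewrite inverse_idp
               | rewrite concat_idp ].

Section Algebra.
Context {TT : TypeTheory}.

Lemma ap_compose {A B C : Type} {fA : Fib A} {fB : Fib B} {fC : Fib C}
  (f : A -> B) (g : B -> C) {a b : A} (p : a == b) :
  ap (fun x => g (f x)) p == ap g (ap f p).
Proof. path_ind p; strict; exact (idp _). Qed.

Lemma ap_id {A : Type} {fA : Fib A} {a b : A} (p : a == b) :
  ap (fun x => x) p == p.
Proof. path_ind p; strict; exact (idp _). Qed.

Lemma ap_const {A B : Type} {fA : Fib A} {fB : Fib B} (c : B)
  {a b : A} (p : a == b) : ap (fun _ => c) p == idp c.
Proof. path_ind p; strict; exact (idp _). Qed.

Lemma ap_inverse {A B : Type} {fA : Fib A} {fB : Fib B} (f : A -> B)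
  {a b : A} (p : a == b) : ap f p^-1 == (ap f p)^-1.
Proof. path_ind p; strict; exact (idp _). Qed.

Lemma inverse_inverse {A : Type} {fA : Fib A} {a b : A} (p : a == b) :
  p^-1^-1 == p.
Proof. path_ind p; strict; exact (idp _). Qed.

Lemma concat_inverse_cancel_r {A : Type} {fA : Fib A} {a b c : A}
  (p : a == b) (q : b == c) : p @ q @ q^-1 == p.
Proof. path_ind q; strict; exact (idp _). Qed.

Lemma concat_cancel_inverse_r {A : Type} {fA : Fib A} {a b c : A}
  (p : a == b) (q : c == b) : p @ q^-1 @ q == p.
Proof. revert p; path_ind q; intros; strict; exact (idp _). Qed.

Lemma inverse_cancel_l {A : Type} {fA : Fib A} {a b c : A}
  (p : a == b) (q : b == c) : p^-1 @ (p @ q) == q.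
Proof. path_ind q; strict; exact (inverse_l p). Qed.

Lemma cancel_inverse_l {A : Type} {fA : Fib A} {a b c : A}
  (p : b == a) (q : b == c) : p @ (p^-1 @ q) == q.
Proof. path_ind q; strict; exact (inverse_r p). Qed.

Lemma move_r_l {A : Type} {fA : Fib A} {a b c : A}
  {p : a == b} {q : b == c} {r : a == c} : p @ q == r -> q == p^-1 @ r.
Proof.
intro h; exact ((inverse_cancel_l p q)^-1 @ ap (fun u => p^-1 @ u) h).
Qed.

Lemma move_l_r {A : Type} {fA : Fib A} {a b c : A}
  {p : a == b} {q : b == c} {r : a == c} : p @ q == r -> p == r @ q^-1.
Proof.
intro h; exact ((concat_inverse_cancel_r p q)^-1 @ ap (fun u => u @ q^-1) h).
Qed.

Lemma transport_path_fg {A B : Type} {fA : Fib A} {fB : Fib B} (f g : A -> B)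
  {a b : A} (p : a == b) (q : f a == g a) :
  transport (fun x => f x == g x) p q == (ap f p)^-1 @ q @ ap g p.
Proof. path_ind p; strict; exact (idp_concat _)^-1. Qed.

Lemma transport_compose {A B : Type} {fA : Fib A} {fB : Fib B} (f : A -> B)
  (P : B -> Type) {fP : forall b, Fib (P b)} {a b : A} (p : a == b)
  (x : P (f a)) :
  transport (fun a => P (f a)) p x == transport P (ap f p) x.
Proof. path_ind p; strict; exact (idp _). Qed.

Lemma transport_concat {A : Type} {fA : Fib A} (P : A -> Type)
  {fP : forall a, Fib (P a)} {a b c : A} (p : a == b) (q : b == c) (x : P a) :
  transport P (p @ q) x == transport P q (transport P p x).
Proof. path_ind q; strict; exact (idp _). Qed.

Lemma transport_inverse_r {A : Type} {fA : Fib A} (P : A -> Type)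
  {fP : forall a, Fib (P a)} {a b : A} (p : a == b) (x : P b) :
  transport P p (transport P p^-1 x) == x.
Proof. revert x; path_ind p; intros; strict; exact (idp _). Qed.

Lemma transport_inverse_l {A : Type} {fA : Fib A} (P : A -> Type)
  {fP : forall a, Fib (P a)} {a b : A} (p : a == b) (x : P a) :
  transport P p^-1 (transport P p x) == x.
Proof. path_ind p; intros; strict; exact (idp _). Qed.

Lemma transport_natural {A : Type} {fA : Fib A} {P Q : A -> Type}
  {fP : forall a, Fib (P a)} {fQ : forall a, Fib (Q a)}
  (f : forall a, P a -> Q a) {a b : A} (p : a == b) (x : P a) :
  transport Q p (f a x) == f b (transport P p x).
Proof. path_ind p; intros; strict; exact (idp _). Qed.

Lemma homotopy_natural {A B : Type} {fA : Fib A} {fB : Fib B} {f g : A -> B}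
  (h : forall x, f x == g x) {a b : A} (p : a == b) :
  ap f p @ h b == h a @ ap g p.
Proof. path_ind p; strict; exact (idp_concat _). Qed.

Lemma path_sigma_over {A : Type} {fA : Fib A} (P : A -> Type)
  {fP : forall a, Fib (P a)} {u v : {a : A & P a}} (p : projT1 u == projT1 v) :
  transport P p (projT2 u) == projT2 v ->
  {e : u == v & ap (fun w : {a : A & P a} => projT1 w) e == p}.
Proof.
destruct u as [a x], v as [b y]; cbn in *; revert y; path_ind p.
intros y q; rewrite transport_idp in q; path_ind q.
exists (idp _); strict; exact (idp _).
Qed.

Definition path_sigma {A : Type} {fA : Fib A} (P : A -> Type)
  {fP : forall a, Fib (P a)} {u v : {a : A & P a}} (p : projT1 u == projT1 v)
  (q : transport P p (projT2 u) == projT2 v) : u == v :=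
  projT1 (path_sigma_over P p q).

End Algebra.

(** * Truncation levels *)

Section Truncation.
Context {TT : TypeTheory} {HT : HoTT}.

Lemma istrunc_retract {k : trunc_index} {A B : Type} {fA : Fib A}
  {fB : Fib B} (r : A -> B) (s : B -> A) (h : forall b, r (s b) == b) :
  IsTrunc k A -> IsTrunc k B.
Proof.
revert A B fA fB r s h; induction k as [|k IH]; intros A B fA fB r s h hA.
- exists (r (projT1 hA)); intro b.
  exact (ap r (projT2 hA (s b)) @ h b).
- intros x y.
  refine (IH (s x == s y) (x == y) _ _
    (fun q => (h x)^-1 @ ap r q @ h y) (fun p => ap s p) _ (hA _ _)).
  intro p; path_ind p; strict; exact (inverse_l _).
Qed.

(** A reflexive family over pairs that implies identity and is [k]-truncated
    bounds the identity types, whatever its relation to them: correcting the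
    implication by its value at reflexivity makes [u == v] a retract. *)
Lemma istrunc_by_relation {k : trunc_index} {A : Type} {fA : Fib A}
  (R : A -> A -> Type) {fR : forall u v, Fib (R u v)}
  (hR : forall u v, IsTrunc k (R u v)) (rho : forall u, R u u)
  (f : forall u v, R u v -> u == v) : IsTrunc (trunc_S k) A.
Proof.
intros u v.
refine (istrunc_retract (fun r => (f u u (rho u))^-1 @ f u v r)
  (fun p => transport (R u) p (rho u)) _ (hR u v)).
intro p; path_ind p; strict; exact (inverse_l _).
Qed.

Lemma istrunc_sig {k : trunc_index} {A : Type} {fA : Fib A} {P : A -> Type}
  {fP : forall a, Fib (P a)} :
  IsTrunc k A -> (forall a, IsTrunc k (P a)) -> IsTrunc k {a : A & P a}.
Proof.
revert A fA P fP; induction k as [|k IH]; intros A fA P fP hA hP.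
- exists (existT P (projT1 hA) (projT1 (hP (projT1 hA)))).
  intros [b y]; unshelve refine (path_sigma P _ _).
  + exact (projT2 hA b).
  + exact (contr_path (hP b) _ _).
- refine (istrunc_by_relation (fun u v => {p : projT1 u == projT1 v &
      transport P p (projT2 u) == projT2 v}) _ _ _).
  + intros u v; exact (IH _ _ _ _ (hA _ _) (fun p => hP _ _ _)).
  + intro u; exists (idp _); strict; exact (idp _).
  + intros u v w; exact (path_sigma P (projT1 w) (projT2 w)).
Qed.

Lemma istrunc_pi {k : trunc_index} {A : Type} {fA : Fib A} {P : A -> Type}
  {fP : forall a, Fib (P a)} :
  (forall a, IsTrunc k (P a)) -> IsTrunc k (forall a, P a).
Proof.
revert A fA P fP; induction k as [|k IH]; intros A fA P fP hP.
- exists (fun a => projT1 (hP a)); intro f.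
  exact (path_pi (fun a => projT2 (hP a) (f a))).
- intros f g.
  destruct (funext P fA fP f g) as [[r hr] _].
  refine (istrunc_retract (A := forall a, f a == g a) r
    (fun p => happly p) hr _).
  exact (IH _ _ _ _ (fun a => hP a (f a) (g a))).
Qed.

Lemma istrunc_prod {k : trunc_index} {A B : Type} {fA : Fib A} {fB : Fib B} :
  IsTrunc k A -> IsTrunc k B -> IsTrunc k (A * B).
Proof.
intros hA hB.
refine (istrunc_retract (A := {_ : A & B}) (fun u => (projT1 u, projT2 u))
  (fun u => existT _ (fst u) (snd u)) _ (istrunc_sig hA (fun _ => hB))).
intros [a b]; exact (idp _).
Qed.

Lemma istrunc_path {k : trunc_index} {A : Type} {fA : Fib A} :
  IsTrunc k A -> forall x y : A, IsTrunc k (x == y).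
Proof. intros hA x y; exact (istrunc_succ hA x y). Qed.

Lemma prop_path {A : Type} (hA : IsTrunc (trunc_S minus_two) A) (x y : A) :
  x == y.
Proof. exact (projT1 (hA x y)). Qed.

Lemma prop_intro {A : Type} {fA : Fib A} :
  (A -> IsContr A) -> IsTrunc (trunc_S minus_two) A.
Proof. intros h x y; exact (istrunc_succ (k := minus_two) (h x) x y). Qed.

Lemma contr_inhabited_prop {A : Type} (hA : IsTrunc (trunc_S minus_two) A)
  (a : A) : IsContr A.
Proof. exists a; exact (prop_path hA a). Qed.

Lemma prop_istrunc (k : trunc_index) {A : Type} {fA : Fib A} :
  IsTrunc (trunc_S minus_two) (IsTrunc k A).
Proof.
revert A fA; induction k as [|k IH]; intros A fA.
- refine (prop_intro _); intro cA.
  refine (istrunc_sig (k := minus_two) cA (fun a => _)).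
  exact (istrunc_pi (k := minus_two)
           (fun b => istrunc_succ (k := minus_two) cA a b)).
- exact (istrunc_pi (fun x => istrunc_pi (fun y => IH (x == y) _))).
Qed.

Lemma contr_path_from {A : Type} {fA : Fib A} (a : A) :
  IsContr {b : A & a == b}.
Proof.
exists (existT _ a (idp a)); intros [b p]; path_ind p; exact (idp _).
Qed.

Lemma contr_path_to {A : Type} {fA : Fib A} (b : A) :
  IsContr {a : A & a == b}.
Proof.
refine (istrunc_retract (k := minus_two)
  (fun u : {a : A & b == a} => existT (fun a => a == b) (projT1 u) (projT2 u)^-1)
  (fun u => existT _ (projT1 u) (projT2 u)^-1) _ (contr_path_from b)).
intros [a p]; exact (ap (existT (fun a => a == b) a) (inverse_inverse p)).
Qed.

Lemma contr_sig_at {A : Type} {fA : Fib A} {P : A -> Type}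
  {fP : forall a, Fib (P a)} (cA : IsContr A) (a : A) :
  IsContr (P a) -> IsContr {a : A & P a}.
Proof.
intro c; refine (istrunc_sig (k := minus_two) cA (fun b => _)).
exact (transport (fun b => IsContr (P b)) (contr_path cA a b) c).
Qed.

(** With levels written [tadd j minus_two], the estimates that subtract a
    connectivity from a truncation level become additions of natural numbers. *)
Fixpoint tadd (j : nat) (k : trunc_index) : trunc_index :=
  match j with O => k | S j => trunc_S (tadd j k) end.

Lemma istrunc_tadd (j : nat) {k : trunc_index} {A : Type} {fA : Fib A} :
  IsTrunc k A -> IsTrunc (tadd j k) A.
Proof. intro h; induction j; [exact h | exact (istrunc_succ IHj)]. Qed.

Lemma nat_to_trunc_tadd (n : nat) :
  nat_to_trunc n = tadd (S (S n)) minus_two.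
Proof. induction n; cbn in *; [reflexivity | now rewrite IHn]. Qed.

Lemma tadd_tadd (i j : nat) (k : trunc_index) :
  tadd i (tadd j k) = tadd (i + j) k.
Proof. induction i; cbn; [reflexivity | now rewrite IHi]. Qed.

Lemma istrunc_prop_tadd (j : nat) {A : Type} {fA : Fib A} :
  IsTrunc (trunc_S minus_two) A -> IsTrunc (tadd (S j) minus_two) A.
Proof.
intro h; induction j; [exact h | exact (istrunc_succ IHj)].
Qed.

(** * Equivalences *)

Lemma isequiv_adjointify {A B : Type} (f : A -> B) (g : B -> A) :
  (forall a, g (f a) == a) -> (forall b, f (g b) == b) -> IsEquiv f.
Proof. intros r s; exact (existT _ g r, existT _ g s). Defined.

Definition equiv_inv {A B : Type} {f : A -> B} (e : IsEquiv f) : B -> A :=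
  projT1 (snd e).

Definition equiv_inv_r {A B : Type} {f : A -> B} (e : IsEquiv f) (b : B) :
  f (equiv_inv e b) == b := projT2 (snd e) b.

Lemma equiv_injective {A B : Type} {fA : Fib A} {fB : Fib B} {f : A -> B}
  (e : IsEquiv f) {x y : A} : f x == f y -> x == y.
Proof.
destruct e as [[g h] _]; intro p; exact ((h x)^-1 @ ap g p @ h y).
Qed.

Lemma equiv_inv_l {A B : Type} {fA : Fib A} {fB : Fib B} {f : A -> B}
  (e : IsEquiv f) (a : A) : equiv_inv e (f a) == a.
Proof. exact (equiv_injective e (equiv_inv_r e (f a))). Qed.

Lemma isequiv_homotopic {A B : Type} {fA : Fib A} {fB : Fib B} {f g : A -> B}
  (h : forall a, f a == g a) : IsEquiv f -> IsEquiv g.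
Proof.
intros [[l hl] [r hr]]; split.
- exists l; intro a; exact (ap l (h a)^-1 @ hl a).
- exists r; intro b; exact ((h _)^-1 @ hr b).
Qed.

Lemma isequiv_compose {A B C : Type} {fA : Fib A} {fB : Fib B} {fC : Fib C}
  {f : A -> B} {g : B -> C} :
  IsEquiv f -> IsEquiv g -> IsEquiv (fun a => g (f a)).
Proof.
intros ef eg.
refine (isequiv_adjointify _ (fun c => equiv_inv ef (equiv_inv eg c)) _ _).
- intro a; exact (ap (equiv_inv ef) (equiv_inv_l eg (f a)) @ equiv_inv_l ef a).
- intro c; exact (ap g (equiv_inv_r ef _) @ equiv_inv_r eg c).
Qed.

Lemma istrunc_equiv {k : trunc_index} {A B : Type} {fA : Fib A} {fB : Fib B} :
  IsTrunc k A -> IsTrunc k B -> IsTrunc k (Equiv A B).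
Proof.
intros hA hB; refine (istrunc_sig (istrunc_pi (fun _ => hB)) (fun f => _)).
refine (istrunc_prod _ _).
- refine (istrunc_sig (istrunc_pi (fun _ => hA)) (fun g => _)).
  exact (istrunc_pi (fun a => istrunc_path hA _ _)).
- refine (istrunc_sig (istrunc_pi (fun _ => hA)) (fun g => _)).
  exact (istrunc_pi (fun a => istrunc_path hB _ _)).
Qed.

(** * Univalence *)

Lemma transport_idtoequiv {u v : U} (p : u == v) (x : El u) :
  transport El p x == projT1 (idtoequiv p) x.
Proof. path_ind p; unfold idtoequiv; rewrite J_idp; strict; exact (idp _). Qed.

Definition ua {u v : U} (e : Equiv (El u) (El v)) : u == v :=
  equiv_inv (univalence u v) e.

Lemma transport_ua {u v : U} (e : Equiv (El u) (El v)) (x : El u) :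
  transport El (ua e) x == projT1 e x.
Proof.
refine (transport_idtoequiv _ x @ _).
exact (ap (fun e : Equiv (El u) (El v) => projT1 e x)
         (equiv_inv_r (univalence u v) e)).
Qed.

Definition TypeOf (k : trunc_index) : Type := {u : U & IsTrunc k (El u)}.

Lemma istrunc_TypeOf (k : trunc_index) : IsTrunc (trunc_S k) (TypeOf k).
Proof.
refine (istrunc_by_relation
  (fun u v : TypeOf k => Equiv (El (projT1 u)) (El (projT1 v))) _ _ _).
- intros [u hu] [v hv]; exact (istrunc_equiv hu hv).
- intro u; exact (equiv_id _).
- intros u v e; refine (path_sig _ _ (ua e)).
  intro w; exact (prop_path (prop_istrunc k)).
Qed.

End Truncation.
(** * Connectedness *)

Section Connected.
Context {TT : TypeTheory} {HT : HoTT}.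

Definition Tr_rec {k : trunc_index} {A : Type} {sA : Small A} {B : Type}
  {fB : Fib B} (hB : IsTrunc k B) (f : A -> B) : Tr k A -> B :=
  Tr_ind (fun _ => B) (fun _ => fB) (fun _ => hB) f.

Definition Tr_rec_tr {k : trunc_index} {A : Type} {sA : Small A} {B : Type}
  {fB : Fib B} (hB : IsTrunc k B) (f : A -> B) (a : A) :
  Tr_rec hB f (tr k a) = f a :=
  Tr_ind_tr (fun _ => B) (fun _ => fB) (fun _ => hB) f a.

Definition cast {A B : Type} (e : A = B) : A -> B :=
  match e with eq_refl => fun a => a end.

Definition castV {A B : Type} (e : A = B) : B -> A :=
  match e with eq_refl => fun a => a end.

Lemma cast_castV {A B : Type} (e : A = B) (b : B) : cast e (castV e b) = b.
Proof. destruct e; reflexivity. Qed.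

Section Family.
Context {k : trunc_index} {X : Type} {sX : Small X} (P : X -> Type)
  {sP : forall x, Small (P x)} (hP : forall x, IsTrunc k (P x)).

Definition tr_family : Tr (trunc_S k) X -> TypeOf k :=
  Tr_rec (istrunc_TypeOf k) (fun x => existT (fun u => IsTrunc k (El u))
    (code (P x)) (match eq_sym (El_code (P x)) in _ = B return IsTrunc k B
                  with eq_refl => hP x end)).

Lemma tr_family_tr (x : X) : El (projT1 (tr_family (tr _ x))) = P x.
Proof. unfold tr_family; rewrite Tr_rec_tr; exact (El_code (P x)). Qed.
End Family.

(** The family [Tr k (pt == x)] descends to the contractible type
    [Tr (trunc_S k) X] because it is classified by the [trunc_S k]-truncated
    type of [k]-types. *)
Lemma connected_path {k : trunc_index} {X : pType} :
  IsConnected (trunc_S k) X -> forall x : X, IsContr (Tr k (pt == x)).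
Proof.
intros c.
pose (P := fun x : X => Tr k (pt == x)).
assert (sP : forall x, Small (P x)) by (intro; apply small_Tr).
assert (hP : forall x, IsTrunc k (P x)) by (intro; apply istrunc_Tr).
pose (Q := fun z => El (projT1 (tr_family P hP z))).
pose (e := tr_family_tr P hP).
pose (s := fun x => cast (e x) (transport Q (contr_path c (tr _ pt) (tr _ x))
  (castV (e pt) (tr k (idp pt))))).
assert (hs : s pt == tr k (idp pt)).
{ unfold s.
  refine (ap (fun p => cast (e pt) (transport Q p
    (castV (e pt) (tr k (idp pt))))) _ @ _).
  - exact (contr_path (istrunc_succ (k := minus_two) c _ _) _ (idp _)).
  - rewrite transport_idp, cast_castV; exact (idp _). }
intro x; exists (s x).
refine (Tr_ind (fun z => s x == z) _ (fun z => istrunc_path (hP x) _ _) _).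
intro p; path_ind p; exact hs.
Qed.

Lemma connected_by_path {k : trunc_index} {X : pType} :
  (forall x : X, Tr k (pt == x)) -> IsConnected (trunc_S k) X.
Proof.
intro s; exists (tr _ pt).
refine (Tr_ind _ _ (fun z => istrunc_path (istrunc_Tr _ _ _) _ _) _); intro x.
refine (Tr_rec (istrunc_Tr (trunc_S k) X _ _ _) (fun p => ap _ p) (s x)).
Qed.

Section Extension.
Context {k : trunc_index} {X : pType}
  (c : forall x : X, IsContr (Tr k (pt == x))).

(** Sections with prescribed value at the basepoint; for a constant family
    these are the pointed maps. *)
Definition Ext {X : pType} (P : X -> Type) (p0 : P pt) : Type :=
  {s : forall x, P x & s pt == p0}.

#[export] Instance fib_Ext {Y : pType} (P : Y -> Type)
  {fP : forall x, Fib (P x)} (p0 : P pt) : Fib (Ext P p0).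
Proof. unfold Ext; exact _. Qed.

#[export] Instance small_Ext {Y : pType} (P : Y -> Type)
  {fP : forall x, Small (P x)} (p0 : P pt) : Small (Ext P p0).
Proof. unfold Ext; exact _. Qed.

Lemma path_Ext_over {Y : pType} {P : Y -> Type} {fP : forall x, Fib (P x)}
  {p0 : P pt} {u v : Ext P p0} (r : forall x, projT1 u x == projT1 v x) :
  r pt @ projT2 v == projT2 u ->
  {e : u == v & forall x, ap (fun w : Ext P p0 => projT1 w x) e == r x}.
Proof.
intro h.
assert (hr : forall x, ap (fun s : forall x, P x => s x) (path_pi r) == r x).
{ intro x; exact (ap (fun g : forall x, _ => g x)
    (projT2 (snd (funext P _ _ (projT1 u) (projT1 v))) r)). }
destruct (path_sigma_over (u := u) (v := v)
  (fun s : forall x, P x => s pt == p0) (path_pi r)) as [e he].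
- refine (transport_path_fg (fun s : forall x, P x => s pt) (fun _ => p0) _ _
    @ _).
  refine (ap (concat _) (ap_const p0 _) @ _); rewrite concat_idp.
  refine ((move_r_l (_ @ h))^-1).
  exact (ap (fun q => q @ projT2 v) (hr pt)).
- exists e; intro x; refine (_ @ hr x).
  refine (ap_compose (fun w : Ext P p0 => projT1 w)
    (fun s : forall x, P x => s x) e @ _).
  exact (ap (ap (fun s : forall x, P x => s x)) he).
Qed.

Definition path_Ext {Y : pType} {P : Y -> Type} {fP : forall x, Fib (P x)}
  {p0 : P pt} {u v : Ext P p0} (r : forall x, projT1 u x == projT1 v x)
  (h : r pt @ projT2 v == projT2 u) : u == v := projT1 (path_Ext_over r h).

Lemma contr_Ext (P : X -> Type) {fP : forall x, Fib (P x)}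
  (hP : forall x, IsTrunc k (P x)) (p0 : P pt) : IsContr (Ext P p0).
Proof.
assert (key : forall (P : X -> Type) (fP : forall x, Fib (P x))
  (hP : forall x, IsTrunc k (P x)) (p0 : P pt), Ext P p0).
{ clear P fP hP p0; intros P fP hP p0.
  exists (fun x => Tr_rec (hP x) (fun p => transport P p p0) (projT1 (c x))).
  refine (ap (Tr_rec (hP pt) _) (projT2 (c pt) (tr k (idp pt))) @ _).
  rewrite Tr_rec_tr, transport_idp; exact (idp _). }
exists (key P _ hP p0); intro v; set (u := key P _ hP p0); clearbody u.
destruct (key (fun x => projT1 u x == projT1 v x) _
  (fun x => istrunc_path (hP x) _ _) (projT2 u @ (projT2 v)^-1)) as [r h].
refine (path_Ext r (ap (fun q => q @ projT2 v) h @ _)).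
exact (concat_cancel_inverse_r _ _).
Qed.

Lemma connected_ext (P : X -> Type) {fP : forall x, Fib (P x)}
  (hP : forall x, IsTrunc k (P x)) (p0 : P pt) : Ext P p0.
Proof. exact (projT1 (contr_Ext P hP p0)). Qed.

(** The identity types of a type of extensions are again of this form, for the
    family of identity types of the fibres. *)
Lemma istrunc_Ext (j : nat) (P : X -> Type) {fP : forall x, Fib (P x)}
  (hP : forall x, IsTrunc (tadd j k) (P x)) (p0 : P pt) :
  IsTrunc (tadd j minus_two) (Ext P p0).
Proof.
revert P fP hP p0; induction j as [|j IH]; intros P fP hP p0.
- exact (contr_Ext P hP p0).
- refine (istrunc_by_relation (fun u v : Ext P p0 =>
    Ext (fun x => projT1 u x == projT1 v x) (projT2 u @ (projT2 v)^-1)) _ _ _).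
  + intros u v; exact (IH _ _ (fun x => hP x _ _) _).
  + intro u; exists (fun x => idp _); exact (inverse_r _)^-1.
  + intros u v [r h]; refine (path_Ext r (ap (fun q => q @ projT2 v) h @ _)).
    exact (concat_cancel_inverse_r _ _).
Qed.

End Extension.

Lemma nat_connected_path {i : nat} {X : pType} : IsConnected i X ->
  forall x : X, IsContr (Tr (tadd (S i) minus_two) (pt == x)).
Proof.
intro c; apply connected_path.
exact (match nat_to_trunc_tadd i in _ = k return IsConnected k X
       with eq_refl => c end).
Qed.

Lemma connected_prop {i : nat} {X : pType} (c : IsConnected i X)
  (P : X -> Type) {fP : forall x, Fib (P x)}
  (hP : forall x, IsTrunc (trunc_S minus_two) (P x)) : P pt -> forall x, P x.
Proof.
intro p; exact (projT1 (connected_ext (nat_connected_path c) P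
  (fun x => istrunc_prop_tadd i (hP x)) p)).
Qed.

Lemma loops_connected {i : nat} {X : pType} :
  IsConnected (S i) X -> IsConnected i (loops X).
Proof. intro c; exact (connected_path c pt). Qed.

(** Given [r], the extensions of [r x] along [Y] form a family over [X]
    truncated enough to have a section; [l] is its value at the basepoint. *)
Lemma wedge_extension {i j : nat} {X Y : pType} (cX : IsConnected i X)
  (cY : IsConnected j Y) (P : X -> Y -> Type)
  {fP : forall x y, Fib (P x y)} (hP : forall x y, IsTrunc (i + j) (P x y))
  (r : forall x, P x pt) (l : forall y, P pt y) (e : l pt == r pt) :
  {h : forall x y, P x y & ((forall x, h x pt == r x) *
                            (forall y, h pt y == l y))%type}.
Proof.
assert (hE : forall x, IsTrunc (tadd (S i) minus_two) (Ext (P x) (r x))).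
{ intro x; refine (istrunc_Ext (nat_connected_path cY) (S i) _ _ _).
  intro y; rewrite tadd_tadd; cbn [Nat.add]; rewrite <- plus_n_Sm.
  rewrite <- nat_to_trunc_tadd; exact (hP x y). }
destruct (connected_ext (nat_connected_path cX) _ hE (existT _ l e)) as [s h].
exists (fun x => projT1 (s x)); split.
- exact (fun x => projT2 (s x)).
- intro y; exact (ap (fun u : Ext (P pt) (r pt) => projT1 u y) h).
Qed.

(** Equality with the basepoint in the truncation holds on the two axes along
    [gluel] and [gluer], and extends to the product by [wedge_extension]. *)
Theorem smash_connected {i j : nat} {X Y : pType} (cX : IsConnected i X)
  (cY : IsConnected j Y) : IsConnected (S (i + j)) (Smash X Y).
Proof.
exists (tr (S (i + j)) pt).
refine (Tr_ind _ _ (fun z => istrunc_path (istrunc_Tr _ _ _) _ _) _).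
pose (Q := fun z : Smash X Y => @tr _ _ (S (i + j)) (Smash X Y) _ pt == tr _ z).
assert (fQ : forall z, Fib (Q z)) by (unfold Q; exact _).
assert (hQ : forall z, IsTrunc (i + j) (Q z)).
{ intro z; exact (istrunc_Tr (S (i + j)) (Smash X Y) _ _ _). }
pose (dl := transport Q (gluel pt) (idp _)).
pose (dr := transport Q (gluer pt) (idp _)).
destruct (wedge_extension cX cY (fun x y => Q (sm (x, y)))
  (fun x y => hQ _) (fun x => transport Q (gluer x)^-1 dr)
  (fun y => transport Q (gluel y)^-1 dl)) as [h [hr hl]].
{ exact (transport_inverse_l _ _ _ @ (transport_inverse_l _ _ _)^-1). }
refine (Smash_ind Q fQ (fun xy => match xy with (x, y) => h x y end) dl dr _ _).
- intro y; exact (ap _ (hl y) @ transport_inverse_r _ _ _).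
- intro x; exact (ap _ (hr x) @ transport_inverse_r _ _ _).
Qed.

End Connected.
(** * Pointed maps *)

Section Pointed.
Context {TT : TypeTheory} {HT : HoTT}.

#[export] Instance small_pMap (X Y : pType) : Small (pMap X Y).
Proof. unfold pMap; exact _. Qed.

Definition pconst (X Y : pType) : pMap X Y := existT _ (fun _ => pt) (idp pt).
Definition pid (X : pType) : pMap X X := existT _ (fun x => x) (idp pt).
Definition pcompose {X Y Z : pType} (g : pMap Y Z) (f : pMap X Y) : pMap X Z :=
  existT _ (fun x => g (f x)) (ap g (pmap_pt f) @ pmap_pt g).
Definition PMap (X Y : pType) : pType := PType (pMap X Y) (pconst X Y).

Definition path_pmap {X Y : pType} {f g : pMap X Y}
  (r : forall x, f x == g x) : r pt @ pmap_pt g == pmap_pt f -> f == g :=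
  path_Ext (P := fun _ => Y) (u := f) (v := g) r.

Definition pmap_path_at {X Y : pType} {f g : pMap X Y} (p : f == g) (x : X) :
  f x == g x := ap (fun h : pMap X Y => h x) p.

Lemma path_pmap_at {X Y : pType} {f g : pMap X Y} (r : forall x, f x == g x)
  (h : r pt @ pmap_pt g == pmap_pt f) (x : X) :
  pmap_path_at (path_pmap r h) x == r x.
Proof.
exact (projT2 (path_Ext_over (P := fun _ => Y) (u := f) (v := g) r h) x).
Qed.

Lemma pmap_path_pt {X Y : pType} {f g : pMap X Y} (p : f == g) :
  pmap_path_at p pt @ pmap_pt g == pmap_pt f.
Proof. path_ind p; unfold pmap_path_at; strict; exact (idp_concat _). Qed.

Definition whisker {X : pType} (d : idp (@pt _ X) == idp pt) (z : loops X) :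
  z == z :=
  (eq_to_id (concat_idp z))^-1 @ ap (fun w => z @ w) d
  @ eq_to_id (concat_idp z).

Lemma whisker_natural {X : pType} (d : idp (@pt _ X) == idp pt)
  {z z' : loops X} (e : z == z') : whisker d z @ e == e @ whisker d z'.
Proof. path_ind e; strict; exact (idp_concat _)^-1. Qed.

Lemma whisker_idp {X : pType} (d : idp (@pt _ X) == idp pt) :
  whisker d (idp pt) == d.
Proof.
unfold whisker; refine (concat_assoc _ _ _ @ (move_r_l _)^-1).
pose proof (h := ap_homotopic_id (fun w : loops X => idp pt @ w)
  (fun w => idp_concat w) d).
unfold idp_concat in h; rewrite J_idp in h; exact h^-1.
Qed.

(** A loop space is homogeneous, so that a homotopy between pointed maps into
    it can always be corrected, by whiskering, to respect the basepoints. *)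
Lemma path_pmap_loops {X Y : pType} {f g : pMap X (loops Y)} :
  (forall x, f x == g x) -> f == g.
Proof.
intro r.
pose (d := (r pt @ pmap_pt g)^-1 @ pmap_pt f).
refine (path_pmap (fun x => r x @ whisker d (g x)) _).
refine (concat_assoc _ _ _ @ _).
refine (ap (fun q => r pt @ q) (whisker_natural d (pmap_pt g)) @ _).
refine (ap (fun q => r pt @ (pmap_pt g @ q)) (whisker_idp d) @ _).
refine ((concat_assoc _ _ _)^-1 @ _).
exact (cancel_inverse_l _ _).
Qed.

Lemma loops_map_compose {X Y Z : pType} (g : pMap Y Z) (f : pMap X Y)
  (p : loops X) : loops_map (pcompose g f) p == loops_map g (loops_map f p).
Proof.
destruct Z as [Z sZ z], Y as [Y sY y], f as [f fp], g as [g gp].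
unfold pcompose, pmap_fun, pmap_pt in *; cbn in *.
path_ind gp; path_ind fp; strict; cbn; strict.
refine (idp_concat _ @ _ @ (idp_concat _)^-1).
exact (ap_compose f g p @ ap (ap g) (idp_concat _)^-1).
Qed.

Lemma loops_map_id {X : pType} (p : loops X) : loops_map (pid X) p == p.
Proof.
cbn; strict; exact (idp_concat _ @ ap_id p).
Qed.

Lemma loops_map_const {X Y : pType} (p : loops X) :
  loops_map (pconst X Y) p == idp pt.
Proof.
cbn; strict; exact (idp_concat _ @ ap_const _ p).
Qed.

Lemma loops_map_concat {X Y : pType} (f : pMap X Y) (p q : loops X) :
  loops_map f (p @ q : loops X) == (loops_map f p @ loops_map f q : loops Y).
Proof.
refine (ap (fun u => (pmap_pt f)^-1 @ u @ pmap_pt f) (ap_concat f p q) @ _).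
exact (conj_concat _ _ _).
Qed.

Lemma iloops_map_path (n : nat) {X Y : pType} {f g : pMap X Y} :
  f == g -> forall p, iloops_map n f p == iloops_map n g p.
Proof. intros e p; exact (ap (fun h => iloops_map n h p) e). Qed.

Lemma iloops_map_compose (n : nat) {X Y Z : pType} (g : pMap Y Z)
  (f : pMap X Y) :
  iloops_map n (pcompose g f) == pcompose (iloops_map n g) (iloops_map n f).
Proof.
induction n as [|n IH]; [exact (idp _) | cbn [iloops_map]].
refine (path_pmap_loops (fun p => _)).
exact (ap (fun h => loops_map h p) IH @ loops_map_compose _ _ p).
Qed.

Lemma iloops_map_compose_at (n : nat) {X Y Z : pType} (g : pMap Y Z)
  (f : pMap X Y) (p : iloops n X) :
  iloops_map n (pcompose g f) p == iloops_map n g (iloops_map n f p).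
Proof. exact (pmap_path_at (iloops_map_compose n g f) p). Qed.

Lemma iloops_map_id (n : nat) (X : pType) :
  iloops_map n (pid X) == pid (iloops n X).
Proof.
induction n as [|n IH]; [exact (idp _) | cbn [iloops_map]].
refine (path_pmap_loops (fun p => _)).
exact (ap (fun h => loops_map h p) IH @ loops_map_id p).
Qed.

Lemma iloops_map_const (n : nat) (X Y : pType) :
  iloops_map n (pconst X Y) == pconst (iloops n X) (iloops n Y).
Proof.
induction n as [|n IH]; [exact (idp _) | cbn [iloops_map]].
refine (path_pmap_loops (fun p => _)).
exact (ap (fun h => loops_map h p) IH @ loops_map_const p).
Qed.

Lemma ap_retraction {A B : Type} {fA : Fib A} {fB : Fib B} (f : A -> B)
  (g : B -> A) (h : forall a, g (f a) == a) {a b : A} (p : a == b) :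
  (h a)^-1 @ ap g (ap f p) @ h b == p.
Proof. path_ind p; strict; exact (inverse_l _). Qed.

(** The second inverse law holds because [ap g], having a retraction, is
    injective. *)
Lemma isequiv_ap {A B : Type} {fA : Fib A} {fB : Fib B} {f : A -> B}
  (e : IsEquiv f) (a b : A) : IsEquiv (fun p : a == b => ap f p).
Proof.
pose (g := equiv_inv e).
pose (h := equiv_inv_l e : forall a, g (f a) == a).
pose (k := equiv_inv_r e : forall b, f (g b) == b).
refine (isequiv_adjointify _ (fun q => (h a)^-1 @ ap g q @ h b) _ _).
- intro p; exact (ap_retraction f g h p).
- intro q; set (p := (h a)^-1 @ ap g q @ h b).
  pose proof (r := ap_retraction f g h p).
  refine ((ap_retraction g f k _)^-1 @ _ @ ap_retraction g f k q).
  refine (ap (fun u => (k (f a))^-1 @ ap f u @ k (f b)) _).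
  refine (concat_cancel_r (h b) (concat_cancel_l (h a)^-1 _)).
  exact ((concat_assoc _ _ _)^-1 @ r @ concat_assoc _ _ _).
Qed.

Lemma isequiv_loops_map {X Y : pType} (f : pMap X Y) :
  IsEquiv f -> IsEquiv (loops_map f).
Proof.
intro e.
destruct Y as [Y sY y], f as [f fp]; unfold pmap_fun in e; cbn in *.
revert e; path_ind fp; intro e.
refine (isequiv_homotopic (f := fun p : loops X => ap f p) _ (isequiv_ap e _ _)).
intro p; unfold loops_map, pmap_fun, pmap_pt; cbn; strict.
exact (idp_concat _)^-1.
Qed.

Lemma isequiv_iloops_map (n : nat) {X Y : pType} (f : pMap X Y) :
  IsEquiv f -> IsEquiv (iloops_map n f).
Proof.
intro e; induction n; [exact e | exact (isequiv_loops_map _ IHn)].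
Qed.

End Pointed.
(** * Maps out of a connected type are determined by their action on loops *)

Section Delooping.
Context {TT : TypeTheory} {HT : HoTT} {i : nat} {X T : pType}
  (cX : IsConnected i X) (f : loops X -> loops T).

(** A map [X -> T] inducing [f] on loops restricts along the canonical map
    [Susp (loops X) -> X] to the map given by [f].  Over [x] the fibre of the
    canonical map consists of two copies of [pt == x], one for each pole, joined
    by a path from [w @ p] to [p] for each loop [w].  So [ExtData x] is the type
    of values at [x], with the paths that identify them on this fibre with the
    map given by [f].  [LoopData] is what is left to choose over a point [p] of
    the fibre over the basepoint once the values at [idp] are known. *)
Definition LoopData (p : loops X) : Type :=
  {b : loops T & forall w : loops X, f (w @ p) == f w @ b}.

Definition ExtData (x : X) : Type :=
  {t : T & {beta : pt == x -> pt == t & {alpha : pt == x -> pt == t &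
    forall (p : pt == x) (w : loops X), alpha (w @ p) == f w @ beta p}}}.

Lemma contr_homotopy_idp (g : loops X -> loops T) :
  IsContr {alpha : loops X -> loops T &
           forall w, alpha (w @ idp pt) == g w}.
Proof.
refine (istrunc_retract (k := minus_two)
  (A := forall w, {a : loops T & a == g w})
  (fun s => existT (fun alpha : loops X -> loops T =>
       forall w, alpha (w @ idp pt) == g w) (fun w => projT1 (s w))
     (fun w => eq_rect_r (fun v => projT1 (s v) == g w)
        (projT2 (s w)) (concat_idp w)))
  (fun u w => existT _ (projT1 u w)
     (eq_rect (w @ idp pt) (fun v => projT1 u v == g w)
        (projT2 u w) w (concat_idp w))) _
  (istrunc_pi (k := minus_two) (P := fun w => {a : loops T & a == g w})
    (fun w => contr_path_to (g w)))).
intros [alpha h]; cbn.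
refine (ap (existT _ alpha) (path_pi (fun w => _))).
generalize (h w); generalize (concat_idp w).
generalize (w @ idp pt); intros v e; destruct e; intro q; exact (idp _).
Qed.

(** By connectedness it suffices to treat the basepoint.  There the data can be
    contracted in three steps: the value with its path at [idp], the function
    [alpha], and the remaining paths, which are [LoopData]. *)
Lemma contr_ExtData (hD : forall p, IsContr (LoopData p)) (x : X) :
  IsContr (ExtData x).
Proof.
revert x; refine (connected_prop cX _ (fun x => prop_istrunc minus_two) _).
pose (L := fun (t : T) (alpha : pt == pt -> pt == t) (p : loops X) =>
  {b : pt == t & forall w : loops X, alpha (w @ p) == f w @ b}).
pose (R := {tq : {t : T & pt == t} &
  {ae : {alpha : loops X -> pt == projT1 tq &
         forall w : loops X, alpha (w @ idp pt) == f w @ projT2 tq} &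
  {s : forall p, L (projT1 tq) (projT1 ae) p &
   s (idp pt) == existT _ (projT2 tq) (projT2 ae)}}}).
unshelve refine (istrunc_retract (k := minus_two) (A := R) (B := ExtData pt)
  _ _ _ _).
- intros [tq [ae [s _]]]; exists (projT1 tq), (fun p => projT1 (s p)),
    (projT1 ae); exact (fun p => projT2 (s p)).
- intros [t [b [a e]]]; exists (existT _ t (b (idp pt))).
  exists (existT _ a (fun w => e (idp pt) w)).
  exists (fun p => existT _ (b p) (e p)); exact (idp _).
- intros [t [b [a e]]]; exact (idp _).
- assert (e0 : forall w : loops X, f (w @ idp pt) == f w @ idp pt).
  { intro w; rewrite !concat_idp; exact (idp _). }
  refine (contr_sig_at (contr_path_from pt) (existT _ pt (idp pt)) _).
  refine (contr_sig_at (contr_homotopy_idp (fun w => f w @ idp pt))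
    (existT _ f e0) _).
  pose proof (cD := istrunc_pi (k := minus_two) (P := LoopData) hD).
  refine (istrunc_sig (k := minus_two) cD (fun s => _)).
  exact (istrunc_succ (k := minus_two) (hD (idp pt)) _ _).
Qed.

Section Deloop.
Context (hD : forall p, IsContr (LoopData p)).

Definition deloop : pMap X T :=
  existT _ (fun x => projT1 (projT1 (contr_ExtData hD x)))
    (projT1 (projT2 (projT1 (contr_ExtData hD pt))) (idp pt))^-1.

Lemma loops_map_deloop (f0 : f (idp pt) == idp pt) (w : loops X) :
  loops_map deloop w == f w.
Proof.
pose (b := fun x => projT1 (projT2 (projT1 (contr_ExtData hD x)))).
pose (a := fun x => projT1 (projT2 (projT2 (projT1 (contr_ExtData hD x))))).
pose proof (e := projT2 (projT2 (projT2 (projT1 (contr_ExtData hD pt))))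
  (idp pt)).
assert (ha : forall (x : X) (p : pt == x),
  a x p == a pt (idp pt) @ ap deloop p).
{ intros x p; path_ind p; strict; exact (idp _). }
pose proof (h0 := e (idp pt)); pose proof (h1 := e w).
rewrite concat_idp in h0, h1.
change (a pt (idp pt) == f (idp pt) @ b pt (idp pt)) in h0.
change (a pt w == f w @ b pt (idp pt)) in h1.
change ((b pt (idp pt))^-1^-1 @ ap deloop w @ (b pt (idp pt))^-1 == f w).
refine ((move_l_r (_ @ _))^-1).
{ exact (h1^-1 @ ha pt w). }
refine (ap (fun q => q @ ap deloop w) _).
refine (h0 @ ap (fun q => q @ _) f0 @ idp_concat _ @ (inverse_inverse _)^-1).
Qed.

(** Every map that acts on loops as [f] arises from points of the contractible
    types [ExtData x]; this is the source of uniqueness. *)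
Definition ext_of (F : pMap X T) (hF : forall w, loops_map F w == f w) (x : X) :
  ExtData x.
Proof.
exists (F x), (fun p => (pmap_pt F)^-1 @ ap F p),
  (fun p => (pmap_pt F)^-1 @ ap F p).
intros p w.
refine (_ @ ap (fun q => q @ ((pmap_pt F)^-1 @ ap F p)) (hF w)).
refine (_ @ (concat_assoc _ _ _)^-1).
refine (_ @ ap (fun q => _ @ q) (cancel_inverse_l _ _)^-1).
refine (ap (fun q => _ @ q) (ap_concat F w p) @ _).
exact (concat_assoc _ _ _)^-1.
Defined.

Lemma pmap_determined_by_loops (F G : pMap X T)
  (hF : forall w, loops_map F w == f w) (hG : forall w, loops_map G w == f w) :
  F == G.
Proof.
pose (c := fun x => contr_path (contr_ExtData hD x) (ext_of F hF x)
                      (ext_of G hG x)).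
pose (r := fun x => ap (fun u : ExtData x => projT1 u) (c x)).
refine (path_pmap r _).
assert (h : forall (u v : ExtData pt) (q : u == v),
  projT1 (projT2 u) (idp pt) @ ap (fun u : ExtData pt => projT1 u) q
  == projT1 (projT2 v) (idp pt)).
{ intros u v q; path_ind q; strict; exact (idp _). }
pose proof (k := h _ _ (c pt)); change (ap _ (c pt)) with (r pt) in k.
cbn in k; rewrite !ap_idp, !concat_idp in k.
refine (ap (fun q => q @ _) (move_r_l k) @ _).
refine (concat_cancel_inverse_r _ _ @ inverse_inverse _).
Qed.

End Deloop.
End Delooping.

Section Step.
Context {TT : TypeTheory} {HT : HoTT}.

(** For a set of loops the extra data is multiplicativity. *)
Lemma contr_LoopData_set {X T : pType} (hT : IsTrunc 1 T)
  (f : loops X -> loops T) (f0 : f (idp pt) == idp pt)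
  (hf : forall p q, f (p @ q : loops X) == (f p @ f q : loops T))
  (p : loops X) : IsContr (LoopData f p).
Proof.
exists (existT (fun b => forall w : loops X, f (w @ p) == f w @ b) (f p)
  (fun w => hf w p)); intros [b hb].
refine (path_sig _ _ _).
- intros c u v; refine (path_pi (fun w => _)); exact (set_path (hT _ _) _ _).
- cbn.
  refine ((idp_concat _)^-1 @ _ @ idp_concat _).
  refine (ap (fun q => q @ f p) f0^-1 @ _ @ ap (fun q => q @ b) f0).
  exact ((hf (idp pt) p)^-1 @ hb (idp pt)).
Qed.

Lemma contr_concat_l {A : Type} {fA : Fib A} {a b c : A} (q : a == b)
  (r : a == c) : IsContr {p : b == c & r == q @ p}.
Proof.
path_ind q.
refine (istrunc_retract (k := minus_two) (A := {p : a == c & r == p})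
  (fun u => existT (fun p => r == idp a @ p) (projT1 u)
     (projT2 u @ (idp_concat _)^-1))
  (fun u => existT _ (projT1 u) (projT2 u @ idp_concat _)) _
  (contr_path_from r)).
intros [p h].
exact (ap (existT (fun p => r == idp a @ p) p) (concat_inverse_cancel_r _ _)).
Qed.

(** One dimension up, multiplicativity is automatic and coherent: by
    connectedness the data over [p] is a proposition, and it holds over
    reflexivity. *)
Lemma contr_LoopData_connected {i : nat} {X T : pType}
  (cX : IsConnected (S i) X) (hT : IsTrunc (S (S i)) T)
  (f : loops X -> loops T) (f0 : f (idp pt) == idp pt)
  (p : loops X) : IsContr (LoopData f p).
Proof.
pose proof (cL := loops_connected cX).
assert (h : forall p : loops X, IsTrunc (trunc_S minus_two) (LoopData f p)).
{ clear p; intro p.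
  pose (B := {be : {b : loops T & f (idp pt @ p) == f (idp pt) @ b} &
    Ext (X := loops X) (fun w => f (w @ p) == f w @ projT1 be) (projT2 be)}).
  assert (hB : IsTrunc (trunc_S minus_two) B).
  { refine (istrunc_sig (istrunc_succ (k := minus_two) (contr_concat_l _ _))
      (fun be => _)).
    refine (istrunc_Ext (nat_connected_path cL) 1 _ _ _); intro w.
    change (IsTrunc (tadd (S (S i)) minus_two) (f (w @ p) == f w @ projT1 be)).
    rewrite <- nat_to_trunc_tadd; exact (hT _ _ _ _). }
  (* The path at [idp] determines [b], and the rest is an extension of it. *)
  unshelve refine (istrunc_retract (A := B) (B := LoopData f p) _ _ _ hB).
  - intros [be se]; exact (existT _ (projT1 be) (projT1 se)).
  - intros [b hb]; exists (existT _ b (hb (idp pt))).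
    exists hb; exact (idp _).
  - intros [b hb]; exact (idp _). }
apply (contr_inhabited_prop (h p)); revert p.
refine (connected_prop cL _ h _).
exists (idp pt); intro w; change (f (w @ idp pt) == f w @ idp pt).
rewrite !concat_idp; exact (idp _).
Qed.

End Step.

(** * Maps from a connected to a truncated type of the same dimension *)

Section Homotopy.
Context {TT : TypeTheory} {HT : HoTT}.

Lemma step_surj {i : nat} {X T : pType} (cX : IsConnected (S i) X)
  (hT : IsTrunc (S (S i)) T) (g : pMap (loops X) (loops T)) :
  {F : pMap X T & loops_map F == g}.
Proof.
pose (hD := contr_LoopData_connected cX hT g (pmap_pt g)).
exists (deloop cX g hD).
exact (path_pmap_loops (loops_map_deloop cX g hD (pmap_pt g))).
Qed.

Lemma step_inj {i : nat} {X T : pType} (cX : IsConnected (S i) X)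
  (hT : IsTrunc (S (S i)) T) (F G : pMap X T) :
  (forall w, loops_map F w == loops_map G w) -> F == G.
Proof.
intro h.
refine (pmap_determined_by_loops cX (loops_map G) _ F G h (fun w => idp _)).
exact (contr_LoopData_connected cX hT (loops_map G) (pmap_pt (loops_map G))).
Qed.

Lemma iloops_connected (j : nat) {i : nat} {X : pType} :
  IsConnected (j + i) X -> IsConnected i (iloops j X).
Proof.
revert i; induction j as [|j IH]; intros i c; [exact c|].
cbn [Nat.add] in c; rewrite plus_n_Sm in c.
exact (loops_connected (IH (S i) c)).
Qed.

Lemma iloops_istrunc (j : nat) {i : nat} {X : pType} :
  IsTrunc (j + i) X -> IsTrunc i (iloops j X).
Proof.
revert i; induction j as [|j IH]; intros i c; [exact c|].
cbn [Nat.add] in c; rewrite plus_n_Sm in c.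
exact (IH (S i) c _ _).
Qed.

Lemma iloops_surj (j : nat) {i : nat} {X T : pType}
  (cX : IsConnected (j + i) X) (hT : IsTrunc (j + S i) T)
  (g : pMap (iloops j X) (iloops j T)) :
  {F : pMap X T & iloops_map j F == g}.
Proof.
revert i cX hT g; induction j as [|j IH]; intros i cX hT g.
- exists g; exact (idp _).
- cbn [Nat.add] in cX, hT; rewrite plus_n_Sm in cX, hT.
  destruct (step_surj (iloops_connected j cX) (iloops_istrunc j hT) g)
    as [g' h'].
  destruct (IH (S i) cX hT g') as [F h]; exists F.
  exact (ap loops_map h @ h').
Qed.

Lemma iloops_inj (j : nat) {i : nat} {X T : pType}
  (cX : IsConnected (j + i) X) (hT : IsTrunc (j + S i) T) (F G : pMap X T) :
  iloops_map j F == iloops_map j G -> F == G.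
Proof.
revert i cX hT; induction j as [|j IH]; intros i cX hT h; [exact h|].
cbn [Nat.add] in cX, hT; rewrite plus_n_Sm in cX, hT.
refine (IH (S i) cX hT _).
refine (step_inj (iloops_connected j cX) (iloops_istrunc j hT) _ _ _).
exact (fun w => pmap_path_at h w).
Qed.

Definition untr {A : Type} {sA : Small A} (hA : IsSet A) : Tr 0 A -> A :=
  Tr_rec hA (fun a => a).

Lemma untr_tr {A : Type} {sA : Small A} (hA : IsSet A) (a : A) :
  untr hA (tr 0 a) = a.
Proof. exact (Tr_rec_tr hA _ a). Qed.

Lemma tr_untr {A : Type} {sA : Small A} (hA : IsSet A) (z : Tr 0 A) :
  tr 0 (untr hA z) == z.
Proof.
revert z; refine (Tr0_path (set_Tr A) (fun z => tr _ (untr hA z))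
  (fun z => z) _).
intro a; rewrite untr_tr; exact (idp _).
Qed.

Lemma loop_group_map_tr {X Y : pType} (f : pMap X Y) (p : loops X) :
  loop_group_map f (tr 0 p) = tr 0 (loops_map f p).
Proof. exact (Tr0_rec_tr _ _ p). Qed.

Lemma idempotent_loop {X : pType} (p : loops X) :
  (p @ p : loops X) == p -> p == idp pt.
Proof.
intro h; exact (concat_cancel_l p (h @ eq_to_id (eq_sym (concat_idp p)))).
Qed.

(** As [loops T] is a set, a homomorphism on the sets of components amounts to a
    multiplicative map of loops. *)
Lemma loop_group_surj {X T : pType} (cX : IsConnected 0 X) (hT : IsTrunc 1 T)
  (h : Hom (loop_group X) (loop_group T)) :
  {F : pMap X T & forall z, loop_group_map F z == h z}.
Proof.
pose (f := fun p : loops X => untr (hT pt pt) (h (tr 0 p)) : loops T).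
assert (hf : forall p q : loops X,
  f (p @ q : loops X) == (f p @ f q : loops T)).
{ intros p q; unfold f; rewrite <- tr_concat_tr.
  refine (ap (untr (hT pt pt)) (hom_op h _ _) @ _).
  assert (k : forall x y : Tr 0 (loops T), untr (hT pt pt) (tr_concat T x y) ==
    (untr (hT pt pt) x @ untr (hT pt pt) y : loops T)).
  { intros x y; revert x; refine (Tr0_path (hT pt pt) _ _ _); intro u.
    revert y; refine (Tr0_path (hT pt pt) _ _ _); intro v.
    rewrite tr_concat_tr, !untr_tr; exact (idp _). }
  exact (k _ _). }
assert (f0 : f (idp pt) == idp pt).
{ apply idempotent_loop; refine ((hf _ _)^-1 @ _).
  rewrite concat_idp; exact (idp _). }
exists (deloop cX f (contr_LoopData_set hT f f0 hf)).
refine (Tr0_path (set_Tr _) _ _ _); intro p.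
rewrite loop_group_map_tr.
refine (ap (tr 0) (loops_map_deloop cX f _ f0 p) @ _).
exact (tr_untr (hT pt pt) _).
Qed.

Lemma tr_injective {A : Type} {sA : Small A} (hA : IsSet A) {x y : A} :
  tr 0 x == tr 0 y -> x == y.
Proof.
intro e; pose proof (h := ap (untr hA) e); rewrite !untr_tr in h; exact h.
Qed.

Lemma loop_group_inj {X T : pType} (cX : IsConnected 0 X) (hT : IsTrunc 1 T)
  (F G : pMap X T) :
  (forall z, loop_group_map F z == loop_group_map G z) -> F == G.
Proof.
intro h.
refine (pmap_determined_by_loops cX (loops_map G) _ F G _ (fun w => idp _)).
- refine (contr_LoopData_set hT (loops_map G) (pmap_pt (loops_map G)) _).
  exact (loops_map_concat G).
- intro w; apply (tr_injective (hT pt pt)).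
  exact ((eq_to_id (loop_group_map_tr F w))^-1 @ h _
         @ eq_to_id (loop_group_map_tr G w)).
Qed.

Theorem pi_surj (j : nat) {X T : pType} (cX : IsConnected j X)
  (hT : IsTrunc (S j) T) (h : Hom (pi (S j) X) (pi (S j) T)) :
  {F : pMap X T & forall z, pi_map (S j) F z == h z}.
Proof.
rewrite (plus_n_O j) in cX, hT; rewrite plus_n_Sm in hT.
destruct (loop_group_surj (iloops_connected j cX) (iloops_istrunc j hT) h)
  as [g hg].
destruct (iloops_surj j cX hT g) as [F e]; exists F; intro z.
exact (ap (fun k => loop_group_map k z) e @ hg z).
Qed.

Theorem pi_inj (j : nat) {X T : pType} (cX : IsConnected j X)
  (hT : IsTrunc (S j) T) (F G : pMap X T) :
  (forall z, pi_map (S j) F z == pi_map (S j) G z) -> F == G.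
Proof.
rewrite (plus_n_O j) in cX, hT; rewrite plus_n_Sm in hT; intro h.
apply (iloops_inj j cX hT).
exact (loop_group_inj (iloops_connected j cX) (iloops_istrunc j hT) _ _ h).
Qed.

End Homotopy.
(** * Loops in a mapping space *)

Section MappingLoops.
Context {TT : TypeTheory} {HT : HoTT}.

Section One.
Context {Y L : pType}.

(** The cast removes the trivial path at the basepoint of the constant map. *)
Definition loops_PMap_fun (q : loops (PMap Y L)) : pMap Y (loops L) :=
  existT _ (fun y => pmap_path_at q y : loops L)
    (eq_rect (pmap_path_at q pt @ idp pt) (fun w => w == idp pt)
       (pmap_path_pt q) (pmap_path_at q pt) (concat_idp _)).

Definition loops_PMap : pMap (loops (PMap Y L)) (PMap Y (loops L)).
Proof.
exists loops_PMap_fun; refine (path_pmap_loops (fun y => _)).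
exact (eq_to_id (ap_idp _ _)).
Defined.

Definition loops_PMap_inv (h : pMap Y (loops L)) : loops (PMap Y L) :=
  path_pmap (f := pconst Y L) (g := pconst Y L) (fun y => h y)
    (eq_rect_r (fun w => w == idp pt) (pmap_pt h) (concat_idp _)).

Lemma loops_PMap_inv_r (h : pMap Y (loops L)) :
  loops_PMap (loops_PMap_inv h) == h.
Proof.
refine (path_pmap_loops (fun y => _)).
exact (path_pmap_at (f := pconst Y L) (g := pconst Y L) (fun y => h y) _ y).
Qed.

(** The other composite [e] is natural in its endpoint, whence
    [e q == e idp @ q]; it is idempotent by the first inverse law, so that
    [e idp] is trivial. *)
Lemma loops_PMap_inv_l (q : loops (PMap Y L)) :
  loops_PMap_inv (loops_PMap q) == q.
Proof.
pose (e := fun (g : pMap Y L) (q : pconst Y L == g) =>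
  path_pmap (pmap_path_at q) (pmap_path_pt q)).
assert (he : forall q : loops (PMap Y L),
  loops_PMap_inv (loops_PMap q) = e (pconst Y L) q).
{ intro p; unfold loops_PMap_inv, e; apply f_equal.
  exact (rew_opp_l (fun w => w == idp pt)
    (concat_idp (pmap_path_at p pt)) (pmap_path_pt p)). }
assert (hn : forall g (q : pconst Y L == g), e g q == e _ (idp _) @ q).
{ intros g p; path_ind p; strict; exact (idp _). }
assert (h0 : e _ (idp _) == idp _).
{ apply (concat_cancel_r (e _ (idp (pconst Y L)))).
  refine ((hn _ _)^-1 @ _ @ (idp_concat _)^-1).
  rewrite <- !he.
  exact (ap loops_PMap_inv (loops_PMap_inv_r _)). }
rewrite he; exact (hn _ q @ ap (fun p => p @ q) h0 @ idp_concat q).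
Qed.

Lemma isequiv_loops_PMap : IsEquiv loops_PMap.
Proof.
exact (isequiv_adjointify _ loops_PMap_inv loops_PMap_inv_l loops_PMap_inv_r).
Qed.

Definition pev (y : Y) : pMap (PMap Y L) L :=
  existT (fun h : PMap Y L -> L => h pt == pt) (fun h : pMap Y L => h y)
    (idp pt).

Lemma loops_PMap_at (q : loops (PMap Y L)) (y : Y) :
  pmap_fun (loops_PMap q) y == loops_map (pev y) q.
Proof. cbn; strict; exact (idp_concat _)^-1. Qed.

End One.

Fixpoint iloops_PMap (n : nat) (Y K : pType) :
  pMap (iloops n (PMap Y K)) (PMap Y (iloops n K)) :=
  match n with
  | O => pid _
  | S n => pcompose loops_PMap (loops_map (iloops_PMap n Y K))
  end.

Lemma isequiv_iloops_PMap (n : nat) (Y K : pType) :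
  IsEquiv (iloops_PMap n Y K).
Proof.
induction n as [|n IH].
- exact (isequiv_adjointify _ (fun x => x) (fun x => idp _) (fun x => idp _)).
- exact (isequiv_compose (isequiv_loops_map _ IH) isequiv_loops_PMap).
Qed.

(** [iloops_PMap] is defined by recursion, so as to be an equivalence; this
    describes its values. *)
Lemma pev_iloops_PMap (n : nat) {Y K : pType} (y : Y) :
  pcompose (pev y) (iloops_PMap n Y K) == iloops_map n (pev y).
Proof.
induction n as [|n IH].
- refine (path_pmap (f := pcompose (pev y) (pid _)) (g := pev y)
    (fun h => idp _) _); cbn; strict; exact (idp _).
- refine (path_pmap_loops (fun p => _)).
  refine (loops_PMap_at _ y @ _).
  refine ((loops_map_compose _ _ p)^-1 @ _).
  exact (ap (fun h => loops_map h p) IH).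
Qed.

Lemma iloops_PMap_at (n : nat) {Y K : pType} (p : iloops n (PMap Y K)) (y : Y) :
  pmap_fun (iloops_PMap n Y K p) y == iloops_map n (pev y) p.
Proof. exact (pmap_path_at (pev_iloops_PMap n y) p). Qed.

End MappingLoops.

(** * Loops in a product *)

Section ProductLoops.
Context {TT : TypeTheory} {HT : HoTT}.

Definition PProd (M N : pType) : pType := PType (M * N)%type (pt, pt).

Section Maps.
Context {M N Y : pType}.
Definition pfst : pMap (PProd M N) M :=
  existT (fun f : PProd M N -> M => f pt == pt) (fun u => fst u) (idp pt).
Definition psnd : pMap (PProd M N) N :=
  existT (fun f : PProd M N -> N => f pt == pt) (fun u => snd u) (idp pt).
Definition pinl : pMap M (PProd M N) :=
  existT (fun f : M -> PProd M N => f pt == pt) (fun x => (x, pt)) (idp _).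
Definition pinr : pMap N (PProd M N) :=
  existT (fun f : N -> PProd M N => f pt == pt) (fun y => (pt, y)) (idp _).
Definition ppair (u : pMap Y M) (v : pMap Y N) : pMap Y (PProd M N) :=
  existT (fun f : Y -> PProd M N => f pt == pt) (fun y => (u y, v y))
    (ap (fun a => (a, v pt)) (pmap_pt u) @ ap (fun b => (pt, b)) (pmap_pt v)).
End Maps.

Definition path_prod {A B : Type} {fA : Fib A} {fB : Fib B} {a a' : A}
  {b b' : B} (p : a == a') (q : b == b') : (a, b) == (a', b') :=
  ap (fun x => (x, b)) p @ ap (fun y => (a', y)) q.

Lemma ap_fst_path_prod {A B : Type} {fA : Fib A} {fB : Fib B} {a a' : A}
  {b b' : B} (p : a == a') (q : b == b') : ap fst (path_prod p q) == p.
Proof.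
unfold path_prod; path_ind p; path_ind q; strict; exact (idp _).
Qed.

Lemma ap_snd_path_prod {A B : Type} {fA : Fib A} {fB : Fib B} {a a' : A}
  {b b' : B} (p : a == a') (q : b == b') : ap snd (path_prod p q) == q.
Proof.
unfold path_prod; path_ind p; path_ind q; strict; exact (idp _).
Qed.

Lemma path_prod_eta {A B : Type} {fA : Fib A} {fB : Fib B} {u v : A * B}
  (r : u == v) :
  (match u, v return u == v -> u == v with (a, b), (a', b') => fun r =>
    path_prod (ap fst r) (ap snd r) end) r == r.
Proof.
path_ind r; destruct u; unfold path_prod; strict; exact (idp _).
Qed.

Lemma pfst_ppair {M N Y : pType} (u : pMap Y M) (v : pMap Y N) :
  pcompose pfst (ppair u v) == u.
Proof.
refine (path_pmap (f := pcompose pfst (ppair u v)) (g := u) (fun y => idp _) _).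
refine (idp_concat _ @ _); cbn; rewrite concat_idp.
exact (ap_fst_path_prod _ _)^-1.
Qed.

Lemma psnd_ppair {M N Y : pType} (u : pMap Y M) (v : pMap Y N) :
  pcompose psnd (ppair u v) == v.
Proof.
refine (path_pmap (f := pcompose psnd (ppair u v)) (g := v) (fun y => idp _) _).
refine (idp_concat _ @ _); cbn; rewrite concat_idp.
exact (ap_snd_path_prod _ _)^-1.
Qed.

Definition loops_ppair (M N : pType) : loops (PProd M N) -> loops M * loops N :=
  fun r => (loops_map pfst r, loops_map psnd r).

Lemma isequiv_loops_ppair (M N : pType) : IsEquiv (loops_ppair M N).
Proof.
assert (h1 : forall r : loops (PProd M N), loops_map pfst r == ap fst r).
{ intro r; cbn; strict; exact (idp_concat _). }
assert (h2 : forall r : loops (PProd M N), loops_map psnd r == ap snd r).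
{ intro r; cbn; strict; exact (idp_concat _). }
refine (isequiv_adjointify _ (fun u : loops M * loops N =>
  path_prod (fst u) (snd u) : loops (PProd M N)) _ _).
- intro r; refine (_ @ path_prod_eta r).
  exact (ap (fun p => path_prod p _) (h1 r) @ ap (path_prod _) (h2 r)).
- intros [p q]; refine (path_prod _ _).
  + exact (h1 _ @ ap_fst_path_prod p q).
  + exact (h2 _ @ ap_snd_path_prod p q).
Qed.

Lemma isequiv_iloops_ppair (n : nat) (M N : pType) :
  IsEquiv (ppair (iloops_map n (@pfst M N)) (iloops_map n (@psnd M N))).
Proof.
induction n as [|n IH].
- refine (isequiv_adjointify _ (fun x => x) _ _); intros [x y]; exact (idp _).
- refine (isequiv_homotopic _
    (isequiv_compose (isequiv_loops_map _ IH) (isequiv_loops_ppair _ _))).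
  intro r; refine (path_prod _ _).
  + refine ((loops_map_compose _ _ r)^-1 @ _).
    exact (ap (fun h => loops_map h r) (pfst_ppair _ _)).
  + refine ((loops_map_compose _ _ r)^-1 @ _).
    exact (ap (fun h => loops_map h r) (psnd_ppair _ _)).
Qed.

Lemma iloops_prod_path (n : nat) {M N : pType} {r s : iloops n (PProd M N)} :
  iloops_map n pfst r == iloops_map n pfst s ->
  iloops_map n psnd r == iloops_map n psnd s -> r == s.
Proof.
intros h k; apply (equiv_injective (isequiv_iloops_ppair n M N)).
exact (path_prod h k).
Qed.

Definition loops_op (L : pType) : pMap (PProd (loops L) (loops L)) (loops L) :=
  existT (fun f : PProd (loops L) (loops L) -> loops L => f pt == pt)
    (fun u => fst u @ snd u) (eq_to_id (concat_idp (idp pt))).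

Definition pmap_mul {Y L : pType} (u v : pMap Y (loops L)) : pMap Y (loops L) :=
  pcompose (loops_op L) (ppair u v).

(** The Eckmann-Hilton argument: an element of a loop space of a product is
    the concatenation of its two components, and applying loops to a map
    preserves concatenation. *)
Lemma iloops_map_mul (n : nat) {Y L : pType} (u v : pMap Y (loops L))
  (z : iloops (S n) Y) :
  iloops_map (S n) (pmap_mul u v) z ==
  (iloops_map (S n) u z @ iloops_map (S n) v z : loops (iloops n (loops L))).
Proof.
pose (r := iloops_map (S n) (ppair u v) z).
assert (h1 : iloops_map (S n) pfst r == iloops_map (S n) u z).
{ refine ((iloops_map_compose_at (S n) _ _ z)^-1 @ _).
  exact (iloops_map_path (S n) (pfst_ppair u v) z). }
assert (h2 : iloops_map (S n) psnd r == iloops_map (S n) v z).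
{ refine ((iloops_map_compose_at (S n) _ _ z)^-1 @ _).
  exact (iloops_map_path (S n) (psnd_ppair u v) z). }
assert (hr : r == (iloops_map (S n) pinl (iloops_map (S n) u z)
  @ iloops_map (S n) pinr (iloops_map (S n) v z)
  : loops (iloops n (PProd (loops L) (loops L))))).
{ assert (c : forall (A B : pType) (i : pMap A B) (w : iloops (S n) A),
    i == pconst A B -> iloops_map (S n) i w == idp pt).
  { intros A B i w e; refine (iloops_map_path (S n) e w @ _).
    exact (pmap_path_at (iloops_map_const (S n) A B) w). }
  assert (d : forall (A : pType) (i : pMap A A) (w : iloops (S n) A),
    i == pid A -> iloops_map (S n) i w == w).
  { intros A i w e; refine (iloops_map_path (S n) e w @ _).
    exact (pmap_path_at (iloops_map_id (S n) A) w). }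
  refine (iloops_prod_path (S n) _ _).
  - refine (h1 @ _ @ (loops_map_concat (iloops_map n pfst) _ _)^-1).
    refine ((eq_to_id (concat_idp _))^-1 @ _).
    refine (ap (fun p => p @ _) _ @ ap (concat _) _).
    + refine (_ @ iloops_map_compose_at (S n) _ _ _).
      refine (d _ _ _ _)^-1.
      exact (path_pmap_loops (f := pcompose pfst pinl) (g := (pid _))
        (fun x => idp _)).
    + refine (_ @ iloops_map_compose_at (S n) _ _ _).
      refine (c _ _ _ _ _)^-1.
      exact (path_pmap_loops (f := pcompose pfst pinr) (g := (pconst _ _))
        (fun x => idp _)).
  - refine (h2 @ _ @ (loops_map_concat (iloops_map n psnd) _ _)^-1).
    refine ((idp_concat _)^-1 @ _).
    refine (ap (fun p => p @ _) _ @ ap (concat _) _).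
    + refine (_ @ iloops_map_compose_at (S n) _ _ _).
      refine (c _ _ _ _ _)^-1.
      exact (path_pmap_loops (f := pcompose psnd pinl) (g := (pconst _ _))
        (fun x => idp _)).
    + refine (_ @ iloops_map_compose_at (S n) _ _ _).
      refine (d _ _ _ _)^-1.
      exact (path_pmap_loops (f := pcompose psnd pinr) (g := (pid _))
        (fun x => idp _)). }
refine (iloops_map_compose_at (S n) _ _ z @ _); fold r.
refine (ap (iloops_map (S n) (loops_op L)) hr @ _).
refine (loops_map_concat (iloops_map n (loops_op L)) _ _ @ _).
refine (ap (fun p => p @ _) _ @ ap (concat _) _).
- refine ((iloops_map_compose_at (S n) _ _ _)^-1 @ _).
  refine (iloops_map_path (S n) (g := pid _) _ _ @ _).
  + refine (path_pmap_loops (fun x => _)).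
    exact (eq_to_id (concat_idp x)).
  + exact (pmap_path_at (iloops_map_id (S n) _) _).
- refine ((iloops_map_compose_at (S n) _ _ _)^-1 @ _).
  refine (iloops_map_path (S n) (g := pid _) _ _ @ _).
  + refine (path_pmap_loops (fun x => _)).
    exact (idp_concat x).
  + exact (pmap_path_at (iloops_map_id (S n) _) _).
Qed.

End ProductLoops.

(** * The pairing of homotopy classes *)

Section Pairing.
Context {TT : TypeTheory} {HT : HoTT}.

Definition iloops_ev (n : nat) (X Z : pType) (a : iloops n X) :
  pMap (PMap X Z) (iloops n Z) :=
  existT (fun k : PMap X Z -> iloops n Z => k pt == pt)
    (fun h : pMap X Z => iloops_map n h a)
    (pmap_path_at (iloops_map_const n X Z) a).

(** For the inclusions into the smash product this is the class of the smash
    product of two maps out of spheres. *)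
Definition pairing (n m : nat) {X Y Z : pType} (H : pMap Y (PMap X Z))
  (a : iloops n X) (b : iloops m Y) : iloops m (iloops n Z) :=
  iloops_map m (pcompose (iloops_ev n X Z a) H) b.

Lemma pairing_add_r (n m : nat) {X Y Z : pType} (H : pMap Y (PMap X Z))
  (a : iloops (S n) X) (b b' : iloops (S m) Y) :
  pairing (S n) (S m) H a (b @ b' : loops (iloops m Y)) ==
  (pairing (S n) (S m) H a b @ pairing (S n) (S m) H a b'
    : loops (iloops m (iloops (S n) Z))).
Proof. exact (loops_map_concat _ b b'). Qed.

Lemma pairing_add_l (n m : nat) {X Y Z : pType} (H : pMap Y (PMap X Z))
  (a a' : iloops (S n) X) (b : iloops (S m) Y) :
  pairing (S n) (S m) H (a @ a' : loops (iloops n X)) b ==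
  (pairing (S n) (S m) H a b @ pairing (S n) (S m) H a' b
    : loops (iloops m (iloops (S n) Z))).
Proof.
refine (_ @ iloops_map_mul m _ _ b).
refine (iloops_map_path (S m) (path_pmap_loops (fun y => _)) b).
exact (loops_map_concat (iloops_map n (H y : pMap X Z)) a a').
Qed.

(** Both sides are loops of pointed maps from [Y] into a loop space, and such maps
    are equal as soon as they agree at each [y]. *)
Lemma pairing_natural (n m : nat) {X X' Y Y' Z Z' : pType} (f : pMap X X')
  (g : pMap Y Y') (phi : pMap Z Z') (H : pMap Y (PMap X Z))
  (H' : pMap Y' (PMap X' Z'))
  (e : forall y, pcompose phi (H y : pMap X Z) ==
                 pcompose (H' (g y) : pMap X' Z') f)
  (a : iloops (S n) X) (b : iloops m Y) :
  iloops_map m (iloops_map (S n) phi) (pairing (S n) m H a b) ==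
  pairing (S n) m H' (iloops_map (S n) f a) (iloops_map m g b).
Proof.
refine ((iloops_map_compose_at m _ _ b)^-1 @ _ @ iloops_map_compose_at m _ _ b).
refine (iloops_map_path m (path_pmap_loops (Y := iloops n Z') (fun y => _)) b).
refine ((iloops_map_compose_at (S n) _ _ a)^-1 @ _
        @ iloops_map_compose_at (S n) _ _ a).
exact (iloops_map_path (S n) (e y) a).
Qed.

(** For a family that comes from a map into [PMap Y K], loops in [X] can be
    taken before evaluating at [y]. *)
Lemma pairing_swap (n m : nat) {X Y K : pType} (F : pMap X (PMap Y K))
  (H : pMap Y (PMap X K))
  (e : forall y, pcompose (pev y) F == (H y : pMap X K))
  (a : iloops (S n) X) (b : iloops m Y) :
  pairing (S n) m H a b ==
  iloops_map m (iloops_PMap (S n) Y K (iloops_map (S n) F a) : pMap _ _) b.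
Proof.
refine (iloops_map_path m (path_pmap_loops (Y := iloops n K) (fun y => _)) b).
refine (_ @ (iloops_PMap_at (S n) _ y)^-1).
refine (_ @ iloops_map_compose_at (S n) _ _ a).
exact (iloops_map_path (S n) (e y)^-1 a).
Qed.

End Pairing.
(** * Maps out of a smash product *)

Section SmashMaps.
Context {TT : TypeTheory} {HT : HoTT}.

Lemma apd_const {A B : Type} {fA : Fib A} {fB : Fib B} (f : A -> B) {a b : A}
  (p : a == b) : apd f p == transport_const p (f a) @ ap f p.
Proof.
path_ind p; unfold apd, transport_const; rewrite !J_idp, ap_idp, concat_idp.
generalize (transport_idp (a := a) (fun _ : A => B) (f a)); intro e; destruct e.
exact (idp _).
Qed.

(** Two constant families over a path differ by [transport_const], which is
    natural, so that the dependent computation rules for paths give the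
    non-dependent ones. *)
Lemma ap_from_apd {A B : Type} {fA : Fib A} {fB : Fib B} (f : A -> B) {a b : A}
  (p : a == b) {u v : B} (s : f a == u) (t : f b == v) (g : u == v) :
  apd f p == ap (transport (fun _ => B) p) s @ (transport_const p u @ g) @ t^-1 ->
  ap f p == s @ g @ t^-1.
Proof.
intro h; apply (concat_cancel_l (transport_const p (f a))).
refine ((apd_const f p)^-1 @ h @ _).
set (c := transport_const p); clearbody c.
refine (_ @ concat_assoc (c (f a)) (s @ g) t^-1).
refine (ap (fun q => q @ t^-1) _).
refine ((concat_assoc _ (c u) g)^-1 @ _ @ concat_assoc (c (f a)) s g).
refine (ap (fun q => q @ g) _).
refine (homotopy_natural (f := transport (fun _ => B) p) (g := fun x => x)
  c s @ _).
exact (ap (fun q => c (f a) @ q) (ap_id s)).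
Qed.

Section Rec.
Context {X Y : pType} {K : Type} {fK : Fib K} (dsm : X * Y -> K) (dl dr : K)
  (gl : forall y, dsm (pt, y) == dl) (gr : forall x, dsm (x, pt) == dr).

Definition smash_rec : Smash X Y -> K :=
  Smash_ind (fun _ => K) (fun _ => fK) dsm dl dr
    (fun y => transport_const _ _ @ gl y) (fun x => transport_const _ _ @ gr x).

Definition smash_rec_sm (xy : X * Y) : smash_rec (sm xy) == dsm xy :=
  eq_to_id (Smash_ind_sm (fun _ => K) (fun _ => fK) dsm dl dr
    (fun y => transport_const _ _ @ gl y) (fun x => transport_const _ _ @ gr x)
    xy).

Definition smash_rec_auxl : smash_rec auxl == dl :=
  eq_to_id (Smash_ind_auxl (fun _ => K) (fun _ => fK) dsm dl dr
    (fun y => transport_const _ _ @ gl y) (fun x => transport_const _ _ @ gr x)).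

Lemma smash_rec_gluel (y : Y) : ap smash_rec (gluel y) ==
  smash_rec_sm (pt, y) @ gl y @ smash_rec_auxl^-1.
Proof.
apply ap_from_apd.
exact (Smash_ind_gluel (fun _ => K) (fun _ => fK) dsm dl dr
  (fun y => transport_const _ _ @ gl y) (fun x => transport_const _ _ @ gr x) y).
Qed.

End Rec.

Definition smash_incl_at {X Y : pType} (y : Y) : pMap X (Smash X Y) :=
  existT (fun f : X -> Smash X Y => f pt == pt) (fun x => sm (x, y))
    (gluel y @ (gluel pt)^-1).

Definition smash_incl (X Y : pType) : pMap Y (PMap X (Smash X Y)).
Proof.
exists (fun y => smash_incl_at y).
refine (path_pmap (f := smash_incl_at pt) (g := pconst X (Smash X Y))
  (fun x => gluer x @ (gluer pt)^-1) _).
exact (eq_to_id (concat_idp _) @ inverse_r _ @ (inverse_r _)^-1).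
Defined.

(** The shape in which the computation rule for [gluel] occurs, once for [y]
    and once, inverted, for the basepoint. *)
Lemma cancel_middle {A : Type} {fA : Fib A} {a b c d a' c' d' : A}
  (s : a == b) (g : b == c) (t : d == c) (s' : a' == c') (g' : c' == c)
  (k : c' == d') (l : d' == c) (h : k @ l == g') :
  (s @ g @ t^-1) @ (s' @ g' @ t^-1)^-1 @ (s' @ k) == s @ (g @ l^-1).
Proof.
path_ind h.
revert t l; revert c g; path_ind s; intros c g; path_ind g; intros t l.
revert t; revert l; revert d' k; path_ind s'; intros d' k; path_ind k; intro l; path_ind l.
intro t; path_ind t; strict; exact (idp _).
Qed.

Lemma smash_map_natural {X X' Y Y' : pType} (f : pMap X X') (g : pMap Y Y')
  (y : Y) :
  pcompose (smash_map f g) (smash_incl X Y y : pMap _ _) ==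
  pcompose (smash_incl X' Y' (g y) : pMap _ _) f.
Proof.
pose (phi := smash_map_fun f g : Smash X Y -> Smash X' Y').
pose (s := smash_rec_sm (smash_map_sm f g) auxl auxr (smash_map_gluel f g)
  (smash_map_gluer f g)).
refine (path_pmap (f := pcompose (smash_map f g) (smash_incl_at y))
  (g := pcompose (smash_incl_at (g y)) f) (fun x => s (x, y)) _).
change (s (pt, y) @ (ap (fun x' => sm (x', g y)) (pmap_pt f)
    @ (gluel (g y) @ (gluel pt)^-1)) ==
  ap phi (gluel y @ (gluel pt)^-1) @ (s (pt, pt)
     @ ap (fun x' => sm (x', g pt)) (pmap_pt f)
     @ ap (fun y' => sm (pt, y')) (pmap_pt g))).
pose (bl := smash_rec_gluel (smash_map_sm f g) auxl auxr
  (smash_map_gluel f g) (smash_map_gluer f g)).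
refine (_ @ ap (fun q => q @ _) (ap_concat phi _ _)^-1).
refine (_ @ ap (fun q => ap phi (gluel y) @ q @ _) (ap_inverse phi _)^-1).
refine (_ @ ap (fun q => q @ (ap phi (gluel pt))^-1 @ _) (bl y)^-1).
refine (_ @ ap (fun q => _ @ q^-1 @ _) (bl pt)^-1).
refine (_ @ ap (concat _) (concat_assoc _ _ _)^-1).
refine (_ @ (cancel_middle _ _ _ _ _ _ (gluel pt) _)^-1).
- exact (ap (concat _) (concat_assoc _ _ _)^-1).
- refine (concat_assoc _ _ _ @ ap (concat _) _).
  refine (homotopy_natural (g := fun _ => auxl) (fun y' => gluel y') (pmap_pt g)
    @ _).
  exact (ap (concat _) (ap_const _ _) @ eq_to_id (concat_idp _)).
Qed.

(** A pointed map [G] out of the smash product and a pointed map [F] into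
    [PMap Y K] are matched by comparing [G] on the inclusion at each [y] with
    [F] evaluated at [y], since only this enters into the pairing. *)
Section Curry.
Context {X Y K : pType}.

Lemma uncurry (F : pMap X (PMap Y K)) : {G : pMap (Smash X Y) K &
  forall y, pcompose G (smash_incl X Y y : pMap _ _) == pcompose (pev y) F}.
Proof.
pose (dsm := fun xy : X * Y => (F (fst xy) : pMap Y K) (snd xy)).
pose (gl := fun y => pmap_path_at (pmap_pt F) y : dsm (pt, y) == pt).
pose (gr := fun x => pmap_pt (F x : pMap Y K) : dsm (x, pt) == pt).
pose (G := smash_rec dsm pt pt gl gr : Smash X Y -> K).
pose (s := smash_rec_sm dsm pt pt gl gr).
exists (existT (fun G : Smash X Y -> K => G pt == pt) G
  (s (pt, pt) @ gl pt)).
intro y.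
refine (path_pmap (f := pcompose (existT _ G (s (pt, pt) @ gl pt))
  (smash_incl_at y)) (g := pcompose (pev y) F) (fun x => s (x, y)) _).
change (s (pt, y) @ (gl y @ idp pt) ==
  ap G (gluel y @ (gluel pt)^-1) @ (s (pt, pt) @ gl pt)).
pose (bl := smash_rec_gluel dsm pt pt gl gr).
refine (_ @ ap (fun q => q @ _) (ap_concat G _ _)^-1).
refine (_ @ ap (fun q => ap G (gluel y) @ q @ _) (ap_inverse G _)^-1).
refine (_ @ ap (fun q => q @ (ap G (gluel pt))^-1 @ _) (bl y)^-1).
refine (_ @ ap (fun q => _ @ q^-1 @ _) (bl pt)^-1).
refine (_ @ (cancel_middle _ _ _ _ _ _ (idp pt) (eq_to_id (concat_idp _)))^-1).
rewrite inverse_idp; exact (idp _).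
Qed.

Section Curried.
Variable G : pMap (Smash X Y) K.

Definition curry_at (x : X) : pMap Y K :=
  existT (fun f : Y -> K => f pt == pt) (fun y => G (sm (x, y)))
    (ap G (gluer x @ (gluer pt)^-1) @ pmap_pt G).

Definition curry_pt_at (y : Y) : G (sm (pt, y)) == pt :=
  ap G (gluel y @ (gluel pt)^-1) @ pmap_pt G.

Lemma curry_pt_coherent :
  curry_pt_at pt @ idp pt == ap G (gluer pt @ (gluer pt)^-1) @ pmap_pt G.
Proof.
rewrite concat_idp.
exact (ap (fun q => ap G q @ pmap_pt G) (inverse_r _ @ (inverse_r _)^-1)).
Qed.

Definition curry : pMap X (PMap Y K) :=
  existT (fun F : X -> PMap Y K => F pt == pt) curry_at
    (path_pmap (f := curry_at pt) (g := pconst Y K) curry_pt_at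
       curry_pt_coherent).

Lemma pev_curry (y : Y) :
  pcompose (pev y) curry == pcompose G (smash_incl X Y y : pMap _ _).
Proof.
refine (path_pmap (f := pcompose (pev y) curry)
  (g := pcompose G (smash_incl_at y)) (fun x => idp _) _).
refine (idp_concat _ @ _).
refine ((path_pmap_at (f := curry_at pt) (g := pconst Y K) curry_pt_at
  curry_pt_coherent y)^-1 @ _).
exact (eq_to_id (eq_sym (concat_idp _))).
Qed.

(** The path from [curry G] to the constant map contains a null-homotopy of [G]
    on the product; its compatibility with the basepoints of [X] and of [Y] says
    that it extends over [gluel] and [gluer]. *)
Lemma curry_const : curry == pconst X (PMap Y K) -> G == pconst (Smash X Y) K.
Proof.
intro p.
pose (q := fun x => pmap_path_at p x : curry_at x == pconst Y K).
pose (h := fun x y => pmap_path_at (q x) y : G (sm (x, y)) == pt).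
assert (hl : forall y, h pt y == curry_pt_at y).
{ intro y; refine (_ @ path_pmap_at (f := curry_at pt) (g := pconst Y K)
    curry_pt_at curry_pt_coherent y).
  refine (ap (fun r : curry_at pt == pconst Y K => pmap_path_at r y) _).
  exact (eq_to_id (eq_sym (concat_idp _)) @ pmap_path_pt p). }
assert (hr : forall x, h x pt == ap G (gluer x @ (gluer pt)^-1) @ pmap_pt G).
{ intro x; exact (eq_to_id (eq_sym (concat_idp _)) @ pmap_path_pt (q x)). }
assert (k : forall (a b c : Smash X Y) (u : a == c) (v : b == c) (w : G b == pt)
  (z : G a == pt), z == ap G (u @ v^-1) @ w ->
  transport (fun t => G t == pt) u z == (ap G v)^-1 @ w).
{ intros a b c u v; revert a u; path_ind v; intros a u w z e.
  refine (transport_path_fg G (fun _ => pt) u z @ _).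
  refine (ap (concat _) (ap_const _ _) @ _); rewrite concat_idp.
  refine (ap (concat _) e @ _).
  rewrite inverse_idp, concat_idp, ap_idp, inverse_idp.
  exact (inverse_cancel_l _ _ @ (idp_concat _)^-1). }
pose (r := Smash_ind (fun z => G z == pt) _
  (fun xy => match xy with (x, y) => h x y end)
  ((ap G (gluel pt))^-1 @ pmap_pt G) ((ap G (gluer pt))^-1 @ pmap_pt G)
  (fun y => k _ _ _ _ _ _ _ (hl y)) (fun x => k _ _ _ _ _ _ _ (hr x))).
refine (path_pmap (f := G) (g := pconst _ _) r _).
cbn; rewrite concat_idp; unfold r at 1.
refine (eq_to_id (Smash_ind_sm _ _ _ _ _ _ _ (pt, pt)) @ _).
refine (hl pt @ ap (fun q => ap G q @ pmap_pt G) (inverse_r _) @ _).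
rewrite ap_idp; exact (idp_concat _).
Qed.

End Curried.
End Curry.

End SmashMaps.
(** * Families of types over pushouts *)

Section Families.
Context {TT : TypeTheory} {HT : HoTT}.

Section PushoutRec.
Context {A B C : Type} {sA : Small A} {sB : Small B} {sC : Small C}
  (f : C -> A) (g : C -> B) {K : Type} {fK : Fib K} (dl : A -> K) (dr : B -> K)
  (dg : forall c, dl (f c) == dr (g c)).

Definition pushout_rec : Pushout f g -> K :=
  Pushout_ind (fun _ => K) (fun _ => fK) dl dr
    (fun c => transport_const _ _ @ dg c).

Definition pushout_rec_l (a : A) : pushout_rec (pushl f g a) = dl a :=
  Pushout_ind_pushl (fun _ => K) (fun _ => fK) dl dr
    (fun c => transport_const _ _ @ dg c) a.

Definition pushout_rec_r (b : B) : pushout_rec (pushr f g b) = dr b :=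
  Pushout_ind_pushr (fun _ => K) (fun _ => fK) dl dr
    (fun c => transport_const _ _ @ dg c) b.

Lemma pushout_rec_glue (c : C) : ap pushout_rec (glue f g c) ==
  eq_to_id (pushout_rec_l (f c)) @ dg c @ (eq_to_id (pushout_rec_r (g c)))^-1.
Proof.
apply ap_from_apd.
exact (Pushout_ind_glue (fun _ => K) (fun _ => fK) dl dr
    (fun c => transport_const _ _ @ dg c) c).
Qed.

End PushoutRec.

(** [El (code A)] is strictly equal to [A] but not convertible to it; [uncode]
    and [encode] are the casts. *)
Definition type_of {k : trunc_index} (A : Type) {sA : Small A}
  (hA : IsTrunc k A) : TypeOf k :=
  existT (fun u => IsTrunc k (El u)) (code A)
    (match eq_sym (El_code A) in _ = B return IsTrunc k B
     with eq_refl => hA end).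

Definition decode {k : trunc_index} (t : TypeOf k) : Type := El (projT1 t).

#[export] Instance small_decode {k : trunc_index} (t : TypeOf k) :
  Small (decode t).
Proof. unfold decode; exact _. Qed.

Definition uncode {k : trunc_index} {A : Type} {sA : Small A}
  {hA : IsTrunc k A} : decode (type_of A hA) -> A := cast (El_code A).

Definition encode {k : trunc_index} {A : Type} {sA : Small A}
  {hA : IsTrunc k A} : A -> decode (type_of A hA) := castV (El_code A).

Lemma castV_cast {A B : Type} (e : A = B) (a : A) : castV e (cast e a) = a.
Proof. destruct e; reflexivity. Qed.

Lemma ua_cast {u v : U} {A B : Type} {fA : Fib A} {fB : Fib B} (eu : El u = A)
  (ev : El v = B) (f : A -> B) (hf : IsEquiv f) :
  {p : u == v & forall x, cast ev (transport El p x) == f (cast eu x)}.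
Proof.
destruct eu, ev; exists (ua (existT _ f hf)); intro x.
exact (transport_ua (existT _ f hf) x).
Qed.

Lemma type_path_exists {k : trunc_index} {A B : Type} {sA : Small A}
  {sB : Small B} (hA : IsTrunc k A) (hB : IsTrunc k B) (f : A -> B)
  (hf : IsEquiv f) : {p : type_of A hA == type_of B hB &
  forall x, uncode (transport decode p x) == f (uncode x)}.
Proof.
destruct (ua_cast (El_code A) (El_code B) f hf) as [p hp].
destruct (path_sigma_over (u := type_of A hA) (v := type_of B hB)
  (fun u => IsTrunc k (El u)) p (prop_path (prop_istrunc k) _ _)) as [e he].
exists e; intro x; refine (_ @ hp x).
refine (ap (cast (El_code B)) _).
refine (transport_compose (fun t : TypeOf k => projT1 t) El e x @ _).
exact (ap (fun q => transport El q x) he).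
Qed.

Lemma equiv_path {A B : Type} {fA : Fib A} {fB : Fib B} (hA : IsSet A)
  (hB : IsSet B) (e e' : Equiv A B) :
  (forall a, projT1 e a == projT1 e' a) -> e == e'.
Proof.
intro h; refine (path_sig _ _ (path_pi h)).
intros f [[g hg] [k hk]] [[g' hg'] [k' hk']].
assert (eg : forall b, g b == g' b).
{ intro b; refine (ap g (hk b)^-1 @ hg _ @ (hg' _)^-1 @ ap g' (hk b)). }
assert (ek : forall b, k b == k' b).
{ intro b; refine ((hg _)^-1 @ ap g (hk b @ (hk' b)^-1) @ hg _). }
refine (path_prod _ _).
- refine (path_sig (u := existT _ g hg) (v := existT _ g' hg')
    (fun g => forall a, g (f a) == a) _ (path_pi eg)).
  intros; refine (path_pi (fun a => _)); exact (set_path hA _ _).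
- refine (path_sig (u := existT _ k hk) (v := existT _ k' hk')
    (fun k => forall b, f (k b) == b) _ (path_pi ek)).
  intros; refine (path_pi (fun a => _)); exact (set_path hB _ _).
Qed.

(** Univalence turns paths into equivalences, and for maps of sets being an
    equivalence is a proposition. *)
Lemma type_path_unique {s t : TypeOf 0} (p q : s == t) :
  (forall x, transport decode p x == transport decode q x) -> p == q.
Proof.
intro h.
pose (sec := fun (t : TypeOf 0) (r : s == t) => transport
  (fun t : TypeOf 0 => Equiv (El (projT1 s)) (El (projT1 t))) r
  (equiv_id (El (projT1 s)))).
pose (R := fun (t : TypeOf 0) (e : Equiv (El (projT1 s)) (El (projT1 t))) =>
  path_sig (u := s) (v := t) (fun u => IsTrunc 0 (El u))
    (fun u => prop_path (prop_istrunc 0)) (ua e)).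
assert (r : forall t (r : s == t), (R s (equiv_id _))^-1 @ R t (sec t r) == r).
{ clear; intros t r; unfold sec; path_ind r; strict; exact (inverse_l _). }
refine ((r t p)^-1 @ ap (fun e => (R s (equiv_id _))^-1 @ R t e) _ @ r t q).
refine (equiv_path (projT2 s) (projT2 t) _ _ _).
assert (k : forall t (r : s == t) x,
  projT1 (sec t r) x == transport decode r x).
{ clear; intros t r x; unfold sec; path_ind r; strict; exact (idp _). }
intro x; exact (k t p x @ h x @ (k t q x)^-1).
Qed.

Lemma path_arrow {A : Type} {fA : Fib A} (P Q : A -> Type)
  {fP : forall a, Fib (P a)} {fQ : forall a, Fib (Q a)} {a b : A} (p : a == b)
  (f : P a -> Q a) (g : P b -> Q b) :
  (forall x, transport Q p (f x) == g (transport P p x)) ->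
  transport (fun a => P a -> Q a) p f == g.
Proof.
revert g; path_ind p; intros g h; rewrite transport_idp.
refine (path_pi (fun x => _)).
pose proof (k := h x); rewrite !transport_idp in k; exact k.
Qed.

Lemma isequiv_contr_fibers {A B : Type} {fA : Fib A} {fB : Fib B} (f : A -> B) :
  (forall b, IsContr {a : A & f a == b}) -> IsEquiv f.
Proof.
intro c.
refine (isequiv_adjointify f (fun b => projT1 (projT1 (c b))) _ _).
- intro a; exact (ap (fun u : {a' : A & f a' == f a} => projT1 u)
    (projT2 (c (f a)) (existT (fun a' => f a' == f a) a (idp _)))).
- intro b; exact (projT2 (projT1 (c b))).
Qed.

End Families.

(** * Coherent H-spaces *)

Section HSpaces.
Context {TT : TypeTheory} {HT : HoTT}.

(** The transports of [v] along the various paths to [x] agree, and their common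
    value is the section at [x]. *)
Lemma invariant_section {X : pType} (c : IsConnected 0 X) (V : X -> Type)
  {fV : forall x, Fib (V x)} (hV : forall x, IsSet (V x)) (v : V pt)
  (hv : forall w : loops X, transport V w v == v) : Ext V v.
Proof.
assert (s : forall x, IsContr {u : V x & forall p : pt == x,
  transport V p v == u}).
{ refine (connected_prop c _ (fun x => prop_istrunc minus_two) _).
  exists (existT (fun u => forall p : pt == pt, transport V p v == u) v hv).
  intros [u h]; refine (path_sig _ _ _).
  - intros w k k'; refine (path_pi (fun p => _)); exact (set_path (hV _) _ _).
  - cbn; refine (_ @ h (idp _)); strict; exact (idp _). }
exists (fun x => projT1 (projT1 (s x))).
refine ((projT2 (projT1 (s pt)) (idp _))^-1 @ _); strict; exact (idp _).
Qed.

(** Each [x] gives a self-map of [A] taking the basepoint to [x], and at the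
    basepoint this is the identity, compatibly with the basepoint: a
    multiplication with two-sided unit whose two unit laws agree there. *)
Definition HSpace (A : pType) : Type :=
  Ext (X := A) (fun x => Ext (X := A) (fun _ => A) x)
    (existT (fun s : A -> A => s pt == pt) (fun a => a) (idp pt)).

Lemma transport_Ext_end {A : pType} {x y : A} (p : x == y)
  (u : Ext (X := A) (fun _ => A) x) :
  transport (fun x => Ext (X := A) (fun _ => A) x) p u ==
  existT _ (projT1 u) (projT2 u @ p).
Proof. path_ind p; strict; destruct u; exact (idp _). Qed.

(** In dimension one the identity map is fixed by the loops because each loop,
    being central, extends to a homotopy of the identity. *)
Lemma HSpace_abelian {A : pType} (c : IsConnected 0 A) (hA : IsTrunc 1 A)
  (comm : forall p q : loops A, (p @ q : loops A) == q @ p) : HSpace A.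
Proof.
refine (invariant_section c _ _ _ _).
- intro x; exact (istrunc_Ext (nat_connected_path c) 2 (fun _ => A)
    (fun _ => hA) x).
- intro w.
  destruct (invariant_section c (fun x => x == x) (fun x => hA x x) w)
    as [h hw].
  { intro q; refine (transport_path_fg (fun x => x) (fun x => x) q w @ _).
    refine (ap (concat _) (ap_id q) @ _).
    refine (ap (fun r => r^-1 @ w @ q) (ap_id q) @ _).
    refine (concat_assoc _ _ _ @ (move_r_l (comm q w))^-1). }
  refine (transport_Ext_end w _ @ _).
  refine (path_Ext (P := fun _ => A) (u := existT _ (fun a => a) (idp pt @ w))
    (v := existT _ (fun a => a) (idp pt)) h _); cbn.
  rewrite concat_idp; exact (hw @ (idp_concat w)^-1).
Qed.

(** In higher dimensions it exists because the map-valued extensions in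
    question form sets, over a simply connected type. *)
Lemma HSpace_connected {i : nat} {A : pType} (c : IsConnected (S i) A)
  (hA : IsTrunc (S (S i)) A) : HSpace A.
Proof.
pose proof (cA := nat_connected_path c).
refine (connected_ext cA _ (fun x => _) _).
assert (h : IsTrunc (tadd 2 minus_two) (Ext (X := A) (fun _ => A) x)).
{ refine (istrunc_Ext cA 2 (fun _ => A) (fun _ => _) x).
  rewrite nat_to_trunc_tadd in hA; exact hA. }
pose proof (k := istrunc_tadd i h); rewrite tadd_tadd in k.
rewrite <- plus_n_Sm, <- plus_n_Sm, <- plus_n_O in k; exact k.
Qed.

Section Multiplication.
Context {i : nat} {A : pType} (c : IsConnected i A) (h : HSpace A).

Definition hmul (x y : A) : A := projT1 (projT1 h x) y.
Definition hmul_unit_r (x : A) : hmul x pt == x := projT2 (projT1 h x).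
Definition hmul_unit_l (y : A) : hmul pt y == y :=
  ap (fun u : Ext (X := A) (fun _ => A) pt => projT1 u y) (projT2 h).

(** Translation by the basepoint is the identity, and being an equivalence is a
    proposition when it is expressed by contractible fibres. *)
Lemma isequiv_hmul (x : A) : IsEquiv (hmul x).
Proof.
apply isequiv_contr_fibers; revert x.
refine (connected_prop c _ (fun x => istrunc_pi (fun b =>
  prop_istrunc minus_two)) _).
intro b; unfold hmul.
refine (transport (fun u : Ext (X := A) (fun _ => A) pt =>
  IsContr {a : A & projT1 u a == b}) (projT2 h)^-1 _).
exact (contr_path_to b).
Qed.

End Multiplication.
End HSpaces.

(** * Delooping an H-space *)

Section Suspension.
Context {TT : TypeTheory} {HT : HoTT}.

Definition Susp (A : Type) {sA : Small A} : pType :=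
  PType (Pushout (fun _ : A => tt) (fun _ : A => tt)) (pushl _ _ tt).

Section Susp.
Context {A : Type} {sA : Small A}.

Definition south : Susp A := pushr _ _ tt.

Definition mer (a : A) : @pt _ (Susp A) == south :=
  glue (fun _ : A => tt) (fun _ => tt) a.

Definition Susp_ind (P : Susp A -> Type) {fP : forall x, Fib (P x)} (n : P pt)
  (s : P south) (m : forall a, transport P (mer a) n == s) : forall x, P x.
Proof.
refine (Pushout_ind P _ (fun u => match u with tt => n end)
  (fun u => match u with tt => s end) m).
Defined.

End Susp.

Lemma susp_connected {i : nat} {A : pType} (c : IsConnected i A) (x : Susp A) :
  Tr i (@pt _ (Susp A) == x).
Proof.
revert x; refine (Susp_ind _ (tr _ (idp pt)) (tr _ (mer pt)) _); intro a.
refine (_ @ projT1 (connected_ext (nat_connected_path c)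
  (fun a => tr i (mer a) == tr i (mer pt)) (fun a => _) (idp _)) a).
- refine (transport_natural (fun x (p : @pt _ (Susp A) == x) => tr i p) (mer a)
    (idp pt) @ _).
  exact (ap (tr i) (idp_concat (mer a))).
- pose proof (h := istrunc_Tr i (@pt _ (Susp A) == south) _).
  rewrite nat_to_trunc_tadd in *; exact (h _ _).
Qed.

(** For [p] itself there are two proofs of the cancellation law, and
    [bmer_mul] needs them to agree. *)
Lemma cancel_inverse_coherent {A : Type} {fA : Fib A} {x y : A} (p : x == y) :
  {k : forall q : x == y, p @ p^-1 @ q == q &
   k p == concat_cancel_inverse_r p p}.
Proof.
path_ind p.
exists (fun q => J x (fun y (q : x == y) => idp x @ (idp x)^-1 @ q == q)
  (concat_cancel_inverse_r (idp x) (idp x)) _ q).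
rewrite J_idp; exact (idp _).
Qed.

Lemma transport_code {k : trunc_index} {B : Type} {fB : Fib B}
  (f : B -> TypeOf k) {a b : B} (p : a == b) {s t : TypeOf k} (e0 : f a = s)
  (e1 : f b = t) (g : s == t) :
  ap f p == eq_to_id e0 @ g @ (eq_to_id e1)^-1 ->
  forall x, cast (f_equal decode e1) (transport (fun b => decode (f b)) p x) ==
            transport decode g (cast (f_equal decode e0) x).
Proof.
destruct e0, e1; cbn; intros h x.
refine (transport_compose f decode p x @ ap (fun q => transport decode q x) _).
refine (h @ _); strict; exact (idp_concat g).
Qed.

Lemma eq_to_id_trans {A : Type} {fA : Fib A} {a b c : A} (e : a = b)
  (e' : b = c) : eq_to_id (eq_trans e e') = eq_to_id e @ eq_to_id e'.
Proof. destruct e, e'; cbn; strict; reflexivity. Qed.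

Lemma conjugate_twice {A : Type} {fA : Fib A} {x0 x1 y0 y1 z0 z1 : A}
  {X : x0 == x1} (s : x1 == y1) (t : x0 == y0) {Y : y0 == y1} {g : z0 == z1}
  (u : y1 == z1) (v : y0 == z0) :
  X @ s == t @ Y -> Y == v @ g @ u^-1 -> X == (t @ v) @ g @ (s @ u)^-1.
Proof.
revert X Y g; path_ind u; path_ind s; revert v; path_ind t; intro v; path_ind v.
intros X Y g; strict; intros h k.
refine (h @ idp_concat Y @ k).
Qed.

Section Deloop.
Context {i : nat} {A : pType} (c : IsConnected i A) (hA : IsTrunc (S i) A)
  (h : HSpace A).

(** [BA] deloops [A]: over it there is a family [Code] with fibre [A], on which
    [bmer a] acts as multiplication by [a], and [BA_path] is inverse to the
    transport of the unit in this family. *)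
Definition BA : pType := PType (Tr (S (S i)) (Susp A)) (tr _ pt).

Lemma istrunc_BA : IsTrunc (S (S i)) BA.
Proof. exact (istrunc_Tr _ _ _). Qed.

Definition BA_south : BA := tr _ south.
Definition bmer (a : A) : @pt _ BA == BA_south := 
  ap (fun x => tr _ x : BA) (mer a).

Lemma BA_connected : IsConnected (S i) BA.
Proof.
refine (connected_by_path (X := BA) _).
refine (Tr_ind _ _ (fun z => istrunc_succ (istrunc_succ (istrunc_Tr _ _ _))) _).
intro x; refine (Tr_rec (istrunc_Tr i (@pt _ BA == tr _ x) _) _
  (susp_connected c x)).
intro p; exact (tr i (ap (fun x => tr _ x : BA) p)).
Qed.

Definition bloop (a : A) : loops BA := bmer a @ (bmer pt)^-1.

(** Both sides agree when [a] or [b] is the basepoint, compatibly, and the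
    difference in between is ruled out by connectedness. *)
Lemma bmer_mul (a b : A) : bloop b @ bmer a == bmer (hmul h a b).
Proof.
destruct (cancel_inverse_coherent (bmer pt)) as [k hk].
pose (W := fun (a : A) (u : Ext (X := A) (fun _ => A) a) =>
  Ext (X := A) (fun b => bloop b @ bmer a == bmer (projT1 u b))
    (k (bmer a) @ ap bmer (projT2 u)^-1)).
assert (fW : forall a u, Fib (W a u)) by (intros; unfold W; exact _).
assert (hW : forall a u, IsTrunc (trunc_S minus_two) (W a u)).
{ intros a' u; refine (istrunc_Ext (nat_connected_path c) 1 _ (fun b' => _) _).
  pose proof (t := istrunc_BA _ _ (bloop b' @ bmer a') (bmer (projT1 u b'))).
  rewrite nat_to_trunc_tadd in t; exact t. }
refine (projT1 (connected_prop c (fun a => W a (projT1 h a))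
  (fun a => hW a _) _ a) b).
refine (transport (W pt) (projT2 h)^-1 _).
exists (fun b => concat_cancel_inverse_r (bmer b) (bmer pt)); cbn.
refine (hk^-1 @ _); rewrite inverse_idp, ap_idp, concat_idp; exact (idp _).
Qed.

Definition hpath (a : A) : {p : type_of A hA == type_of A hA &
  forall x, uncode (transport decode p x) == hmul h a (uncode x)} :=
  type_path_exists hA hA (hmul h a) (isequiv_hmul c h a).

Definition susp_code : Susp A -> TypeOf (S i) :=
  pushout_rec (fun _ : A => tt) (fun _ => tt) (fun _ => type_of A hA)
    (fun _ => type_of A hA) (fun a => projT1 (hpath a)).

Definition BA_code : BA -> TypeOf (S i) :=
  Tr_rec (istrunc_TypeOf (S i)) susp_code.

Definition code_pt : BA_code pt = type_of A hA :=
  eq_trans (Tr_rec_tr _ _ _) (pushout_rec_l _ _ _ _ _ tt).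
Definition code_south : BA_code BA_south = type_of A hA :=
  eq_trans (Tr_rec_tr _ _ _) (pushout_rec_r _ _ _ _ _ tt).

Definition Code (z : BA) : Type := decode (BA_code z).
#[local] Instance small_Code (z : BA) : Small (Code z).
Proof. unfold Code; exact _. Qed.

Definition un_pt (x : Code pt) : A := uncode (cast (f_equal decode code_pt) x).
Definition in_pt (a : A) : Code pt :=
  castV (f_equal decode code_pt) (encode a).
Definition un_south (x : Code BA_south) : A :=
  uncode (cast (f_equal decode code_south) x).

Lemma un_in_pt (a : A) : un_pt (in_pt a) = a.
Proof. unfold un_pt, in_pt, uncode, encode; now rewrite !cast_castV. Qed.

Lemma transport_code_mer (a : A) (x : Code pt) :
  un_south (transport Code (bmer a) x) == hmul h a (un_pt x).
Proof.
refine (_ @ projT2 (hpath a) (cast (f_equal decode code_pt) x)).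
refine (ap uncode (transport_code BA_code (bmer a) code_pt code_south _ _ x)).
refine ((ap_compose (fun x => tr _ x : BA) BA_code (mer a))^-1 @ _).
unfold code_pt, code_south; rewrite !eq_to_id_trans.
refine (conjugate_twice _ _ _ _ (homotopy_natural (g := susp_code)
  (fun x : Susp A => eq_to_id (Tr_rec_tr (istrunc_TypeOf (S i)) susp_code x))
  (mer a)) _).
exact (pushout_rec_glue _ _ _ _ _ a).
Qed.

Definition BA_path (z : BA) : Code z -> @pt _ BA == z.
Proof.
revert z; refine (Tr_ind (fun z => Code z -> @pt _ BA == z) _
  (fun z => istrunc_pi (fun _ => istrunc_path istrunc_BA _ _)) _).
refine (Susp_ind (fun s => Code (tr _ s) -> @pt _ BA == tr _ s)
  (fun x => bloop (un_pt x)) (fun x => bmer (un_south x)) _).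
intro a; refine (path_arrow (fun s : Susp A => Code (tr _ s)) _ _ _ _ _).
intro x.
refine (transport_compose (fun s : Susp A => tr _ s : BA) (fun z => @pt _ BA == z)
  (mer a) _ @ _).
refine (bmer_mul a (un_pt x) @ ap bmer _).
refine ((transport_code_mer a x)^-1 @ ap un_south _).
exact (transport_compose (fun s : Susp A => tr _ s : BA) Code (mer a) x)^-1.
Defined.

Lemma BA_path_pt (x : Code pt) : BA_path pt x = bloop (un_pt x).
Proof.
unfold BA_path, Susp_ind.
change (@pt _ BA) with (@tr _ _ (S (S i)) (Susp A) _ pt).
rewrite Tr_ind_tr; exact (f_equal (fun f => f x) (Pushout_ind_pushl _ _ _ _ _ tt)).
Qed.

Definition BA_encode : pMap (loops BA) A.
Proof.
exists (fun p : loops BA => un_pt (transport Code p (in_pt pt))).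
refine (eq_to_id _); cbn; rewrite transport_idp; exact (un_in_pt pt).
Defined.

Lemma isequiv_BA_encode : IsEquiv BA_encode.
Proof.
refine (isequiv_adjointify _ bloop _ _).
- assert (k : forall (z : BA) (p : pt == z),
    BA_path z (transport Code p (in_pt pt)) == p).
  { intros z p; path_ind p; rewrite transport_idp, BA_path_pt, un_in_pt.
    exact (inverse_r (bmer pt)). }
  intro p; refine (_ @ k pt p).
  exact (eq_to_id (eq_sym (BA_path_pt _))).
- assert (un_path : forall x : Code pt, in_pt (un_pt x) = x).
  { intro x; unfold in_pt, un_pt, encode, uncode; now rewrite !castV_cast. }
  assert (inj : forall x y : Code BA_south, un_south x == un_south y -> x == y).
  { intros x y e.
    pose proof (k := ap (fun a => castV (f_equal decode code_south) (encode a)) e).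
    unfold un_south, encode, uncode in k; rewrite !castV_cast in k; exact k. }
  intro a; unfold BA_encode, bloop; cbn.
  refine (ap un_pt (transport_concat Code (bmer a) (bmer pt)^-1 _) @ _).
  refine (ap (fun x => un_pt (transport Code (bmer pt)^-1 x))
    (inj _ (transport Code (bmer pt) (in_pt a)) _) @ _).
  + refine (transport_code_mer a _ @ _ @ (transport_code_mer pt _)^-1).
    rewrite !un_in_pt; exact (hmul_unit_r h a @ (hmul_unit_l h a)^-1).
  + refine (ap un_pt (transport_inverse_l Code (bmer pt) _) @ _).
    exact (eq_to_id (un_in_pt a)).
Qed.

End Deloop.
End Suspension.
(** * Classifying spaces of groups *)

Section Classifying.
Context {TT : TypeTheory} {HT : HoTT} (C : Group).

Definition Join : Type := Pushout (fun u : C * C => fst u) (fun u => snd u).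

(** The Hopf construction on the multiplication of [C]; attaching a cone along
    it makes [mer (c * d)] factor through the cone point. *)
Definition hopf : Join -> Susp C :=
  pushout_rec (fun u : C * C => fst u) (fun u => snd u) (fun _ => @pt _ (Susp C))
    (fun _ => south) (fun u => mer (gop (fst u) (snd u))).

Definition joinl (c : C) : Join :=
  pushl (fun u : C * C => fst u) (fun u => snd u) c.
Definition joinr (c : C) : Join :=
  pushr (fun u : C * C => fst u) (fun u => snd u) c.
Definition joinp (c d : C) : joinl c == joinr d :=
  glue (fun u : C * C => fst u) (fun u => snd u) (c, d).

Definition hopf_l (c : C) : hopf (joinl c) == pt :=
  eq_to_id (pushout_rec_l _ _ _ _ _ c).
Definition hopf_r (d : C) : hopf (joinr d) == south :=
  eq_to_id (pushout_rec_r _ _ _ _ _ d).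

Lemma hopf_p (c d : C) :
  ap hopf (joinp c d) == hopf_l c @ mer (gop c d) @ (hopf_r d)^-1.
Proof. exact (pushout_rec_glue _ _ _ _ _ (c, d)). Qed.

Definition HopfCone : Type := Pushout hopf (fun _ : Join => tt).

Definition BG : pType := PType (Tr 1 HopfCone) (tr 1 (pushl _ _ pt : HopfCone)).

Definition in_cone (s : Susp C) : BG := tr 1 (pushl _ _ s : HopfCone).
Definition apex : BG := tr 1 (pushr _ _ tt : HopfCone).
Definition cone (j : Join) : in_cone (hopf j) == apex :=
  ap (fun p : HopfCone => tr 1 p : BG) (glue hopf (fun _ => tt) j).

(** In [BG] there are thus three points, joined by paths indexed by [C], and
    for all [c] and [d] the triangle formed by [edge (gop c d)], [leg_s d] and
    [leg_n c] is filled.  Up to the choice of [edge (gid C)] the paths [edge c]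
    are loops, and the triangles say that they multiply as the elements of [C]
    do ([edge_mul]). *)
Definition edge (c : C) : in_cone pt == in_cone south := ap in_cone (mer c).
Definition leg_n (c : C) : in_cone pt == apex :=
  (ap in_cone (hopf_l c))^-1 @ cone (joinl c).
Definition leg_s (d : C) : in_cone south == apex :=
  (ap in_cone (hopf_r d))^-1 @ cone (joinr d).

Lemma triangle {A : Type} {fA : Fib A} {a b n s z : A} (l : a == n)
  (m : n == s) (r : b == s) (u : a == z) (v : b == z) :
  l @ m @ r^-1 @ v == u -> m @ (r^-1 @ v) == l^-1 @ u.
Proof.
intro h; apply (concat_cancel_l l).
refine (_ @ h @ (cancel_inverse_l _ _)^-1).
exact ((concat_assoc _ _ _)^-1 @ (concat_assoc _ _ _)^-1).
Qed.

Lemma edge_leg (c d : C) : edge (gop c d) @ leg_s d == leg_n c.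
Proof.
pose proof (n := homotopy_natural (f := fun j => in_cone (hopf j))
  (g := fun _ => apex) cone (joinp c d)).
refine (triangle (ap in_cone (hopf_l c)) (edge (gop c d)) (ap in_cone (hopf_r d))
  (cone (joinl c)) (cone (joinr d)) _).
pose proof (k := ap_const apex (joinp c d)).
refine (_ @ (n @ ap (concat (cone (joinl c))) k)
  @ eq_to_id (concat_idp _)).
refine (ap (fun q => q @ cone (joinr d)) _).
refine (_ @ (ap_compose hopf in_cone (joinp c d))^-1).
refine (_ @ ap (ap in_cone) (hopf_p c d)^-1).
refine (_ @ (ap_concat in_cone _ _)^-1).
refine (_ @ ap (fun q => q @ ap in_cone (hopf_r d)^-1) (ap_concat in_cone _ _)^-1).
exact (ap (concat _) (ap_inverse in_cone _)^-1).
Qed.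

Lemma edge_factor (c d : C) : edge (gop c d) == leg_n c @ (leg_s d)^-1.
Proof. exact (move_l_r (edge_leg c d)). Qed.

Lemma four_paths {A : Type} {fA : Fib A} {a b x : A} (p : a == x)
  (q : b == x) (t : a == x) (r : b == x) :
  (p @ q^-1) @ (t @ q^-1)^-1 @ (t @ r^-1) == p @ r^-1.
Proof.
revert p t r; path_ind q; intros p t r; strict.
refine (concat_assoc p t^-1 (t @ r^-1) @ _).
exact (ap (concat p) (inverse_cancel_l t r^-1)).
Qed.

Lemma edge_mul (x c : C) : edge x @ (edge (gid C))^-1 @ edge c == edge (gop x c).
Proof.
refine (_ @ four_paths (leg_n x) (leg_s (gid C)) (leg_n (gid C)) (leg_s c)
        @ (edge_factor x c)^-1).
refine (ap (fun p => p @ _ @ _) _ @ ap (fun p => _ @ p^-1 @ _) _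
        @ ap (fun p => _ @ p) _).
- exact (ap edge (gop_id_r C x)^-1 @ edge_factor x (gid C)).
- exact (ap edge (gop_id_r C (gid C))^-1 @ edge_factor (gid C) (gid C)).
- exact (ap edge (gop_id_l C c)^-1 @ edge_factor (gid C) c).
Qed.

Lemma edge_leg_n (x c : C) : edge x @ (edge (gid C))^-1 @ leg_n c == leg_n (gop x c).
Proof.
refine (ap (concat _) (_ @ edge_leg c (gid C))^-1 @ _).
{ exact (ap (fun y => edge y @ _) (gop_id_r C c)^-1). }
refine ((concat_assoc _ _ _)^-1 @ ap (fun p => p @ _) (edge_mul x c) @ _).
refine (ap (fun y => edge y @ _) (gop_id_r C _)^-1 @ edge_leg _ _).
Qed.

Lemma gop_cancel_l (x d : C) : gop (gop x (ginv d)) d == x.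
Proof.
exact (gop_assoc C _ _ _ @ ap (gop x) (gop_inv_l C d) @ gop_id_r C x).
Qed.

Lemma gop_cancel_r (x d : C) : gop (gop x d) (ginv d) == x.
Proof.
exact (gop_assoc C _ _ _ @ ap (gop x) (gop_inv_r C d) @ gop_id_r C x).
Qed.

Lemma edge_leg_s (x d : C) : edge x @ leg_s d == leg_n (gop x (ginv d)).
Proof.
exact (ap (fun y => edge y @ _) (gop_cancel_l x d)^-1 @ edge_leg _ _).
Qed.

Lemma istrunc_BG : IsTrunc 1 BG.
Proof. exact (istrunc_Tr 1 HopfCone _). Qed.

Lemma BG_connected : IsConnected 0 BG.
Proof.
pose (hT := fun x : BG => istrunc_Tr (trunc_S minus_two) (pt == x) _).
refine (connected_by_path (X := BG) (k := trunc_S minus_two) _).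
refine (Tr_ind _ _ (fun z => istrunc_succ (istrunc_succ (hT z))) _).
unshelve refine (Pushout_ind _ _ _
  (fun u => match u with tt => tr _ (leg_n (gid C)) end) _).
- refine (Susp_ind _ (tr _ (idp _)) (tr _ (edge (gid C))) _).
  intro a; exact (prop_path (hT _) _ _).
- intro c; exact (prop_path (hT _) _ _).
Qed.

(** The family over [BG] used to compute its loops has fibre [C]; [edge c] and
    [leg_n c] act by translation by [c], and [leg_s d] by the inverse of [d], as
    the triangles require. *)
Definition ctype : TypeOf 0 := type_of C (gset C).

Lemma isequiv_translation (c : C) : IsEquiv (fun x : C => gop x c).
Proof.
exact (isequiv_adjointify _ (fun x => gop x (ginv c))
  (fun x => gop_cancel_r x c) (fun x => gop_cancel_l x c)).
Qed.

Definition translation (c : C) : {p : ctype == ctype &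
  forall x, uncode (transport decode p x) == gop (uncode x) c} :=
  type_path_exists (gset C) (gset C) _ (isequiv_translation c).

Definition tpath (c : C) : ctype == ctype := projT1 (translation c).

Lemma uncode_injective {k : trunc_index} {A : Type} {sA : Small A}
  {hA : IsTrunc k A} (x y : decode (type_of A hA)) :
  uncode x == uncode y -> x == y.
Proof.
intro e; pose proof (h := ap (encode (hA := hA)) e); unfold encode, uncode in h.
rewrite !castV_cast in h; exact h.
Qed.

Lemma tpath_op (c d : C) : tpath (gop c d) @ tpath (ginv d) == tpath c.
Proof.
apply type_path_unique; intro x; apply uncode_injective.
refine (ap uncode (transport_concat decode _ _ x) @ _).
refine (projT2 (translation (ginv d)) _ @ _).
refine (ap (fun y => gop y (ginv d)) (projT2 (translation (gop c d)) x) @ _).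
refine (ap (fun y => gop y (ginv d)) (gop_assoc C _ _ _)^-1 @ _).
exact (gop_cancel_r _ d @ (projT2 (translation c) x)^-1).
Qed.

Definition code_susp : Susp C -> TypeOf 0 :=
  pushout_rec (fun _ : C => tt) (fun _ => tt) (fun _ => ctype) (fun _ => ctype)
    tpath.
Definition code_n : code_susp pt = ctype := pushout_rec_l _ _ _ _ _ tt.
Definition code_s : code_susp south = ctype := pushout_rec_r _ _ _ _ _ tt.

Lemma code_susp_mer (c : C) : ap code_susp (mer c) ==
  eq_to_id code_n @ tpath c @ (eq_to_id code_s)^-1.
Proof. exact (pushout_rec_glue _ _ _ _ _ c). Qed.

Lemma cone_algebra {A : Type} {fA : Fib A} {a b n s z y h : A} (l : a == n)
  (r : b == s) {X : a == b} {m : n == s} (en : n == z) (es : s == y) {g : z == y}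
  {k : z == h} (k' : y == h) :
  X == l @ m @ r^-1 -> m == en @ g @ es^-1 -> g @ k' == k ->
  X^-1 @ (l @ en @ k) == r @ es @ k'.
Proof.
intros hX hm hk; path_ind hk.
refine (ap (fun X => X^-1 @ _) (hX @ ap (fun m => l @ m @ r^-1) hm) @ _).
clear hX hm X m.
path_ind k'; revert es; path_ind g; intro es.
revert en es; path_ind r; revert l; intros l en; revert l; path_ind en.
intros l es; revert l; path_ind es; intro l.
strict; exact (inverse_l l).
Qed.

Definition code_cone (j : Join) : code_susp (hopf j) == ctype.
Proof.
revert j; refine (Pushout_ind (fun j => code_susp (hopf j) == ctype) _
  (fun c => ap code_susp (hopf_l c) @ eq_to_id code_n @ tpath c)
  (fun d => ap code_susp (hopf_r d) @ eq_to_id code_s @ tpath (ginv d)) _).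
intros [c d].
refine (transport_path_fg (fun j => code_susp (hopf j)) (fun _ => ctype)
  (joinp c d) _ @ _).
pose proof (k := ap_const ctype (joinp c d)).
refine (ap (concat _) k @ _); rewrite concat_idp.
refine (cone_algebra _ _ _ _ _ _ (code_susp_mer (gop c d)) (tpath_op c d)).
refine (ap_compose hopf code_susp (joinp c d) @ _).
refine (ap (ap code_susp) (hopf_p c d) @ _).
refine (ap_concat code_susp _ _ @ _).
refine (ap (fun q => q @ _) (ap_concat code_susp _ _) @ _).
exact (ap (concat _) (ap_inverse code_susp _)).
Defined.

Lemma code_cone_l (c : C) : code_cone (joinl c) =
  ap code_susp (hopf_l c) @ eq_to_id code_n @ tpath c.
Proof. exact (Pushout_ind_pushl _ _ _ _ _ c). Qed.

Lemma code_cone_r (d : C) : code_cone (joinr d) =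
  ap code_susp (hopf_r d) @ eq_to_id code_s @ tpath (ginv d).
Proof. exact (Pushout_ind_pushr _ _ _ _ _ d). Qed.

Definition code_hopf : HopfCone -> TypeOf 0 :=
  pushout_rec hopf (fun _ => tt) code_susp (fun _ => ctype) code_cone.

Definition BG_code : BG -> TypeOf 0 := Tr_rec (istrunc_TypeOf 0) code_hopf.

Definition BG_code_at (s : Susp C) : BG_code (in_cone s) = code_susp s :=
  eq_trans (Tr_rec_tr _ _ _) (pushout_rec_l _ _ _ _ _ s).
Definition BG_code_apex : BG_code apex = ctype :=
  eq_trans (Tr_rec_tr _ _ _) (pushout_rec_r _ _ _ _ _ tt).
Definition BG_code_pt : BG_code pt = ctype := eq_trans (BG_code_at pt) code_n.
Definition BG_code_south : BG_code (in_cone south) = ctype :=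
  eq_trans (BG_code_at south) code_s.

Lemma BG_code_edge (c : C) : ap BG_code (edge c) ==
  eq_to_id BG_code_pt @ tpath c @ (eq_to_id BG_code_south)^-1.
Proof.
refine ((ap_compose in_cone BG_code (mer c))^-1 @ _).
unfold BG_code_pt, BG_code_south; rewrite !eq_to_id_trans.
exact (conjugate_twice _ _ _ _ (homotopy_natural (g := code_susp)
  (fun s => eq_to_id (BG_code_at s)) (mer c)) (code_susp_mer c)).
Qed.

Lemma BG_code_cone (j : Join) : ap BG_code (cone j) ==
  eq_to_id (BG_code_at (hopf j)) @ code_cone j @ (eq_to_id BG_code_apex)^-1.
Proof.
refine ((ap_compose (fun p : HopfCone => tr 1 p : BG) BG_code _)^-1 @ _).
unfold BG_code_at, BG_code_apex; rewrite !eq_to_id_trans.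
refine (conjugate_twice _ _ _ _ (homotopy_natural (g := code_hopf)
  (fun p : HopfCone => eq_to_id (Tr_rec_tr (istrunc_TypeOf 0) code_hopf p))
  (glue hopf (fun _ => tt) j)) _).
exact (pushout_rec_glue _ _ _ _ _ j).
Qed.

Lemma leg_algebra {A : Type} {fA : Fib A} {a n a' n' z y w : A} {X : a == n}
  (kn : n == n') (kh : a == a') {Y : a' == n'} (e : n' == z) (g : z == y)
  (kb : w == y) {Z : a == w} :
  X @ kn == kh @ Y -> Z == kh @ (Y @ e @ g) @ kb^-1 ->
  X^-1 @ Z == (kn @ e) @ g @ kb^-1.
Proof.
intros h1 h2.
refine (ap (fun X => X^-1 @ Z) (move_l_r h1) @ _).
refine (ap (concat _) h2 @ _); clear h1 h2 X Z.
revert Y e g kb; path_ind kn; path_ind kh; intros Y e g kb.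
revert kb; path_ind g; revert e; intros e kb.
revert Y e; path_ind kb; intros Y e.
revert Y; path_ind e; intro Y; strict.
refine (ap (concat _) (idp_concat Y) @ _).
refine (ap (fun q => q^-1 @ Y) (idp_concat Y) @ inverse_l Y).
Qed.

Lemma BG_code_leg {s : Susp C} (j : Join) (e : hopf j == s)
  (k : code_susp s = ctype) (p : ctype == ctype)
  (hj : code_cone j = ap code_susp e @ eq_to_id k @ p) :
  ap BG_code ((ap in_cone e)^-1 @ cone j) ==
  eq_to_id (eq_trans (BG_code_at s) k) @ p @ (eq_to_id BG_code_apex)^-1.
Proof.
rewrite eq_to_id_trans.
refine (ap_concat BG_code _ _ @ _).
refine (ap (fun q => q @ _) (ap_inverse BG_code _) @ _).
refine (leg_algebra _ (eq_to_id (BG_code_at (hopf j))) _ _ _ _ _).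
- refine (ap (fun q => q @ _) (ap_compose in_cone BG_code e)^-1 @ _).
  exact (homotopy_natural (g := code_susp)
    (fun s => eq_to_id (BG_code_at s)) e).
- rewrite <- hj; exact (BG_code_cone j).
Qed.

Definition BCode (z : BG) : Type := decode (BG_code z).
#[local] Instance small_BCode (z : BG) : Small (BCode z).
Proof. unfold BCode; exact _. Qed.

Definition un_code {z : BG} (e : BG_code z = ctype) (x : BCode z) : C :=
  uncode (cast (f_equal decode e) x).
Definition in_code {z : BG} (e : BG_code z = ctype) (x : C) : BCode z :=
  castV (f_equal decode e) (encode x).

Lemma un_in_code {z : BG} (e : BG_code z = ctype) (x : C) :
  un_code e (in_code e x) = x.
Proof. unfold un_code, in_code, uncode, encode; now rewrite !cast_castV. Qed.

Lemma un_code_injective {z : BG} (e : BG_code z = ctype) (x y : BCode z) :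
  un_code e x == un_code e y -> x == y.
Proof.
intro h; pose proof (k := ap (in_code e) h).
unfold un_code, in_code, uncode, encode in k; rewrite !castV_cast in k; exact k.
Qed.

Lemma transport_BCode {y z : BG} (p : y == z) (e : BG_code y = ctype)
  (e' : BG_code z = ctype) (c : C) :
  ap BG_code p == eq_to_id e @ tpath c @ (eq_to_id e')^-1 ->
  forall x, un_code e' (transport BCode p x) == gop (un_code e x) c.
Proof.
intros h x; refine (_ @ projT2 (translation c) (cast (f_equal decode e) x)).
exact (ap uncode (transport_code BG_code p e e' _ h x)).
Qed.

Lemma transport_edge (c : C) (x : BCode pt) :
  un_code BG_code_south (transport BCode (edge c) x) ==
  gop (un_code BG_code_pt x) c.
Proof. exact (transport_BCode _ _ _ _ (BG_code_edge c) x). Qed.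

Lemma transport_leg_n (c : C) (x : BCode pt) :
  un_code BG_code_apex (transport BCode (leg_n c) x) ==
  gop (un_code BG_code_pt x) c.
Proof.
exact (transport_BCode _ _ _ _ (BG_code_leg (joinl c) (hopf_l c) code_n _
  (code_cone_l c)) x).
Qed.

Lemma transport_leg_s (d : C) (x : BCode (in_cone south)) :
  un_code BG_code_apex (transport BCode (leg_s d) x) ==
  gop (un_code BG_code_south x) (ginv d).
Proof.
exact (transport_BCode _ _ _ _ (BG_code_leg (joinr d) (hopf_r d) code_s _
  (code_cone_r d)) x).
Qed.

Definition bloop_of (x : C) : loops BG := edge x @ (edge (gid C))^-1.

Let F (z : BG) : Type := BCode z -> @pt _ BG == z.

Let F_path {y z : BG} (p : y == z) (f : F y) (g : F z) :
  (forall x, f x @ p == g (transport BCode p x)) -> transport F p f == g.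
Proof. exact (path_arrow BCode (fun z => @pt _ BG == z) p f g). Qed.

Definition BG_path_susp (s : Susp C) : F (in_cone s).
Proof.
revert s; refine (Susp_ind (fun s => F (in_cone s))
  (fun x => bloop_of (un_code BG_code_pt x))
  (fun x => edge (un_code BG_code_south x)) _).
intro c; refine (transport_compose in_cone F (mer c) _ @ _).
refine (F_path _ _ _ _); intro x.
exact (edge_mul _ c @ ap edge (transport_edge c x)^-1).
Defined.

Lemma BG_path_susp_pt :
  BG_path_susp pt = fun x => bloop_of (un_code BG_code_pt x).
Proof. exact (Pushout_ind_pushl _ _ _ _ _ tt). Qed.

Lemma BG_path_susp_south :
  BG_path_susp south = fun x => edge (un_code BG_code_south x).
Proof. exact (Pushout_ind_pushr _ _ _ _ _ tt). Qed.

Lemma BG_path_cone {s : Susp C} (j : Join) (e : hopf j == s) (g : F apex) :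
  (forall x, BG_path_susp s x @ ((ap in_cone e)^-1 @ cone j) ==
             g (transport BCode ((ap in_cone e)^-1 @ cone j) x)) ->
  transport F (cone j) (BG_path_susp (hopf j)) == g.
Proof.
path_ind e; intro h; refine (F_path _ _ _ _); intro x.
pose proof (k := h x).
rewrite ap_idp, inverse_idp in k.
refine (ap (concat _) (idp_concat (cone j))^-1 @ k @ _).
exact (ap (fun p => g (transport BCode p x)) (idp_concat (cone j))).
Qed.

Lemma istrunc_F (z : BG) : IsTrunc 0 (F z).
Proof.
exact (istrunc_pi (k := 0) (P := fun _ => @pt _ BG == z)
  (fun _ => istrunc_BG pt z)).
Qed.

(** The fibres are sets, so that over the cone only the two ends of the join
    have to be checked. *)
Definition BG_path (z : BG) : F z.
Proof.
revert z; refine (Tr_ind F _ (fun z => istrunc_succ (istrunc_F z)) _).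
refine (Pushout_ind (fun p : HopfCone => F (tr 1 p)) _ BG_path_susp
  (fun u => match u with tt => fun x => leg_n (un_code BG_code_apex x) end) _).
intro j.
refine (transport_compose (fun p : HopfCone => tr 1 p : BG) F _ _ @ _).
revert j.
refine (Pushout_ind (fun j => transport F (cone j) (BG_path_susp (hopf j)) ==
  fun x => leg_n (un_code BG_code_apex x)) _ _ _
  (fun u => set_path (istrunc_F _) _ _)).
- intro c; refine (BG_path_cone (joinl c) (hopf_l c) _ _).
  intro x; rewrite BG_path_susp_pt.
  exact (edge_leg_n _ c @ ap leg_n (transport_leg_n c x)^-1).
- intro d; refine (BG_path_cone (joinr d) (hopf_r d) _ _).
  intro x; rewrite BG_path_susp_south.
  exact (edge_leg_s _ d @ ap leg_n (transport_leg_s d x)^-1).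
Defined.

Lemma BG_path_pt (x : BCode pt) : BG_path pt x = bloop_of (un_code BG_code_pt x).
Proof.
unfold BG_path.
change (@pt _ BG) with (@tr _ _ 1 HopfCone _ (pushl hopf (fun _ => tt) pt)).
rewrite Tr_ind_tr, Pushout_ind_pushl.
exact (f_equal (fun f => f x) BG_path_susp_pt).
Qed.

Definition BG_encode (p : loops BG) : C :=
  un_code BG_code_pt (transport BCode p (in_code BG_code_pt (gid C))).

Lemma bloop_of_encode (p : loops BG) : bloop_of (BG_encode p) == p.
Proof.
assert (k : forall (z : BG) (p : pt == z),
  BG_path z (transport BCode p (in_code BG_code_pt (gid C))) == p).
{ intros z q; path_ind q; rewrite transport_idp, BG_path_pt, un_in_code.
  exact (inverse_r _). }
exact (eq_to_id (eq_sym (BG_path_pt _)) @ k pt p).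
Qed.

Lemma encode_bloop_of (x : C) : BG_encode (bloop_of x) == x.
Proof.
unfold BG_encode, bloop_of.
refine (ap (un_code BG_code_pt) (transport_concat BCode (edge x) _ _) @ _).
refine (ap (fun u => un_code BG_code_pt (transport BCode (edge (gid C))^-1 u))
  (un_code_injective BG_code_south _
     (transport BCode (edge (gid C)) (in_code BG_code_pt x)) _) @ _).
- refine (transport_edge _ _ @ _ @ (transport_edge _ _)^-1).
  rewrite !un_in_code; exact (gop_id_l C x @ (gop_id_r C x)^-1).
- refine (ap (un_code BG_code_pt) (transport_inverse_l BCode _ _) @ _).
  exact (eq_to_id (un_in_code _ x)).
Qed.

Lemma bloop_of_op (x y : C) :
  bloop_of (gop x y) == (bloop_of x @ bloop_of y : loops BG).
Proof.
refine (ap (fun p => p @ _) (edge_mul x y)^-1 @ _).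
exact (concat_assoc (bloop_of x) (edge y) _).
Qed.

(** [BG_encode] is inverse to a multiplicative map. *)
Lemma BG_encode_op (p q : loops BG) :
  BG_encode (p @ q : loops BG) == gop (BG_encode p) (BG_encode q).
Proof.
refine (_ @ encode_bloop_of _); refine (ap BG_encode _).
refine (_ @ (bloop_of_op _ _)^-1).
exact (ap (fun r => r @ q) (bloop_of_encode p)^-1
       @ ap (concat _) (bloop_of_encode q)^-1).
Qed.

End Classifying.
(** * Eilenberg-MacLane spaces *)

Section EilenbergMacLane.
Context {TT : TypeTheory} {HT : HoTT}.

(** The strict identity of [iloops m (iloops n X)] and [iloops (m + n) X],
    together with its compatibility with maps, is one equation of functors. *)
Record PFunctor := {
  pf_obj : pType -> pType;
  pf_map : forall X Y : pType, pMap X Y -> pMap (pf_obj X) (pf_obj Y) }.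

Definition iloopsF (n : nat) : PFunctor :=
  {| pf_obj := iloops n; pf_map := fun X Y f => iloops_map n f |}.

Definition composeF (F G : PFunctor) : PFunctor :=
  {| pf_obj := fun X => pf_obj F (pf_obj G X);
     pf_map := fun X Y f => pf_map F _ _ (pf_map G _ _ f) |}.

Lemma iloopsF_add (m n : nat) :
  composeF (iloopsF m) (iloopsF n) = iloopsF (m + n).
Proof.
induction m as [|m IH]; [reflexivity|].
exact (f_equal (composeF (iloopsF 1)) IH).
Qed.

Definition castF {F G : PFunctor} (e : F = G) (X : pType) :
  pMap (pf_obj F X) (pf_obj G X) :=
  match e in _ = G return pMap (pf_obj F X) (pf_obj G X) with
  | eq_refl => pid _
  end.

Lemma isequiv_castF {F G : PFunctor} (e : F = G) (X : pType) :
  IsEquiv (castF e X).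
Proof.
destruct e.
exact (isequiv_adjointify _ (fun x => x) (fun x => idp x) (fun x => idp x)).
Qed.

Lemma loops_castF {F G : PFunctor} (e : F = G) {X Y : pType} (f : pMap X Y)
  (p : loops (pf_obj F X)) :
  loops_map (castF e Y) (loops_map (pf_map F _ _ f) p) ==
  loops_map (pf_map G _ _ f) (loops_map (castF e X) p).
Proof.
destruct e; cbn [castF].
exact (loops_map_id _ @ ap (loops_map (pf_map F X Y f)) (loops_map_id p)^-1).
Qed.

(** In terms of [loops (BG C)], a type with these data has [pi (S j)]
    isomorphic to [C]; the multiplication is kept for the next delooping. *)
Definition EMData (C : Group) (j : nat) (A : pType) : Type :=
  (IsConnected j A * IsTrunc (S j) A * HSpace A *
   {E : pMap (iloops j A) (BG C) & IsEquiv E})%type.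

Lemma EM_exists (C : AbGroup) (j : nat) : {A : pType & EMData C j A}.
Proof.
induction j as [|j [A [[[cA hA] h] [E hE]]]].
- exists (BG C); refine (BG_connected C, istrunc_BG C, _, _).
  + refine (HSpace_abelian (BG_connected C) (istrunc_BG C) _); intros p q.
    refine ((bloop_of_encode C _)^-1 @ ap (bloop_of C) _ @ bloop_of_encode C _).
    exact (BG_encode_op C p q @ gop_comm C _ _ @ (BG_encode_op C q p)^-1).
  + exists (pid _).
    exact (isequiv_adjointify _ (fun x => x) (fun x => idp x) (fun x => idp x)).
- exists (BA (i := j) (A := A)).
  refine (BA_connected cA, istrunc_BA,
          HSpace_connected (BA_connected cA) istrunc_BA, _).
  pose (e := iloopsF_add j 1).
  rewrite <- plus_n_Sm, <- plus_n_O in e.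
  exists (pcompose E (pcompose (iloops_map j (BA_encode cA hA h))
    (castF (eq_sym e) (BA (i := j) (A := A))))).
  pose proof (i1 := isequiv_castF (eq_sym e) (BA (i := j) (A := A))).
  pose proof (i2 := isequiv_iloops_map j _ (isequiv_BA_encode cA hA h)).
  exact (isequiv_compose
    (isequiv_compose (B := iloops j (loops (BA (i := j) (A := A)))) i1 i2) hE).
Qed.

Lemma isequiv_loop_group_map {X Y : pType} (f : pMap X Y) :
  IsEquiv (loops_map f) -> IsEquiv (loop_group_map f).
Proof.
intro e.
refine (isequiv_adjointify (loop_group_map f) (Tr0_rec (set_Tr _)
  (fun q => tr 0 (equiv_inv e q))) _ _).
- refine (Tr0_path (set_Tr _) (fun z => Tr0_rec _ _ (loop_group_map f z))
    (fun z => z) _).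
  intro p; rewrite loop_group_map_tr, Tr0_rec_tr.
  exact (ap (tr 0) (equiv_inv_l e p)).
- refine (Tr0_path (set_Tr _) (fun z => loop_group_map f (Tr0_rec _ _ z))
    (fun z => z) _).
  intro q; rewrite Tr0_rec_tr, loop_group_map_tr.
  exact (ap (tr 0) (equiv_inv_r e q)).
Qed.

Definition BG_pi (C : Group) : Hom (loop_group (BG C)) C.
Proof.
exists (Tr0_rec (gset C) (BG_encode C)).
intros x y; revert x; refine (Tr0_path (gset C) (fun x => _) (fun x => _) _).
intro p; revert y.
refine (Tr0_path (gset C) (fun x => _) (fun x => _) _); intro q.
cbn [gop loop_group]; rewrite tr_concat_tr, !Tr0_rec_tr.
exact (BG_encode_op C p q).
Defined.

Lemma isequiv_BG_pi (C : Group) : IsEquiv (BG_pi C).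
Proof.
refine (isequiv_adjointify (BG_pi C) (fun x => tr 0 (bloop_of C x)) _ _).
- refine (Tr0_path (set_Tr _) (fun z => tr 0 (bloop_of C (BG_pi C z)))
    (fun z => z) _).
  intro p; cbn; rewrite Tr0_rec_tr; exact (ap (tr 0) (bloop_of_encode C p)).
- intro x; cbn; rewrite Tr0_rec_tr; exact (encode_bloop_of C x).
Qed.

Definition EM_pi {C : Group} {j : nat} {A : pType} (d : EMData C j A) :
  Hom (pi (S j) A) C := hom_compose (BG_pi C) (loop_group_map (projT1 (snd d))).

Lemma isequiv_EM_pi {C : Group} {j : nat} {A : pType} (d : EMData C j A) :
  IsEquiv (EM_pi d).
Proof.
refine (isequiv_compose _ (isequiv_BG_pi C)).
exact (isequiv_loop_group_map _ (isequiv_loops_map _ (projT2 (snd d)))).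
Qed.

End EilenbergMacLane.

(** * Homomorphisms *)

Section Homs.
Context {TT : TypeTheory} {HT : HoTT}.

Lemma hom_gid {G H : Group} (f : Hom G H) : f (gid G) == gid H.
Proof.
assert (h : gop (f (gid G)) (f (gid G)) == f (gid G)).
{ exact ((hom_op f _ _)^-1 @ ap f (gop_id_l G _)). }
refine ((gop_id_l H _)^-1 @ ap (fun u => gop u _) (gop_inv_l H (f (gid G)))^-1 @ _).
refine (gop_assoc H _ _ _ @ ap (gop _) h @ gop_inv_l H _).
Qed.

Definition hom_inv {G H : Group} (f : Hom G H) (e : IsEquiv f) : Hom H G.
Proof.
exists (equiv_inv e); intros x y; apply (equiv_injective e).
refine (equiv_inv_r e _ @ _ @ (hom_op f _ _)^-1).
exact (ap (fun u => gop u y) (equiv_inv_r e x)^-1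
       @ ap (gop _) (equiv_inv_r e y)^-1).
Defined.

Lemma abz_path {G : Group} (aG : Abelianization G) {A : AbGroup}
  (f g : Hom aG A) :
  (forall x, f (abz_unit aG x) == g (abz_unit aG x)) -> forall z, f z == g z.
Proof.
intros h z.
pose (P := fun k : Hom aG A =>
  hom_compose k (abz_unit aG) == hom_compose f (abz_unit aG)).
pose proof (c := contr_path (abz_initial aG A (hom_compose f (abz_unit aG)))
  (existT P f (idp _)) (existT P g (hom_path
    (f := hom_compose g (abz_unit aG)) (g := hom_compose f (abz_unit aG))
    (fun x => (h x)^-1)))).
exact (ap (fun u : {k : Hom aG A & P k} => projT1 u z) c).
Qed.

Definition abz_lift {G : Group} (aG : Abelianization G) {A : AbGroup}
  (f : Hom G A) : Hom aG A := projT1 (projT1 (abz_initial aG A f)).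

Lemma abz_lift_unit {G : Group} (aG : Abelianization G) {A : AbGroup}
  (f : Hom G A) (x : G) : abz_lift aG f (abz_unit aG x) == f x.
Proof.
exact (ap (fun k : Hom G A => k x) (projT2 (projT1 (abz_initial aG A f)))).
Qed.

Lemma abz_map_unit {G H : Group} (aG : Abelianization G)
  (aH : Abelianization H) (f : Hom G H) (x : G) :
  abz_map aG aH f (abz_unit aG x) == abz_unit aH (f x).
Proof. exact (abz_lift_unit aG (hom_compose (abz_unit aH) f) x). Qed.

Definition hom_eval {B : Group} {T : AbGroup} (b : B) : Hom (HomAb B T) T :=
  existT _ (fun f : HomAb B T => hom_fun (f : Hom B T) b)
    (fun f g => idp _).

Section Bilinear.
Context {G1 G2 : Group} {T : AbGroup} (beta : G1 -> G2 -> T)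
  (hl : forall x x' y, beta (gop x x') y == gop (beta x y) (beta x' y))
  (hr : forall x y y', beta x (gop y y') == gop (beta x y) (beta x y'))
  (a1 : Abelianization G1) (a2 : Abelianization G2).

Definition bilinear_at (x : G1) : Hom a2 T :=
  abz_lift a2 (existT _ (beta x) (hr x)).

Lemma bilinear_at_unit (x : G1) (y : G2) :
  bilinear_at x (abz_unit a2 y) == beta x y.
Proof. exact (abz_lift_unit a2 (existT _ (beta x) (hr x)) y). Qed.

Definition bilinear_hom : Hom G1 (HomAb a2 T).
Proof.
exists (bilinear_at : G1 -> HomAb a2 T).
intros x x'; refine (hom_path (f := bilinear_at (gop x x'))
  (g := hom_add T (bilinear_at x) (bilinear_at x')) _).
refine (abz_path a2 _ _ _); intro y.
refine (bilinear_at_unit _ y @ hl x x' y @ _).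
exact (ap (fun u => gop u _) (bilinear_at_unit x y)^-1
  @ ap (gop _) (bilinear_at_unit x' y)^-1).
Defined.

Definition bilinear : Hom a1 (HomAb a2 T) := abz_lift a1 bilinear_hom.

Lemma bilinear_unit (x : G1) (y : G2) :
  hom_app2 bilinear (abz_unit a1 x) (abz_unit a2 y) == beta x y.
Proof.
refine (_ @ bilinear_at_unit x y).
exact (ap (fun k : Hom a2 T => k (abz_unit a2 y)) 
  (abz_lift_unit a1 bilinear_hom x)).
Qed.

End Bilinear.

Lemma abz_path2 {G1 G2 : Group} (a1 : Abelianization G1)
  (a2 : Abelianization G2) {T : AbGroup} (s t : Hom a1 (HomAb a2 T)) :
  (forall x y, hom_app2 s (abz_unit a1 x) (abz_unit a2 y) ==
               hom_app2 t (abz_unit a1 x) (abz_unit a2 y)) ->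
  forall a b, hom_app2 s a b == hom_app2 t a b.
Proof.
intros h a b; revert a.
refine (abz_path a1 (hom_compose (hom_eval b) s) (hom_compose (hom_eval b) t) _).
intro x; revert b; exact (abz_path a2 (s (abz_unit a1 x) : Hom a2 T)
  (t (abz_unit a1 x) : Hom a2 T) (h x)).
Qed.

Lemma isequiv_bijective {A B : Type} (f : A -> B) :
  (forall x y, f x == f y -> x == y) -> (forall b, {a : A & f a == b}) ->
  IsEquiv f.
Proof.
intros hi hs; refine (isequiv_adjointify f (fun b => projT1 (hs b)) _ _).
- intro a; exact (hi _ _ (projT2 (hs (f a)))).
- intro b; exact (projT2 (hs b)).
Qed.

End Homs.
(** * The pairing on homotopy groups *)

Section GroupPairing.
Context {TT : TypeTheory} {HT : HoTT}.

Lemma iloopsF_shift {n m N : nat} (e : m + S n = S N) :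
  composeF (iloopsF m) (iloopsF (S n)) = iloopsF (S N).
Proof. rewrite iloopsF_add, e; reflexivity. Qed.

Lemma pi_map_tr (j : nat) {X Y : pType} (f : pMap X Y) (a : iloops (S j) X) :
  pi_map (S j) f (tr 0 (a : loops (iloops j X))) =
  tr 0 (iloops_map (S j) f a : loops (iloops j Y)).
Proof. exact (loop_group_map_tr _ a). Qed.

Section Fixed.
Context (n m N : nat) (e : m + S n = S N).

Definition shift (Z : pType) :
  Hom (loop_group (iloops m (iloops (S n) Z))) (abpi (S (S N)) Z) :=
  loop_group_map (castF (iloopsF_shift e) Z).

Lemma isequiv_shift (Z : pType) : IsEquiv (shift Z).
Proof.
exact (isequiv_loop_group_map _ (isequiv_loops_map _
  (isequiv_castF (iloopsF_shift e) Z))).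
Qed.

Lemma shift_natural {Z Z' : pType} (phi : pMap Z Z')
  (p : iloops (S m) (iloops (S n) Z)) :
  abpi_map (S (S N)) phi (shift Z (tr 0 p)) ==
  shift Z' (tr 0 (iloops_map (S m) (iloops_map (S n) phi) p)).
Proof.
refine (ap (abpi_map (S (S N)) phi) (eq_to_id (loop_group_map_tr _ p)) @ _).
refine (eq_to_id (loop_group_map_tr _ _) @ _).
refine (_ @ (eq_to_id (loop_group_map_tr _ _))^-1).
exact (ap (tr 0) (loops_castF (iloopsF_shift e) phi p)^-1).
Qed.

Definition class_pairing {X Y Z : pType} (H : pMap Y (PMap X Z))
  (x : pi (S n) X) (y : pi (S m) Y) : abpi (S (S N)) Z :=
  Tr0_rec (gset _) (fun a : loops (iloops n X) =>
    Tr0_rec (gset _) (fun b : loops (iloops m Y) =>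
      shift Z (tr 0 (pairing (S n) (S m) H a b))) y) x.

Lemma class_pairing_tr {X Y Z : pType} (H : pMap Y (PMap X Z))
  (a : iloops (S n) X) (b : iloops (S m) Y) :
  class_pairing H (tr 0 a) (tr 0 b) =
  shift Z (tr 0 (pairing (S n) (S m) H a b)).
Proof. unfold class_pairing; rewrite !Tr0_rec_tr; reflexivity. Qed.

Lemma pi_ind {X : pType} {B : Type} {fB : Fib B} (hB : IsSet B)
  (f g : loop_group X -> B) :
  (forall p : loops X, f (tr 0 p) == g (tr 0 p)) -> forall x, f x == g x.
Proof. exact (Tr0_path hB f g). Qed.

Lemma shift_concat {Z : pType} (p q : iloops (S m) (iloops (S n) Z)) :
  shift Z (tr 0 (p @ q : loops (iloops m (iloops (S n) Z)))) ==
  gop (shift Z (tr 0 p)) (shift Z (tr 0 q)).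
Proof.
refine (_ @ hom_op (shift Z) (tr 0 p) (tr 0 q)).
exact (ap (shift Z) (eq_to_id (eq_sym (tr_concat_tr _ p q)))).
Qed.

Lemma class_pairing_add_l {X Y Z : pType} (H : pMap Y (PMap X Z))
  (x x' : pi (S n) X) (y : pi (S m) Y) : class_pairing H (gop x x') y ==
  gop (class_pairing H x y) (class_pairing H x' y).
Proof.
revert x; refine (pi_ind (gset _) (fun x => _) (fun x => _) _); intro a.
revert x'; refine (pi_ind (gset _) (fun x => _) (fun x => _) _); intro a'.
revert y; refine (pi_ind (gset _) (fun x => _) (fun x => _) _); intro b.
refine (ap (fun u => class_pairing H u (tr 0 b))
  (eq_to_id (tr_concat_tr _ a a')) @ _).
refine (eq_to_id (class_pairing_tr H (a @ a' : loops (iloops n X)) b) @ _).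
refine (ap (fun p => shift Z (tr 0 p)) (pairing_add_l n m H a a' b) @ _).
refine (shift_concat _ _ @ _).
exact (ap (fun u => gop u _) (eq_to_id (class_pairing_tr H a b))^-1
       @ ap (gop _) (eq_to_id (class_pairing_tr H a' b))^-1).
Qed.

Lemma class_pairing_add_r {X Y Z : pType} (H : pMap Y (PMap X Z))
  (x : pi (S n) X) (y y' : pi (S m) Y) : class_pairing H x (gop y y') ==
  gop (class_pairing H x y) (class_pairing H x y').
Proof.
revert x; refine (pi_ind (gset _) (fun x => _) (fun x => _) _); intro a.
revert y; refine (pi_ind (gset _) (fun x => _) (fun x => _) _); intro b.
revert y'; refine (pi_ind (gset _) (fun x => _) (fun x => _) _); intro b'.
refine (ap (class_pairing H (tr 0 a)) (eq_to_id (tr_concat_tr _ b b')) @ _).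
refine (eq_to_id (class_pairing_tr H a (b @ b' : loops (iloops m Y))) @ _).
refine (ap (fun p => shift Z (tr 0 p)) (pairing_add_r n m H a b b') @ _).
refine (shift_concat _ _ @ _).
exact (ap (fun u => gop u _) (eq_to_id (class_pairing_tr H a b))^-1
       @ ap (gop _) (eq_to_id (class_pairing_tr H a b'))^-1).
Qed.

Lemma class_pairing_natural {X X' Y Y' Z Z' : pType} (f : pMap X X')
  (g : pMap Y Y') (phi : pMap Z Z') (H : pMap Y (PMap X Z))
  (H' : pMap Y' (PMap X' Z'))
  (k : forall y, pcompose phi (H y : pMap X Z) ==
                 pcompose (H' (g y) : pMap X' Z') f)
  (x : pi (S n) X) (y : pi (S m) Y) :
  abpi_map (S (S N)) phi (class_pairing H x y) ==
  class_pairing H' (pi_map (S n) f x) (pi_map (S m) g y).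
Proof.
revert x; refine (pi_ind (gset _) (fun x => _) (fun x => _) _); intro a.
revert y; refine (pi_ind (gset _) (fun x => _) (fun x => _) _); intro b.
refine (_ @ ap (fun u => class_pairing H' u _)
  (eq_to_id (pi_map_tr n f a))^-1).
refine (_ @ ap (class_pairing H' _) (eq_to_id (pi_map_tr m g b))^-1).
refine (_ @ (eq_to_id (class_pairing_tr H' (iloops_map (S n) f a)
  (iloops_map (S m) g b)))^-1).
refine (ap (abpi_map (S (S N)) phi) (eq_to_id (class_pairing_tr H a b)) @ _).
refine (shift_natural phi _ @ _).
exact (ap (fun p => shift Z' (tr 0 p))
  (pairing_natural n (S m) f g phi H H' k a b)).
Qed.

Definition post {X Y Z K : pType} (G : pMap Z K) (H : pMap Y (PMap X Z)) :
  pMap Y (PMap X K).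
Proof.
exists (fun y => pcompose G (H y : pMap X Z)).
refine (ap (fun h : pMap X Z => pcompose G h : PMap X K) (pmap_pt H) @ _).
refine (path_pmap (f := pcompose G (pconst X Z)) (g := pconst X K)
  (fun _ => pmap_pt G) _).
cbn; rewrite ap_idp, concat_idp; exact (idp_concat _)^-1.
Defined.

Lemma pcompose_id_r {X Z : pType} (h : pMap X Z) : h == pcompose h (pid X).
Proof.
refine (path_pmap (f := h) (g := pcompose h (pid X)) (fun x => idp _) _).
cbn; rewrite ap_idp; exact (idp_concat _ @ idp_concat _).
Qed.

Lemma pi_map_id (j : nat) {X : pType} (x : pi (S j) X) :
  pi_map (S j) (pid X) x == x.
Proof.
revert x; refine (pi_ind (gset (pi (S j) X)) (fun x => _) (fun x => x) _).
intro a; refine (eq_to_id (pi_map_tr j (pid X) a) @ _).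
exact (ap (tr 0) (pmap_path_at (iloops_map_id (S j) X) a)).
Qed.

Lemma class_pairing_post {X Y Z K : pType} (G : pMap Z K)
  (H : pMap Y (PMap X Z)) (x : pi (S n) X) (y : pi (S m) Y) :
  abpi_map (S (S N)) G (class_pairing H x y) == class_pairing (post G H) x y.
Proof.
refine (class_pairing_natural (pid X) (pid Y) G H (post G H) _ x y @ _).
- intro y'; exact (pcompose_id_r _).
- exact (ap (fun u => class_pairing _ u _) (pi_map_id n x)
         @ ap (class_pairing _ x) (pi_map_id m y)).
Qed.

Definition smash_pairing (X Y : pType) (aX : Abelianization (pi (S n) X))
  (aY : Abelianization (pi (S m) Y)) :
  Hom aX (HomAb aY (abpi (S (S N)) (Smash X Y))) :=
  bilinear (class_pairing (smash_incl X Y))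
    (class_pairing_add_l (smash_incl X Y))
    (class_pairing_add_r (smash_incl X Y)) aX aY.

Lemma smash_pairing_unit {X Y : pType} (aX : Abelianization (pi (S n) X))
  (aY : Abelianization (pi (S m) Y)) (x : pi (S n) X) (y : pi (S m) Y) :
  hom_app2 (smash_pairing X Y aX aY) (abz_unit aX x) (abz_unit aY y) ==
  class_pairing (smash_incl X Y) x y.
Proof. exact (bilinear_unit _ _ _ aX aY x y). Qed.

Lemma smash_pairing_natural {X X' Y Y' : pType}
  (aX : Abelianization (pi (S n) X)) (aX' : Abelianization (pi (S n) X'))
  (aY : Abelianization (pi (S m) Y)) (aY' : Abelianization (pi (S m) Y'))
  (f : pMap X X') (g : pMap Y Y') (a : aX) (b : aY) :
  abpi_map (S (S N)) (smash_map f g)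
    (hom_app2 (smash_pairing X Y aX aY) a b) ==
  hom_app2 (smash_pairing X' Y' aX' aY')
    (abz_map aX aX' (pi_map (S n) f) a) (abz_map aY aY' (pi_map (S m) g) b).
Proof.
pose (t := smash_pairing X Y aX aY); pose (t' := smash_pairing X' Y' aX' aY').
pose (fa := abz_map aX aX' (pi_map (S n) f)).
pose (gb := abz_map aY aY' (pi_map (S m) g)).
pose (phi := abpi_map (S (S N)) (smash_map f g)).
revert a; refine (abz_path aX
  (A := abpi (S (S N)) (Smash X' Y'))
  (hom_compose phi (hom_compose (hom_eval b) t))
  (hom_compose (hom_compose (hom_eval (gb b)) t') fa) _).
intro x; revert b; refine (abz_path aY
  (A := abpi (S (S N)) (Smash X' Y'))
  (hom_compose phi (t (abz_unit aX x) : Hom aY _))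
  (hom_compose (t' (fa (abz_unit aX x)) : Hom aY' _) gb) _).
intro y.
refine (ap phi (smash_pairing_unit aX aY x y) @ _).
refine (class_pairing_natural f g _ _ (smash_incl X' Y')
  (smash_map_natural f g) x y @ _).
refine ((smash_pairing_unit aX' aY' _ _)^-1 @ _).
exact (ap (fun u => hom_app2 t' u _) (abz_map_unit _ aX' _ x)^-1
  @ ap (hom_app2 t' _) (abz_map_unit _ aY' _ y)^-1).
Qed.

End Fixed.
End GroupPairing.
(** * The pairing is universal *)

Section Universal.
Context {TT : TypeTheory} {HT : HoTT} (n m N : nat) (e : m + S n = S N)
  {X Y : pType} (cX : IsConnected n X) (cY : IsConnected m Y).

Notation cpair := (class_pairing n m N e).

(** The dimension of [A] splits into [S n] for [PMap Y A], to be used with maps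
    out of [X], and [S m] for its loops, to be used with maps out of [Y]. *)
Lemma istrunc_PMap {A : pType} (hA : IsTrunc (S (S N)) A) :
  IsTrunc (S n) (PMap Y A).
Proof.
pose proof (h := istrunc_Ext (nat_connected_path cY) (S (S (S n)))
  (fun _ => A)).
rewrite tadd_tadd in h.
rewrite nat_to_trunc_tadd in hA |- *.
refine (h _ pt); intros _.
replace (S (S (S n)) + S m) with (S (S (S (S N)))) by lia; exact hA.
Qed.

Lemma istrunc_iloops {A : pType} (hA : IsTrunc (S (S N)) A) :
  IsTrunc (S m) (iloops (S n) A).
Proof.
apply (iloops_istrunc (S n)); replace (S n + S m) with (S (S N)) by lia.
exact hA.
Qed.

Lemma pair_swap {A : pType} (F : pMap X (PMap Y A)) (H : pMap Y (PMap X A))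
  (k : forall y, pcompose (pev y) F == (H y : pMap X A))
  (a : iloops (S n) X) (y : pi (S m) Y) :
  cpair H (tr 0 (a : loops (iloops n X))) y ==
  shift n m N e A (pi_map (S m)
    (iloops_PMap (S n) Y A (iloops_map (S n) F a) : pMap _ _) y).
Proof.
revert y; refine (pi_ind (gset _) (fun y => _) (fun y => _) _); intro b.
refine (eq_to_id (class_pairing_tr n m N e H a b) @ _).
refine (ap (fun p => shift n m N e A (tr 0 p))
  (pairing_swap n (S m) F H k a b) @ _).
exact (ap (shift n m N e A) (eq_to_id (pi_map_tr m _ b))^-1).
Qed.

Lemma pi_map_mul {L : pType} (u v : pMap Y (loops L)) (y : pi (S m) Y) :
  pi_map (S m) (pmap_mul u v) y ==
  gop (pi_map (S m) u y) (pi_map (S m) v y).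
Proof.
revert y; refine (pi_ind (gset (pi (S m) (loops L))) (fun y => _)
  (fun y => _) _); intro b.
refine (eq_to_id (pi_map_tr m _ b) @ _).
refine (ap (tr 0) (iloops_map_mul m u v b) @ _).
refine (eq_to_id (eq_sym (tr_concat_tr (iloops m (loops L))
  (iloops_map (S m) u b) (iloops_map (S m) v b))) @ _).
exact (ap (fun z => gop z _) (eq_to_id (pi_map_tr m u b))^-1
  @ ap (gop _) (eq_to_id (pi_map_tr m v b))^-1).
Qed.

Lemma iloops_PMap_concat {A : pType} (p q : iloops (S n) (PMap Y A)) :
  (iloops_PMap (S n) Y A (p @ q : loops (iloops n (PMap Y A))) : pMap _ _) ==
  pmap_mul (L := iloops n A) (iloops_PMap (S n) Y A p : pMap _ _)
    (iloops_PMap (S n) Y A q : pMap _ _).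
Proof.
refine (path_pmap_loops (Y := iloops n A) (fun y => _)).
refine (iloops_PMap_at (S n) _ y @ _).
refine (loops_map_concat (iloops_map n (pev y)) p q @ _).
exact (ap (fun r : loops (iloops n A) => r @ _) (iloops_PMap_at (S n) p y)^-1
  @ ap (fun r : loops (iloops n A) => _ @ r) (iloops_PMap_at (S n) q y)^-1).
Qed.

Section Target.
Context {C : AbGroup} {A : pType} (d : EMData C (S N) A).

Let hA : IsTrunc (S (S N)) A := snd (fst (fst d)).

Definition coeff : Hom (loop_group (iloops m (iloops (S n) A))) C :=
  hom_compose (EM_pi d) (shift n m N e A).

Lemma isequiv_coeff : IsEquiv coeff.
Proof. exact (isequiv_compose (isequiv_shift n m N e A) (isequiv_EM_pi d)). Qed.

Section Realize.
Context (beta : pi (S n) X -> Hom (pi (S m) Y) C)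
  (hb : forall x x' y, beta (gop x x') y == gop (beta x y) (beta x' y)).

Lemma realize_at (x : pi (S n) X) : {p : iloops (S n) (PMap Y A) &
  forall y, coeff (pi_map (S m) (iloops_PMap (S n) Y A p : pMap _ _) y) ==
            beta x y}.
Proof.
destruct (pi_surj m cY (istrunc_iloops hA)
  (hom_compose (hom_inv coeff isequiv_coeff) (beta x))) as [psi hpsi].
pose (E := isequiv_iloops_PMap (S n) Y A).
exists (equiv_inv E psi); intro y.
refine (ap (fun f : pMap Y (iloops (S n) A) => coeff (pi_map (S m) f y))
  (equiv_inv_r E psi) @ _).
exact (ap coeff (hpsi y) @ equiv_inv_r isequiv_coeff _).
Qed.

Lemma iloops_PMap_injective (p q : iloops (S n) (PMap Y A)) :
  (forall y, coeff (pi_map (S m) (iloops_PMap (S n) Y A p : pMap _ _) y) ==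
             coeff (pi_map (S m) (iloops_PMap (S n) Y A q : pMap _ _) y)) ->
  p == q.
Proof.
intro h; apply (equiv_injective (isequiv_iloops_PMap (S n) Y A)).
refine (pi_inj m cY (istrunc_iloops hA) _ _ _); intro y.
exact (equiv_injective isequiv_coeff (h y)).
Qed.

(** [beta] gives for each [x] an element of [pi (S n) (PMap Y A)] by
    [realize_at], multiplicatively in [x], hence a map [X -> PMap Y A], and this
    is uncurried. *)
Lemma realize : {G : pMap (Smash X Y) A & forall x y,
  EM_pi d (abpi_map (S (S N)) G (cpair (smash_incl X Y) x y)) == beta x y}.
Proof.
pose (q := fun x => projT1 (realize_at x)).
assert (hq : forall x x', q (gop x x') ==
  (q x @ q x' : loops (iloops n (PMap Y A)))).
{ intros x x'; apply iloops_PMap_injective; intro y.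
  refine (projT2 (realize_at (gop x x')) y @ hb x x' y @ _).
  refine (_ @ ap (fun f : pMap Y (iloops (S n) A) => coeff (pi_map (S m) f y))
    (iloops_PMap_concat (q x) (q x'))^-1).
  refine (_ @ ap coeff (pi_map_mul (L := iloops n A) _ _ y)^-1).
  refine (_ @ (hom_op coeff _ _)^-1).
  exact (ap (fun u => gop u _) (projT2 (realize_at x) y)^-1
    @ ap (gop _) (projT2 (realize_at x') y)^-1). }
pose (h := existT _ (fun x => tr 0 (q x : loops (iloops n (PMap Y A))))
  (fun x x' => ap (tr 0) (hq x x') @ eq_to_id (eq_sym (tr_concat_tr
     (iloops n (PMap Y A)) (q x) (q x')))) :
  Hom (pi (S n) X) (pi (S n) (PMap Y A))).
destruct (pi_surj n cX (istrunc_PMap hA) h) as [F hF].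
destruct (uncurry F) as [G hG].
exists G; intros x y.
refine (ap (EM_pi d) (class_pairing_post n m N e G _ x y) @ _).
revert x; refine (pi_ind (gset _) (fun x => _) (fun x => _) _); intro a.
refine (ap (EM_pi d) (pair_swap F (post G (smash_incl X Y))
  (fun y => (hG y)^-1) a y) @ _).
assert (k : iloops_map (S n) F a == q (tr 0 (a : loops (iloops n X)))).
{ refine (tr_injective (A := loops (iloops n (PMap Y A))) _
    (eq_to_id (eq_sym (pi_map_tr n F a)) @ hF (tr 0 a))).
  assert (t : IsTrunc (n + 1) (PMap Y A)).
  { rewrite <- plus_n_Sm, <- plus_n_O; exact (istrunc_PMap hA). }
  exact (iloops_istrunc n t pt pt). }
refine (ap (fun p => coeff (pi_map (S m)
  (iloops_PMap (S n) Y A p : pMap _ _) y)) k @ _).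
exact (projT2 (realize_at _) y).
Qed.

End Realize.

(** The map into [A] that represents [h] becomes trivial after currying, since
    each of the two bijections with homomorphisms is injective. *)
Lemma vanish (h : Hom (abpi (S (S N)) (Smash X Y)) C) :
  (forall x y, h (cpair (smash_incl X Y) x y) == gid C) ->
  forall z, h z == gid C.
Proof.
intro h0.
assert (cZ : IsConnected (S N) (Smash X Y)).
{ replace N with (n + m) by lia; exact (smash_connected cX cY). }
pose (E := isequiv_EM_pi d).
destruct (pi_surj (S N) cZ hA (hom_compose (hom_inv (EM_pi d) E) h))
  as [G hG].
assert (hG' : forall z : abpi (S (S N)) (Smash X Y),
  EM_pi d (abpi_map (S (S N)) G z) == h z).
{ intro z; exact (ap (EM_pi d) (hG z) @ equiv_inv_r E (h z)). }
assert (kc : curry G == pconst X (PMap Y A)).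
{ refine (pi_inj n cX (istrunc_PMap hA) _ _ _).
  refine (pi_ind (gset (pi (S n) (PMap Y A))) (fun x => _) (fun x => _) _).
  intro a.
  refine (eq_to_id (pi_map_tr n _ a) @ _ @ (eq_to_id (pi_map_tr n _ a))^-1).
  refine (ap (tr 0) _); refine (iloops_PMap_injective _ _ _); intro y.
  refine (ap (EM_pi d) (pair_swap (curry G) (post G (smash_incl X Y))
    (pev_curry G) a y)^-1 @ _).
  refine (ap (EM_pi d) (class_pairing_post n m N e G _ _ y)^-1 @ _).
  refine (hG' _ @ h0 _ y @ _).
  refine ((hom_gid coeff)^-1 @ ap coeff _).
  revert y; refine (pi_ind (gset (pi (S m) (iloops (S n) A)))
    (fun y => _) (fun y => _) _); intro b.
  refine (_ @ (eq_to_id (pi_map_tr m _ b))^-1).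
  refine (ap (tr 0) (_ @ _)^-1).
  - refine (iloops_map_path (S m) (g := pconst Y (iloops (S n) A)) _ b).
    refine (ap (fun p => iloops_PMap (S n) Y A p)
      (pmap_path_at (iloops_map_const (S n) X (PMap Y A)) a) @ _).
    exact (pmap_pt (iloops_PMap (S n) Y A)).
  - exact (pmap_path_at (iloops_map_const (S m) Y (iloops (S n) A)) b). }
pose proof (gc := curry_const G kc).
intro z; refine ((hG' z)^-1 @ _).
refine (ap (fun G => EM_pi d (abpi_map (S (S N)) G z)) gc @ _).
refine (_ @ hom_gid (EM_pi d)); refine (ap (EM_pi d) _).
revert z; refine (pi_ind (gset (abpi (S (S N)) A)) (fun y => _) (fun y => _) _).
intro p; refine (eq_to_id (loop_group_map_tr _ p) @ _).
exact (ap (tr 0) (pmap_path_at (iloops_map_const (S (S N)) (Smash X Y) A) p)).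
Qed.

End Target.

Theorem smash_pairing_tensor (aX : Abelianization (pi (S n) X))
  (aY : Abelianization (pi (S m) Y)) :
  IsTensorProduct (smash_pairing n m N e X Y aX aY).
Proof.
intro C; destruct (EM_exists C (S N)) as [A d].
refine (isequiv_bijective _ _ _).
- intros h h' k; refine (hom_path _); intro z.
  pose (D := hom_add C h (hom_opp C h')).
  assert (hD : D z == gid C).
  { refine (vanish d D _ z); intros x y.
    refine (ap (fun u => gop u (ginv (h' (cpair _ x y)))) _
      @ gop_inv_r C (h' (cpair (smash_incl X Y) x y))).
    refine (ap h (smash_pairing_unit n m N e aX aY x y)^-1 @ _
      @ ap h' (smash_pairing_unit n m N e aX aY x y)).
    exact (ap (fun t : Hom aX (HomAb aY C) =>
      hom_app2 t (abz_unit aX x) (abz_unit aY y)) k). }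
  refine ((gop_id_r C _)^-1 @ ap (gop _) (gop_inv_l C (h' z))^-1 @ _).
  refine ((gop_assoc C _ _ _)^-1 @ ap (fun u => gop u _) hD @ gop_id_l C _).
- intro B.
  pose (beta := fun x : pi (S n) X =>
    hom_compose (B (abz_unit aX x) : Hom aY C) (abz_unit aY)).
  destruct (realize d beta) as [G hG].
  { intros x x' y.
    exact (ap (fun u => hom_app2 B u (abz_unit aY y)) (hom_op (abz_unit aX) x x')
      @ ap (fun f : Hom aY C => f (abz_unit aY y)) (hom_op B _ _)). }
  exists (hom_compose (EM_pi d) (abpi_map (S (S N)) G)).
  refine (hom_path _); intro a.
  refine (hom_path (f := hom_compose (hom_compose (EM_pi d)
    (abpi_map (S (S N)) G)) (smash_pairing n m N e X Y aX aY a : Hom aY _))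
    (g := (B a : Hom aY C)) _); intro b.
  refine (abz_path2 aX aY (tensor_pre (smash_pairing n m N e X Y aX aY) C
    (hom_compose (EM_pi d) (abpi_map (S (S N)) G))) B _ a b).
  intros x y; refine (_ @ hG x y).
  exact (ap (fun u => EM_pi d (abpi_map (S (S N)) G u))
    (smash_pairing_unit n m N e aX aY x y)).
Qed.

End Universal.

Theorem theoremS (TT : TypeTheory) (HT : HoTT)
  (ab : forall G : Group, Abelianization G)
  (n m : nat) (hn : 1 <= n) (hm : 1 <= m) :
  (forall X Y : pType, IsConnected (pred n) X -> IsConnected (pred m) Y ->
     IsConnected (pred (n + m)) (Smash X Y)) *
  {t : forall X Y : pType, IsConnected (pred n) X -> IsConnected (pred m) Y ->
         Hom (ab (pi n X)) (HomAb (ab (pi m Y)) (abpi (n + m) (Smash X Y))) &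
    (forall (X X' Y Y' : pType)
        (cX : IsConnected (pred n) X) (cX' : IsConnected (pred n) X')
        (cY : IsConnected (pred m) Y) (cY' : IsConnected (pred m) Y')
        (f : pMap X X') (g : pMap Y Y')
        (a : ab (pi n X)) (b : ab (pi m Y)),
        abpi_map (n + m) (smash_map f g) (hom_app2 (t X Y cX cY) a b) ==
        hom_app2 (t X' Y' cX' cY')
          (abz_map (ab (pi n X)) (ab (pi n X')) (pi_map n f) a)
          (abz_map (ab (pi m Y)) (ab (pi m Y')) (pi_map m g) b)) *
    (forall (X Y : pType)
        (cX : IsConnected (pred n) X) (cY : IsConnected (pred m) Y),
        IsTensorProduct (t X Y cX cY))}.
Proof.
destruct n as [|n]; [lia|]; destruct m as [|m]; [lia|].
assert (k : S n + S m = S (S (n + m))) by lia.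
assert (e : m + S n = S (n + m)) by lia.
rewrite k; cbn [pred]; split.
- intros X Y cX cY; exact (smash_connected cX cY).
- exists (fun X Y _ _ => smash_pairing n m (n + m) e X Y
    (ab (pi (S n) X)) (ab (pi (S m) Y))); split.
  + intros; exact (smash_pairing_natural n m (n + m) e _ _ _ _ f g a b).
  + intros X Y cX cY.
    exact (smash_pairing_tensor n m (n + m) e cX cY _ _).
Qed.
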